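(* Let $A$ be a strongly graded connected $S$-ring which has a bimodule of relations $R$. Let $P$ be an $S$-subbimodule of $T_A$ such that $R\subseteq R_P$. Assume that $R$ and $A^1$ are projective as left $S$-modules, and that $R_P$ is a projective $S$-bimodule. The $S$-ring $U(P)$ is a PBW-deformation of $A$ if and only if $\langle R\rangle=\langle R_P\rangle$, there exists a morphism of filtered $S$-bimodules $\alpha:R\to T_A$ such that $\alpha(R)\subseteq P\subseteq\langle\alpha(R)\rangle$, and either $c(A)=-1$ or $\alpha(R)$ satisfies the Jacobi conditions $(\mathcal J_n)$ for $1\le n\le c(A)$.
   Context: $S$ is an associative unital ring, $\otimes=\otimes_S$. A positively graded $S$-ring $A$ is connected if $A^0=S$ and strongly graded if $A^nA^m=A^{n+m}$. $T:=T_A:=T_S(A^1)$ is the tensor $S$-ring, $I_A$ the kernel of the canonical surjection $T_A\to A$. A bimodule of relations for $A$ is a graded $S$-subbimodule $R\subseteq I_A$ with $I_A=R\oplus(A^1I_A+I_AA^1)$ (it then generates $I_A$). $p^n:T\to T^n$ is the projection, $T^{\le n}=\bigoplus_{m\le n}T^m$, $X^{\le n}=X\cap T^{\le n}$, $\langle X\rangle$ the two-sided ideal generated by $X$. For an $S$-subbimodule $P\subseteq T$: $R_P:=\bigoplus_np^n(P^{\le n})$; $U(P):=T/\langle P\rangle$, filtered by the images of $T^{\le n}$. $U(P)$ is a PBW-deformation of $A=T/\langle R\rangle$ if the graded $S$-ring map $T/\langle R\rangle\to\operatorname{gr}U(P)$, $x+\langle R\rangle\mapsto(x+\langle P\rangle)+U(P)^{\le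 n-1}$ ($x\in T^n$), is an isomorphism. A morphism of filtered $S$-bimodules $\alpha:R\to T$ is an $S$-bimodule map with $\alpha(R^n)\subseteq T^{\le n}$, by convention always satisfying $p^n\alpha(r)=r$ for $r\in R^n$. For a subbimodule $Q\subseteq T$, $(\mathcal J_n)$ is the condition $Q_{n+1}\cap T^{\le n}\subseteq Q_n$, where $Q_n:=\sum_{i+j+k=n}T^{\le i}Q^{\le j}T^{\le k}$. The homological complexity $c(A)$ is $-1$ if $\operatorname{Tor}_3^A(S,S)=0$, and otherwise $c(A)=\sup\{n-1\mid\operatorname{Tor}^A_{3,n}(S,S)\ne0\}$, with $n$ the internal degree (if $c(A)=\infty$ all $(\mathcal J_n)$, $n\ge1$, are required). *)

(* Defs.v *)
From HB Require Import structures.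
From mathcomp Require Import all_boot all_order all_algebra.
From mathcomp Require Import boolp classical_sets constructive_ereal.

Set Implicit Arguments.
Unset Strict Implicit.
Unset Printing Implicit Defensive.

Import Order.TTheory GRing.Theory Num.Theory.
Local Open Scope classical_set_scope.
Local Open Scope quotient_scope.
Local Open Scope ring_scope.

HB.mixin Record Zmodule_isRmodule (S : pzRingType) M of GRing.Zmodule M := {
  rscale : M -> S -> M;
  rscaleA : forall x a b, rscale (rscale x a) b = rscale x (a * b);
  rscale1 : forall x, rscale x 1 = x;
  rscaleDl : forall x y a, rscale (x + y) a = rscale x a + rscale y a;
  rscaleDr : forall x a b, rscale x (a + b) = rscale x a + rscale x b
}.

#[short(type="rmodType")]
HB.structure Definition Rmodule (S : pzRingType) :=
  {M of GRing.Zmodule M & Zmodule_isRmodule S M}.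

HB.mixin Record LRmodule_isBimodule (S : pzRingType) M
    of GRing.Lmodule S M & Rmodule S M := {
  scale_rscale : forall (a b : S) (x : M), a *: rscale x b = rscale (a *: x) b
}.

#[short(type="bimodType")]
HB.structure Definition Bimodule (S : pzRingType) :=
  {M of GRing.Lmodule S M & Rmodule S M & LRmodule_isBimodule S M}.

Section RegularBimodule.
Variable S : pzRingType.

Lemma regular_rscale_compat (a b : S) (x : S^o) :
  a *: ((x : S) * b : S^o) = ((a *: x : S^o) : S) * b :> S^o.
Proof. exact: mulrA. Qed.

HB.instance Definition _ := Zmodule_isRmodule.Build S S^o
  (fun x a b => esym (mulrA (x : S) a b)) (@mulr1 S)
  (fun x y a => mulrDl (x : S) y a) (fun x a b => mulrDr (x : S) a b).
HB.instance Definition _ :=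
  LRmodule_isBimodule.Build S S^o regular_rscale_compat.
End RegularBimodule.

Definition left_projective (S : pzRingType) (M : lmodType S) : Prop :=
  forall (N N' : lmodType S) (g : {linear N -> N'}) (h : {linear M -> N'}),
    (forall y, exists x, g x = y) ->
    exists k : {linear M -> N}, forall x, g (k x) = h x.

Definition rlinear (S : pzRingType) (M N : bimodType S) (f : M -> N) : Prop :=
  forall x a, f (rscale x a) = rscale (f x) a.

Definition bimod_projective (S : pzRingType) (M : bimodType S) : Prop :=
  forall (N N' : bimodType S) (g : {linear N -> N'}) (h : {linear M -> N'}),
    rlinear g -> rlinear h -> (forall y, exists x, g x = y) ->
    exists2 k : {linear M -> N}, rlinear k & forall x, g (k x) = h x.

Definition subgroup (M : zmodType) (X : set M) : Prop :=
  X 0 /\ forall x y, X x -> X y -> X (x - y).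

Definition addspan (M : zmodType) (X : set M) : set M :=
  smallest (@subgroup M) X.

Definition setadd (M : zmodType) (X Y : set M) : set M :=
  [set x + y | x in X & y in Y].

Definition setmulspan (B : pzRingType) (X Y : set B) : set B :=
  addspan [set x * y | x in X & y in Y].

Record subbimod (S : pzRingType) (M : bimodType S) := Subbimod {
  sbset :> set M;
  sb_subgroup : subgroup sbset;
  sb_scale : forall a x, sbset x -> sbset (a *: x);
  sb_rscale : forall x a, sbset x -> sbset (rscale x a)
}.

Section SubbimodType.
Variables (S : pzRingType) (M : bimodType S) (X : subbimod M).

Definition sbpred : {pred M} := fun x => x \in sbset X.

Lemma sbpredP x : reflect (sbset X x) (x \in sbpred).
Proof. by apply: (iffP idP) => [/set_mem|/mem_set]. Qed.

Lemma sbpred_zmod_closed : zmod_closed sbpred.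
Proof.
case: (sb_subgroup X) => X0 XB; split; first exact/sbpredP.
by move=> x y /sbpredP Xx /sbpredP Xy; apply/sbpredP/XB.
Qed.

HB.instance Definition _ :=
  GRing.isZmodClosed.Build M sbpred sbpred_zmod_closed.

Definition sbtype := {x : M | x \in sbpred}.

HB.instance Definition _ := SubChoice.on sbtype.
HB.instance Definition _ := [SubChoice_isSubZmodule of sbtype by <:].

Lemma sb_scaleP a (x : sbtype) : a *: val x \in sbpred.
Proof. exact/sbpredP/sb_scale/sbpredP/valP. Qed.

Lemma sb_rscaleP (x : sbtype) a : rscale (val x) a \in sbpred.
Proof. exact/sbpredP/sb_rscale/sbpredP/valP. Qed.

Let lsc a (x : sbtype) : sbtype := Sub (a *: val x) (sb_scaleP a x).
Let rsc (x : sbtype) a : sbtype := Sub (rscale (val x) a) (sb_rscaleP x a).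

Fact sb_lscA a b v : lsc a (lsc b v) = lsc (a * b) v.
Proof. by apply: val_inj; rewrite !SubK scalerA. Qed.
Fact sb_lsc1 : left_id 1 lsc.
Proof. by move=> x; apply: val_inj; rewrite !SubK scale1r. Qed.
Fact sb_lscDr : right_distributive lsc +%R.
Proof. by move=> a x y; apply: val_inj; rewrite /= scalerDr. Qed.
Fact sb_lscDl v : {morph lsc^~ v: a b / a + b}.
Proof. by move=> a b; apply: val_inj; rewrite /= scalerDl. Qed.
HB.instance Definition _ :=
  GRing.Zmodule_isLmodule.Build S sbtype sb_lscA sb_lsc1 sb_lscDr sb_lscDl.

Fact sb_rscA x a b : rsc (rsc x a) b = rsc x (a * b).
Proof. by apply: val_inj; rewrite !SubK rscaleA. Qed.
Fact sb_rsc1 x : rsc x 1 = x.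
Proof. by apply: val_inj; rewrite !SubK rscale1. Qed.
Fact sb_rscDl x y a : rsc (x + y) a = rsc x a + rsc y a.
Proof. by apply: val_inj; rewrite /= rscaleDl. Qed.
Fact sb_rscDr x a b : rsc x (a + b) = rsc x a + rsc x b.
Proof. by apply: val_inj; rewrite /= rscaleDr. Qed.
HB.instance Definition _ :=
  Zmodule_isRmodule.Build S sbtype sb_rscA sb_rsc1 sb_rscDl sb_rscDr.

Fact sb_lrsc (a b : S) (x : sbtype) : a *: rscale x b = rscale (a *: x) b.
Proof. by apply: val_inj; rewrite /= scale_rscale. Qed.
HB.instance Definition _ := LRmodule_isBimodule.Build S sbtype sb_lrsc.

End SubbimodType.

Section Tensor.
Variables (A : pzRingType) (X : rmodType A) (Y : lmodType A).

(* The sequence [:: (x1, y1); ...; (xn, yn)] stands for the formal sum of the *)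
(* xi (x) yi; an opposite is not needed since - (x (x) y) = (- x) (x) y.      *)
Inductive tens_eq : seq (X * Y) -> seq (X * Y) -> Prop :=
| tens_eq_refl s : tens_eq s s
| tens_eq_sym s t : tens_eq s t -> tens_eq t s
| tens_eq_trans s t u : tens_eq s t -> tens_eq t u -> tens_eq s u
| tens_eq_cat s s' t t' :
    tens_eq s s' -> tens_eq t t' -> tens_eq (s ++ t) (s' ++ t')
| tens_eq_comm s t : tens_eq (s ++ t) (t ++ s)
| tens_eq_0l y : tens_eq [:: (0, y)] [::]
| tens_eq_Dl x x' y : tens_eq [:: (x + x', y)] [:: (x, y); (x', y)]
| tens_eq_Dr x y y' : tens_eq [:: (x, y + y')] [:: (x, y); (x, y')]
| tens_eq_balanced x a y : tens_eq [:: (rscale x a, y)] [:: (x, a *: y)].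

Definition tens_rel (s t : seq (X * Y)) : bool := `[< tens_eq s t >].

Lemma tens_rel_refl : reflexive tens_rel.
Proof. by move=> s; apply/asboolP; apply: tens_eq_refl. Qed.
Lemma tens_rel_sym : symmetric tens_rel.
Proof. by move=> s t; apply/asbool_equiv_eq; split; apply: tens_eq_sym. Qed.
Lemma tens_rel_trans : transitive tens_rel.
Proof.
by move=> s t u /asboolP st /asboolP tu; apply/asboolP; apply: tens_eq_trans tu.
Qed.

Canonical tens_equiv := EquivRel tens_rel tens_rel_refl tens_rel_sym tens_rel_trans.

Definition tens := {eq_quot tens_equiv}.
HB.instance Definition _ := Choice.on tens.
HB.instance Definition _ := EqQuotient.on tens.

Let pit (s : seq (X * Y)) : tens := \pi_tens s.

Lemma tens_piP s t : pit s = pit t <-> tens_eq s t.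
Proof.
split=> [/eqmodP/asboolP //|st]; apply/eqmodP; exact/asboolP.
Qed.

Let tadd (z w : tens) : tens := pit (repr z ++ repr w).
Let topp (z : tens) : tens := pit [seq (- p.1, p.2) | p <- repr z].

Lemma tens_repr s : tens_eq (repr (pit s)) s.
Proof. by apply/tens_piP; rewrite /pit reprK. Qed.

Lemma tens_addE s t : tadd (pit s) (pit t) = pit (s ++ t).
Proof. by apply/tens_piP/tens_eq_cat; apply: tens_repr. Qed.

Lemma tens_oppE s : topp (pit s) = pit [seq (- p.1, p.2) | p <- s].
Proof.
apply/tens_piP; have := tens_repr s; rewrite -/(pit s).
move: (repr _) => s'; elim=> {s s'} /= [*|*|s t u _ IH1 _ IH2|s s' t t' _ IH1 _ IH2|s t|y|x x' y|x y y'|x a y].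
- exact: tens_eq_refl.
- exact: tens_eq_sym.
- exact: tens_eq_trans IH2.
- by rewrite !map_cat; apply: tens_eq_cat.
- by rewrite !map_cat; apply: tens_eq_comm.
- by rewrite oppr0; apply: tens_eq_0l.
- by rewrite opprD; apply: tens_eq_Dl.
- exact: tens_eq_Dr.
- suff -> : - rscale x a = rscale (- x) a by apply: tens_eq_balanced.
  apply: (addrI (rscale x a)); rewrite subrr -rscaleDl subrr.
  by apply: (addIr (rscale 0 a)); rewrite -rscaleDl !add0r.
Qed.

Lemma tens_surj z : exists s, z = pit s.
Proof. by exists (repr z); rewrite /pit reprK. Qed.

Fact tens_addA : associative tadd.
Proof.
move=> z w v; have [s ->] := tens_surj z; have [t ->] := tens_surj w.
by have [u ->] := tens_surj v; rewrite !tens_addE catA.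
Qed.
Fact tens_addC : commutative tadd.
Proof.
move=> z w; have [s ->] := tens_surj z; have [t ->] := tens_surj w.
by rewrite !tens_addE; apply/tens_piP/tens_eq_comm.
Qed.
Fact tens_add0 : left_id (pit [::]) tadd.
Proof. by move=> z; have [s ->] := tens_surj z; rewrite tens_addE. Qed.
Fact tens_addN : left_inverse (pit [::]) topp tadd.
Proof.
move=> z; have [s ->] := tens_surj z; rewrite tens_oppE tens_addE.
apply/tens_piP; elim: s => [|[x y] s IH] /=; first exact: tens_eq_refl.
rewrite -cat1s -[(x, y) :: s]cat1s.
apply: (@tens_eq_trans _ ([:: (- x, y)] ++ [:: (x, y)] ++ [::])); last first.
  rewrite cats0; apply: tens_eq_trans (tens_eq_0l y).
  by rewrite -(addNr x); apply/tens_eq_sym/tens_eq_Dl.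
apply: tens_eq_cat; first exact: tens_eq_refl.
apply: tens_eq_trans (tens_eq_comm _ _) _; rewrite -catA.
apply: tens_eq_cat; first exact: tens_eq_refl.
exact: tens_eq_trans (tens_eq_comm _ _) IH.
Qed.
HB.instance Definition _ :=
  GRing.isZmodule.Build tens tens_addA tens_addC tens_add0 tens_addN.

Definition tpure (x : X) (y : Y) : tens := pit [:: (x, y)].

Lemma tpureDl x x' y : tpure (x + x') y = tpure x y + tpure x' y.
Proof.
by rewrite [RHS]tens_addE; apply/tens_piP/tens_eq_Dl.
Qed.
Lemma tpureDr x y y' : tpure x (y + y') = tpure x y + tpure x y'.
Proof.
by rewrite [RHS]tens_addE; apply/tens_piP/tens_eq_Dr.
Qed.
Lemma tpure_balanced x a y : tpure (rscale x a) y = tpure x (a *: y).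
Proof. exact/tens_piP/tens_eq_balanced. Qed.

Lemma tens_ind (P : tens -> Prop) :
  P 0 -> (forall x y z, P z -> P (tpure x y + z)) -> forall z, P z.
Proof.
move=> P0 PD z; have [s ->] := tens_surj z.
elim: s => [//|[x y] s IH]; have := PD x y _ IH.
by rewrite [_ + _]tens_addE.
Qed.

Section Lift.
Variables (M : zmodType) (f : X -> Y -> M).

Definition balanced : Prop :=
  [/\ forall x x' y, f (x + x') y = f x y + f x' y,
      forall x y y', f x (y + y') = f x y + f x y' &
      forall x a y, f (rscale x a) y = f x (a *: y)].

(* The additive map induced by f, meaningful when f is balanced.              *)
Definition tens_lift (z : tens) : M := \sum_(p <- repr z) f p.1 p.2.

Hypothesis bal_f : balanced.

Lemma tens_lift_pi s : tens_lift (pit s) = \sum_(p <- s) f p.1 p.2.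
Proof.
have [fDl fDr fb] := bal_f.
rewrite /tens_lift; have := tens_repr s.
move: (repr _) => s'; elim=> {s s'} /= [*|*|s t u _ IH1 _ IH2|s s' t t' _ IH1 _ IH2|s t|y|x x' y|x y y'|x a y].
- by [].
- by [].
- by rewrite IH1.
- by rewrite !big_cat /= IH1 IH2.
- by rewrite !big_cat /= addrC.
- rewrite big_seq1 big_nil; apply: (addIr (f 0 y)).
  by rewrite -fDl !add0r.
- by rewrite !big_cons big_nil /= fDl !addr0.
- by rewrite !big_cons big_nil /= fDr !addr0.
- by rewrite !big_seq1 /= fb.
Qed.

Lemma tens_liftE x y : tens_lift (tpure x y) = f x y.
Proof. by rewrite tens_lift_pi big_seq1. Qed.

Lemma tens_liftD z w : tens_lift (z + w) = tens_lift z + tens_lift w.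
Proof.
have [s ->] := tens_surj z; have [t ->] := tens_surj w.
by rewrite [_ + _]tens_addE !tens_lift_pi big_cat.
Qed.

Lemma tens_lift0 : tens_lift 0 = 0.
Proof. by rewrite [0]/(pit [::]) tens_lift_pi big_nil. Qed.

End Lift.
End Tensor.

Section TensorBimodule.
Variables (S : pzRingType) (V W : bimodType S).
Implicit Types (a b : S) (z : tens V W).

Fact tens_lsc_balanced a : balanced (fun (v : V) (w : W) => tpure (a *: v) w).
Proof.
split=> *; rewrite ?scalerDr ?tpureDl ?tpureDr //.
by rewrite scale_rscale tpure_balanced.
Qed.

Fact tens_rsc_balanced a : balanced (fun (v : V) (w : W) => tpure v (rscale w a)).
Proof.
split=> *; rewrite ?rscaleDl ?tpureDl ?tpureDr //.
by rewrite tpure_balanced scale_rscale.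
Qed.

Let lsc a z := tens_lift (fun (v : V) (w : W) => tpure (a *: v) w) z.
Let rsc z a := tens_lift (fun (v : V) (w : W) => tpure v (rscale w a)) z.

Let lscE a v w : lsc a (tpure v w) = tpure (a *: v) w.
Proof. exact: (tens_liftE (tens_lsc_balanced a)). Qed.
Let rscE a v w : rsc (tpure v w) a = tpure v (rscale w a).
Proof. exact: (tens_liftE (tens_rsc_balanced a)). Qed.
Let lscD a : {morph lsc a : z z' / z + z'}.
Proof. exact: (tens_liftD (tens_lsc_balanced a)). Qed.
Let rscD a : {morph rsc^~ a : z z' / z + z'}.
Proof. exact: (tens_liftD (tens_rsc_balanced a)). Qed.
Let lsc0 a : lsc a 0 = 0.
Proof. exact: (tens_lift0 (tens_lsc_balanced a)). Qed.
Let rsc0 a : rsc 0 a = 0.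
Proof. exact: (tens_lift0 (tens_rsc_balanced a)). Qed.

Fact tens_lscA a b z : lsc a (lsc b z) = lsc (a * b) z.
Proof.
elim/tens_ind: z => [|v w z IH]; first by rewrite !lsc0.
by rewrite !lscD IH !lscE scalerA.
Qed.
Fact tens_lsc1 : left_id 1 lsc.
Proof.
elim/tens_ind => [|v w z IH]; first by rewrite !lsc0.
by rewrite !lscD IH !lscE scale1r.
Qed.
Fact tens_lscDr : right_distributive lsc +%R.
Proof. by move=> a; apply: lscD. Qed.
Fact tens_lscDl z : {morph lsc^~ z : a b / a + b}.
Proof.
move=> a b; elim/tens_ind: z => [|v w z IH]; first by rewrite !lsc0 addr0.
by rewrite !lscD IH !lscE scalerDl tpureDl addrACA.
Qed.
HB.instance Definition _ := GRing.Zmodule_isLmodule.Build S (tens V W)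
  tens_lscA tens_lsc1 tens_lscDr tens_lscDl.

Fact tens_rscA z a b : rsc (rsc z a) b = rsc z (a * b).
Proof.
elim/tens_ind: z => [|v w z IH]; first by rewrite !rsc0.
by rewrite !rscD IH !rscE rscaleA.
Qed.
Fact tens_rsc1 z : rsc z 1 = z.
Proof.
elim/tens_ind: z => [|v w z IH]; first by rewrite !rsc0.
by rewrite !rscD IH !rscE rscale1.
Qed.
Fact tens_rscDl z z' a : rsc (z + z') a = rsc z a + rsc z' a.
Proof. exact: rscD. Qed.
Fact tens_rscDr z a b : rsc z (a + b) = rsc z a + rsc z b.
Proof.
elim/tens_ind: z => [|v w z IH]; first by rewrite !rsc0 addr0.
by rewrite !rscD IH !rscE rscaleDr tpureDr addrACA.
Qed.
HB.instance Definition _ := Zmodule_isRmodule.Build S (tens V W)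
  tens_rscA tens_rsc1 tens_rscDl tens_rscDr.

Fact tens_lrsc a b z : a *: rscale z b = rscale (a *: z) b.
Proof.
change (lsc a (rsc z b) = rsc (lsc a z) b).
elim/tens_ind: z => [|v w z IH]; first by rewrite !(rsc0, lsc0).
by rewrite !(rscD, lscD) IH !(rscE, lscE).
Qed.
HB.instance Definition _ := LRmodule_isBimodule.Build S (tens V W) tens_lrsc.

Lemma scale_tpure a (v : V) (w : W) : a *: tpure v w = tpure (a *: v) w.
Proof. exact: lscE. Qed.
Lemma rscale_tpure a (v : V) (w : W) : rscale (tpure v w) a = tpure v (rscale w a).
Proof. exact: rscE. Qed.

End TensorBimodule.

(* A grading M = \bigoplus_n M^n is given by its projections gproj n.         *)
HB.mixin Record Zmodule_isGraded M of GRing.Zmodule M := {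
  gproj : nat -> M -> M;
  gprojD : forall n x y, gproj n (x + y) = gproj n x + gproj n y;
  gproj_orth : forall m n x,
    gproj m (gproj n x) = if m == n then gproj n x else 0;
  gproj_fin : forall x, exists N, x = \sum_(n < N) gproj n x
}.

#[short(type="gradedZmodType")]
HB.structure Definition GradedZmodule :=
  {M of GRing.Zmodule M & Zmodule_isGraded M}.

Definition homog (M : gradedZmodType) (n : nat) : set M :=
  [set x | gproj n x = x].

Definition upto (M : gradedZmodType) (n : nat) : set M :=
  [set x | forall m, (n < m)%N -> gproj m x = 0].

Arguments homog : clear implicits.
Arguments upto : clear implicits.

Section GradedTheory.
Variable M : gradedZmodType.
Implicit Types x y : M.

Lemma gproj0 n : gproj n (0 : M) = 0.
Proof. by apply: (addIr (gproj n 0)); rewrite -gprojD !add0r. Qed.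
Lemma gprojN n x : gproj n (- x) = - gproj n x.
Proof. by apply: (addIr (gproj n x)); rewrite -gprojD !addNr gproj0. Qed.
Lemma gprojB n x y : gproj n (x - y) = gproj n x - gproj n y.
Proof. by rewrite gprojD gprojN. Qed.
Lemma gproj_sum n I r (P : pred I) (F : I -> M) :
  gproj n (\sum_(i <- r | P i) F i) = \sum_(i <- r | P i) gproj n (F i).
Proof. exact: (big_morph _ (gprojD n) (gproj0 n)). Qed.
Lemma gproj_homog n x : homog M n (gproj n x).
Proof. by rewrite /homog /= gproj_orth eqxx. Qed.
Lemma homog_neq m n x : homog M n x -> m != n -> gproj m x = 0.
Proof. by move=> /= <- /negPf mn; rewrite gproj_orth mn. Qed.
Lemma homog_subgroup n : subgroup (homog M n).
Proof.
split=> [|x y]; rewrite /homog /= ?gproj0 // => xn yn.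
by rewrite gprojB xn yn.
Qed.
Lemma upto_subgroup n : subgroup (upto M n).
Proof.
split=> [|x y] /=; first by move=> m _; rewrite gproj0.
by move=> xn yn m nm; rewrite gprojB xn // yn // subr0.
Qed.
Lemma homog_upto n x : homog M n x -> upto M n x.
Proof. by move=> xn m nm; apply: homog_neq xn _; rewrite gtn_eqF. Qed.
Lemma uptoS m n x : (m <= n)%N -> upto M m x -> upto M n x.
Proof. by move=> mn xm k nk; apply: xm; apply: leq_ltn_trans nk. Qed.
Lemma upto_fin x : exists n, upto M n x.
Proof.
have [N xE] := gproj_fin x; exists N => m Nm.
rewrite xE gproj_sum big1 // => i _; rewrite gproj_orth gtn_eqF //.
exact: ltn_trans Nm.
Qed.
End GradedTheory.

HB.mixin Record PzRing_isSRing (S : pzRingType) B of GRing.PzRing B := {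
  sunit : S -> B;
  sunitD : forall a b, sunit (a + b) = sunit a + sunit b;
  sunitM : forall a b, sunit (a * b) = sunit a * sunit b;
  sunit1 : sunit 1 = 1
}.

#[short(type="sringType")]
HB.structure Definition SRing (S : pzRingType) :=
  {B of GRing.PzRing B & PzRing_isSRing S B}.

(* The S-bimodule underlying an S-ring. This is an alias because a pzRingType *)
(* cannot be joined with an lmodType (lalgType requires a nontrivial ring).   *)
Definition sbim (S : pzRingType) (B : sringType S) : Type := B.

Section SRingBimodule.
Variables (S : pzRingType) (B : sringType S).
Implicit Types (a b : S) (x y : B).

HB.instance Definition _ := GRing.Zmodule.on (sbim B).

Let lsc a (x : sbim B) : sbim B := sunit a * (x : B).
Let rsc (x : sbim B) a : sbim B := (x : B) * sunit a.

Fact sbim_lscA a b x : lsc a (lsc b x) = lsc (a * b) x.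
Proof. by rewrite /lsc sunitM mulrA. Qed.
Fact sbim_lsc1 : left_id 1 lsc.
Proof. by move=> x; rewrite /lsc sunit1 mul1r. Qed.
Fact sbim_lscDr : right_distributive lsc +%R.
Proof. by move=> a x y; apply: mulrDr. Qed.
Fact sbim_lscDl x : {morph lsc^~ x : a b / a + b}.
Proof. by move=> a b; rewrite /lsc sunitD mulrDl. Qed.
HB.instance Definition _ := GRing.Zmodule_isLmodule.Build S (sbim B)
  sbim_lscA sbim_lsc1 sbim_lscDr sbim_lscDl.

Fact sbim_rscA x a b : rsc (rsc x a) b = rsc x (a * b).
Proof. by rewrite /rsc sunitM mulrA. Qed.
Fact sbim_rsc1 x : rsc x 1 = x.
Proof. by rewrite /rsc sunit1 mulr1. Qed.
Fact sbim_rscDl x y a : rsc (x + y) a = rsc x a + rsc y a.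
Proof. exact: mulrDl. Qed.
Fact sbim_rscDr x a b : rsc x (a + b) = rsc x a + rsc x b.
Proof. by rewrite /rsc sunitD mulrDr. Qed.
HB.instance Definition _ := Zmodule_isRmodule.Build S (sbim B)
  sbim_rscA sbim_rsc1 sbim_rscDl sbim_rscDr.
Fact sbim_lrsc a b (x : sbim B) : a *: rscale x b = rscale (a *: x) b.
Proof. exact: mulrA. Qed.
HB.instance Definition _ := LRmodule_isBimodule.Build S (sbim B) sbim_lrsc.
End SRingBimodule.

HB.mixin Record SRing_isGraded (S : pzRingType) B
    of SRing S B & GradedZmodule B := {
  sunit_homog : forall s : S, homog B 0 (sunit s);
  homogM : forall m n (x y : B),
    homog B m x -> homog B n y -> homog B (m + n) (x * y)
}.

#[short(type="gradedSRingType")]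
HB.structure Definition GradedSRing (S : pzRingType) :=
  {B of SRing S B & GradedZmodule B & SRing_isGraded S B}.

Arguments homogM {S s} [m n x y] _ _.

HB.mixin Record GradedSRing_isConnected (S : pzRingType) A of GradedSRing S A := {
  sunit_inj : injective (@sunit S A);
  sunit_surj : forall a : A, homog A 0 a -> exists s : S, sunit s = a
}.

(* A^0 = S, i.e. the unit map of A is an isomorphism onto A^0.                *)
#[short(type="connSRingType")]
HB.structure Definition ConnSRing (S : pzRingType) :=
  {A of GradedSRing S A & GradedSRing_isConnected S A}.

Definition strongly_graded (S : pzRingType) (A : gradedSRingType S) : Prop :=
  forall m n, setmulspan (homog A m) (homog A n) = homog A (m + n).

HB.mixin Record Lmodule_isGradedLmod (S : pzRingType) (A : gradedSRingType S) M
    of GRing.Lmodule A M & GradedZmodule M := {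
  homogZ : forall m n (a : A) (x : M),
    homog A m a -> homog M n x -> homog M (m + n) (a *: x)
}.

#[short(type="gradedLmodType")]
HB.structure Definition GradedLmod (S : pzRingType) (A : gradedSRingType S) :=
  {M of GRing.Lmodule A M & GradedZmodule M & Lmodule_isGradedLmod S A M}.

Section GradedSRingTheory.
Variables (S : pzRingType) (A : gradedSRingType S).

Lemma gprojZl n (s : S) (x : A) : gproj n (sunit s * x) = sunit s * gproj n x.
Proof.
have [N xE] := gproj_fin x.
rewrite {1}xE mulr_sumr gproj_sum [in RHS]xE gproj_sum mulr_sumr.
apply: eq_bigr => i _; have := homogM (sunit_homog s) (gproj_homog i x).
rewrite add0n gproj_orth => h.
by case: eqP => [->|/eqP ni]; [exact: h | rewrite (homog_neq h ni) mulr0].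
Qed.

Lemma gprojZr n (x : A) (s : S) : gproj n (x * sunit s) = gproj n x * sunit s.
Proof.
have [N xE] := gproj_fin x.
rewrite {1}xE mulr_suml gproj_sum [in RHS]xE gproj_sum mulr_suml.
apply: eq_bigr => i _; have := homogM (gproj_homog i x) (sunit_homog s).
rewrite addn0 gproj_orth => h.
by case: eqP => [->|/eqP ni]; [exact: h | rewrite (homog_neq h ni) mul0r].
Qed.

Lemma homog_scale n (s : S) (x : sbim A) :
  homog A n x -> homog A n (s *: x : sbim A).
Proof. by move=> xn; rewrite /homog /= [LHS]gprojZl xn. Qed.

Lemma homog_rscale n (x : sbim A) (s : S) :
  homog A n x -> homog A n (rscale x s).
Proof. by move=> xn; rewrite /homog /= [LHS]gprojZr xn. Qed.

Definition homog_subbimod n : subbimod (sbim A) :=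
  @Subbimod S (sbim A) (homog A n) (homog_subgroup A n)
    (@homog_scale n) (@homog_rscale n).

End GradedSRingTheory.

Section DirectSum.
Variable M : nat -> zmodType.

Record dsum := Dsum {
  dval :> forall n, M n;
  dval_fin : exists N, forall n, (N <= n)%N -> dval n = 0
}.

Lemma dsumP (x y : dsum) : (forall n, x n = y n) -> x = y.
Proof.
case: x y => [x px] [y py] /= xy.
have {}xy : x = y by exact: functional_extensionality_dep.
by subst y; congr Dsum; apply: Prop_irrelevance.
Qed.

HB.instance Definition _ := gen_eqMixin dsum.
HB.instance Definition _ := gen_choiceMixin dsum.

Fact dsum_zero_fin : exists N, forall n, (N <= n)%N -> (0 : M n) = 0.
Proof. by exists 0. Qed.
Fact dsum_opp_fin (x : dsum) : exists N, forall n, (N <= n)%N -> - x n = 0.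
Proof. by have [N xN] := dval_fin x; exists N => n /xN ->; rewrite oppr0. Qed.
Fact dsum_add_fin (x y : dsum) :
  exists N, forall n, (N <= n)%N -> x n + y n = 0.
Proof.
have [N xN] := dval_fin x; have [K yK] := dval_fin y; exists (maxn N K) => n.
by rewrite geq_max => /andP[/xN -> /yK ->]; rewrite addr0.
Qed.

Let dzero := Dsum dsum_zero_fin.
Let dopp x := Dsum (dsum_opp_fin x).
Let dadd x y := Dsum (dsum_add_fin x y).

Fact dsum_addA : associative dadd.
Proof. by move=> x y z; apply: dsumP => n; apply: addrA. Qed.
Fact dsum_addC : commutative dadd.
Proof. by move=> x y; apply: dsumP => n; apply: addrC. Qed.
Fact dsum_add0 : left_id dzero dadd.
Proof. by move=> x; apply: dsumP => n; apply: add0r. Qed.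
Fact dsum_addN : left_inverse dzero dopp dadd.
Proof. by move=> x; apply: dsumP => n; apply: addNr. Qed.
HB.instance Definition _ :=
  GRing.isZmodule.Build dsum dsum_addA dsum_addC dsum_add0 dsum_addN.

Lemma dsumDE (x y : dsum) n : (x + y) n = x n + y n. Proof. by []. Qed.
Lemma dsum0E n : (0 : dsum) n = 0. Proof. by []. Qed.


(* The sum of the f n (x n), meaningful when each f n is additive.            *)
Definition dsum_lift (B : zmodType) (f : forall n, M n -> B) (x : dsum) : B :=
  \sum_(n < projT1 (cid (dval_fin x))) f n (x n).

Lemma dsum_liftE (B : zmodType) (f : forall n, M n -> B) (x : dsum) N :
  (forall n, f n 0 = 0) -> (forall n, (N <= n)%N -> x n = 0) ->
  dsum_lift f x = \sum_(n < N) f n (x n).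
Proof.
move=> f0 xN; rewrite /dsum_lift; case: cid => K /= xK.
have aux L L' : (L <= L')%N -> (forall n, (L <= n)%N -> x n = 0) ->
    \sum_(n < L') f n (x n) = \sum_(n < L) f n (x n).
  move=> LL' xL; rewrite (big_ord_widen _ (fun n => f n (x n)) LL').
  rewrite [LHS](bigID (fun n : 'I_L' => (n < L)%N)) /= [X in _ + X]big1 ?addr0 //.
  by move=> n; rewrite -leqNgt => /xL ->.
by case: (leqP K N) => [/aux -> //|/ltnW/aux ->].
Qed.

End DirectSum.

Section TensorRing.
Variables (S : pzRingType) (V : bimodType S).

Fixpoint tpow (n : nat) : bimodType S :=
  if n is m.+1 then [the bimodType S of tens V (tpow m)] else [the bimodType S of S^o].

Definition tring := dsum (fun n => tpow n : zmodType).
HB.instance Definition _ := GRing.Zmodule.on tring.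
Implicit Types (x y z : tring) (a b : S) (v w : V).

Fact tring_lsc_fin a x : exists N, forall n, (N <= n)%N -> a *: x n = 0.
Proof. by have [N xN] := dval_fin x; exists N => n /xN ->; rewrite scaler0. Qed.
Lemma rscale0 (W : rmodType S) a : rscale (0 : W) a = 0.
Proof. by apply: (addIr (rscale 0 a)); rewrite -rscaleDl !add0r. Qed.
Fact tring_rsc_fin x a : exists N, forall n, (N <= n)%N -> rscale (x n) a = 0.
Proof. by have [N xN] := dval_fin x; exists N => n /xN ->; rewrite rscale0. Qed.

Let lsc a x : tring := Dsum (tring_lsc_fin a x).
Let rsc x a : tring := Dsum (tring_rsc_fin x a).

Fact tring_lscA a b x : lsc a (lsc b x) = lsc (a * b) x.
Proof. by apply: dsumP => n; apply: scalerA. Qed.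
Fact tring_lsc1 : left_id 1 lsc.
Proof. by move=> x; apply: dsumP => n; apply: scale1r. Qed.
Fact tring_lscDr : right_distributive lsc +%R.
Proof. by move=> a x y; apply: dsumP => n; apply: scalerDr. Qed.
Fact tring_lscDl x : {morph lsc^~ x : a b / a + b}.
Proof. by move=> a b; apply: dsumP => n; apply: scalerDl. Qed.
HB.instance Definition _ := GRing.Zmodule_isLmodule.Build S tring
  tring_lscA tring_lsc1 tring_lscDr tring_lscDl.

Fact tring_rscA x a b : rsc (rsc x a) b = rsc x (a * b).
Proof. by apply: dsumP => n; apply: rscaleA. Qed.
Fact tring_rsc1 x : rsc x 1 = x.
Proof. by apply: dsumP => n; apply: rscale1. Qed.
Fact tring_rscDl x y a : rsc (x + y) a = rsc x a + rsc y a.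
Proof. by apply: dsumP => n; apply: rscaleDl. Qed.
Fact tring_rscDr x a b : rsc x (a + b) = rsc x a + rsc x b.
Proof. by apply: dsumP => n; apply: rscaleDr. Qed.
HB.instance Definition _ := Zmodule_isRmodule.Build S tring
  tring_rscA tring_rsc1 tring_rscDl tring_rscDr.
Fact tring_lrsc a b x : a *: rscale x b = rscale (a *: x) b.
Proof. by apply: dsumP => n; apply: scale_rscale. Qed.
HB.instance Definition _ := LRmodule_isBimodule.Build S tring tring_lrsc.

Definition tring_one_val (n : nat) : tpow n :=
  if n is 0 then (1 : S) : tpow 0 else 0.
Fact tring_one_fin : exists N, forall n, (N <= n)%N -> tring_one_val n = 0.
Proof. by exists 1%N; case. Qed.
Definition tring_one : tring := Dsum tring_one_fin.

(* Left multiplication by an element of V shifts degrees by one.              *)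
Definition lmulv_val v (y : tring) (n : nat) : tpow n :=
  if n is m.+1 return tpow n then tpure v (y m) : tpow m.+1 else 0.
Lemma tpure0r v (W : lmodType S) : tpure v (0 : W) = 0.
Proof. by apply: (addIr (tpure v 0)); rewrite -tpureDr !add0r. Qed.
Fact lmulv_fin v y : exists N, forall n, (N <= n)%N -> lmulv_val v y n = 0.
Proof.
by have [N yN] := dval_fin y; exists N.+1 => -[//|n] /yN /= ->; apply: tpure0r.
Qed.
Definition lmulv v y : tring := Dsum (lmulv_fin v y).

(* The action of T^n on T by left multiplication, i.e. concatenation:         *)
(* s . y = s *: y for s : S, and (v (x) t) . y = v . (t . y).                 *)
Fixpoint tact (n : nat) : tpow n -> tring -> tring :=
  if n is m.+1 return tpow n -> tring -> tring then
    fun t y => tens_lift (fun (v : V) (u : tpow m) => lmulv v (tact u y)) t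
  else fun a y => (a : S) *: y.

Definition tring_mul x y : tring := dsum_lift (fun n t => @tact n t y) x.

Lemma lmulvDl v w y : lmulv (v + w) y = lmulv v y + lmulv w y.
Proof. by apply: dsumP => -[|n]; rewrite dsumDE /= ?addr0 // tpureDl. Qed.
Lemma lmulvDr v y z : lmulv v (y + z) = lmulv v y + lmulv v z.
Proof. by apply: dsumP => -[|n]; rewrite dsumDE /= ?addr0 // tpureDr. Qed.
Lemma lmulv_balanced v a y : lmulv (rscale v a) y = lmulv v (a *: y).
Proof. by apply: dsumP => -[|n] //=; rewrite tpure_balanced. Qed.
Lemma scale_lmulv v a y : a *: lmulv v y = lmulv (a *: v) y.
Proof. by apply: dsumP => -[|n] /=; rewrite ?scaler0 ?scale_tpure. Qed.
Lemma rscale_lmulv v a y : rscale (lmulv v y) a = lmulv v (rscale y a).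
Proof. by apply: dsumP => -[|n] /=; rewrite ?rscale0 ?rscale_tpure. Qed.

Lemma tact_props n y :
  [/\ forall t t' : tpow n, tact (t + t') y = tact t y + tact t' y,
      @tact n 0 y = 0 &
      forall a (t : tpow n), tact (a *: t) y = a *: tact t y].
Proof.
elim: n => [|n [tD t0 tZ]] /=.
  split=> [t t'||a t]; first exact: scalerDl; first exact: scale0r.
  by rewrite scalerA.
have bal : balanced (fun (v : V) (u : tpow n) => lmulv v (tact u y)).
  split=> [v v' u|v u u'|v a u]; first exact: lmulvDl.
    by rewrite tD lmulvDr.
  by rewrite tZ lmulv_balanced.
split; [exact: tens_liftD | exact: tens_lift0 | move=> a].
elim/tens_ind => [|v u t IH]; first by rewrite !scaler0 (tens_lift0 bal) scaler0.
rewrite scalerDr !(tens_liftD bal) scalerDr IH scale_tpure !(tens_liftE bal).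
by rewrite scale_lmulv.
Qed.

Lemma tactD n y (t t' : tpow n) : tact (t + t') y = tact t y + tact t' y.
Proof. by have [] := tact_props n y. Qed.
Lemma tact0 n y : @tact n 0 y = 0.
Proof. by have [] := tact_props n y. Qed.
Lemma tactZ n y a (t : tpow n) : tact (a *: t) y = a *: tact t y.
Proof. by have [] := tact_props n y. Qed.
Lemma tact_balanced n y :
  balanced (fun (v : V) (u : tpow n) => lmulv v (tact u y)).
Proof.
split=> [v v' u|v u u'|v a u]; first exact: lmulvDl.
  by rewrite tactD lmulvDr.
by rewrite tactZ lmulv_balanced.
Qed.
Lemma tact_pure n y v (u : tpow n) :
  @tact n.+1 (tpure v u) y = lmulv v (tact u y).
Proof. exact: (tens_liftE (tact_balanced n y)). Qed.

Lemma tpow_ind (P : forall n, tpow n -> Prop) :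
  (forall n (t u : tpow n), P n t -> P n u -> P n (t + u)) ->
  (forall n, P n 0) -> (forall a : S, P 0 a) ->
  (forall n v (u : tpow n), P n u -> P n.+1 (tpure v u)) ->
  forall n (t : tpow n), P n t.
Proof.
move=> PD P0 Pa Pv; elim=> [//|n IH] /= t.
by elim/tens_ind: t => [|v u t Pt]; [exact: P0 | apply: PD => //; apply: Pv].
Qed.

Lemma tactDr n (t : tpow n) y z : tact t (y + z) = tact t y + tact t z.
Proof.
elim/tpow_ind: n / t => [n t u IHt IHu|n|a|n v u IH].
- by rewrite !tactD IHt IHu addrACA.
- by rewrite !tact0 addr0.
- exact: scalerDr.
- by rewrite !tact_pure IH lmulvDr.
Qed.

Lemma tring_mulE N x y : (forall n, (N <= n)%N -> x n = 0) ->
  tring_mul x y = \sum_(n < N) tact (x n) y.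
Proof. by move=> xN; apply: dsum_liftE => // n; apply: tact0. Qed.

Lemma dval_bound2 x y : exists N, (forall n, (N <= n)%N -> x n = 0) /\
  (forall n, (N <= n)%N -> y n = 0).
Proof.
have [N xN] := dval_fin x; have [K yK] := dval_fin y; exists (maxn N K).
by split=> n; rewrite geq_max => /andP[/xN ? /yK ?].
Qed.

Fact tring_mulDl : left_distributive tring_mul +%R.
Proof.
move=> x y z; have [N [xN yN]] := dval_bound2 x y.
rewrite !(@tring_mulE N) // => [|n Nn]; last by rewrite dsumDE xN ?yN ?addr0.
by rewrite -big_split; apply: eq_bigr => n _; apply: tactD.
Qed.
Fact tring_mulDr : right_distributive tring_mul +%R.
Proof.
move=> x y z; rewrite /tring_mul /dsum_lift -big_split.
by apply: eq_bigr => n _; apply: tactDr.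
Qed.
Lemma tring_mulZl a x y : tring_mul (a *: x) y = a *: tring_mul x y.
Proof.
have [N xN] := dval_fin x; rewrite !(@tring_mulE N) // => [|n /xN xn]; last first.
  by rewrite /= xn scaler0.
by rewrite scaler_sumr; apply: eq_bigr => n _; apply: tactZ.
Qed.
Lemma tring_mul0l y : tring_mul 0 y = 0.
Proof. by rewrite (@tring_mulE 0) ?big_ord0. Qed.
Lemma tring_mulvl v x y : tring_mul (lmulv v x) y = lmulv v (tring_mul x y).
Proof.
have [N xN] := dval_fin x; rewrite (@tring_mulE N x) //.
rewrite (@tring_mulE N.+1) => [|[//|n] /xN /= ->]; last exact: tpure0r.
rewrite big_ord_recl /= scale0r add0r.
have lv0 : lmulv v 0 = 0 by apply: (addIr (lmulv v 0)); rewrite -lmulvDr !add0r.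
rewrite (big_morph (lmulv v) (lmulvDr v) lv0); apply: eq_bigr => n _.
exact: tact_pure.
Qed.
Lemma tring_mul_tact n (t : tpow n) x y :
  tring_mul (tact t x) y = tact t (tring_mul x y).
Proof.
elim/tpow_ind: n / t => [n t u IHt IHu|n|a|n v u IH].
- by rewrite !tactD tring_mulDl IHt IHu.
- by rewrite !tact0 tring_mul0l.
- exact: tring_mulZl.
- by rewrite !tact_pure tring_mulvl IH.
Qed.
Fact tring_mulA : associative tring_mul.
Proof.
move=> x y z; have [N xN] := dval_fin x; rewrite (@tring_mulE N x) // (@tring_mulE N x) //.
rewrite (big_morph (tring_mul^~ z) (fun x y => tring_mulDl x y z) (tring_mul0l z)).
by apply: eq_bigr => n _; rewrite tring_mul_tact.
Qed.
Fact tring_mul1l : left_id tring_one tring_mul.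
Proof.
by move=> x; rewrite (@tring_mulE 1) => [|[]//]; rewrite big_ord1 /= scale1r.
Qed.

Lemma tact1E n (t : tpow n) m : tact t tring_one m =
  if n =P m is ReflectT e then ecast i (tpow i) e t else 0.
Proof.
elim/tpow_ind: n / t m => [n t u IHt IHu|n|a|n v u IH] m.
- rewrite tactD dsumDE IHt IHu; case: eqP => [e|_]; last by rewrite addr0.
  by case: _ / e.
- by rewrite tact0 dsum0E; case: eqP => [e|//]; case: _ / e.
- case: eqP => [e|]; last by case: m => //= m _; rewrite scaler0.
  by case: _ / e => /=; exact: mulr1.
- rewrite tact_pure; case: m => [|m] /=; first by case: eqP.
  rewrite IH; case: eqP => [e|ne]; case: eqP => [e'|ne'] //=.
  + by case: _ / e e' => e'; rewrite (eq_irrelevance e' erefl).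
  + by case: ne'; rewrite e.
  + by case: ne; case: e'.
  + exact: tpure0r.
Qed.

Lemma dsum_sumE I r (P : pred I) (F : I -> tring) n :
  (\sum_(i <- r | P i) F i) n = \sum_(i <- r | P i) F i n.
Proof. by elim/big_rec2: _ => // i y1 y2 _ <-. Qed.

Fact tring_mul1r : right_id tring_one tring_mul.
Proof.
move=> x; apply: dsumP => m; have [N xN] := dval_fin x.
rewrite (@tring_mulE (maxn N m.+1)); last first.
  by move=> n; rewrite geq_max => /andP[/xN].
have mN : (m < maxn N m.+1)%N by rewrite leq_max leqnn orbT.
rewrite dsum_sumE (bigD1 (Ordinal mN)) //= big1 => [|n nm].
  by rewrite tact1E addr0; case: eqP => // e; rewrite (eq_irrelevance e erefl).
rewrite tact1E; case: eqP => // e; case/eqP: nm; exact: val_inj.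
Qed.

HB.instance Definition _ := GRing.Zmodule_isPzRing.Build tring
  tring_mulA tring_mul1l tring_mul1r tring_mulDl tring_mulDr.

Definition tunit (s : S) : tring := s *: tring_one.
Fact tunitD a b : tunit (a + b) = tunit a + tunit b.
Proof. exact: scalerDl. Qed.
Fact tunitM a b : tunit (a * b) = tunit a * tunit b.
Proof. by rewrite [RHS]tring_mulZl tring_mul1l [RHS]scalerA. Qed.
Fact tunit1 : tunit 1 = 1.
Proof. exact: scale1r. Qed.
HB.instance Definition _ := PzRing_isSRing.Build S tring tunitD tunitM tunit1.

Definition tproj_val (n : nat) x (m : nat) : tpow m := if m == n then x m else 0.
Fact tproj_fin n x : exists N, forall m, (N <= m)%N -> tproj_val n x m = 0.
Proof. by exists n.+1 => m nm; rewrite /tproj_val gtn_eqF. Qed.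
Definition tproj n x : tring := Dsum (tproj_fin n x).

Fact tprojD n x y : tproj n (x + y) = tproj n x + tproj n y.
Proof.
by apply: dsumP => m; rewrite dsumDE /= /tproj_val; case: eqP; rewrite ?addr0.
Qed.
Fact tproj_orth m n x : tproj m (tproj n x) = if m == n then tproj n x else 0.
Proof.
apply: dsumP => k; rewrite /= /tproj_val; case: eqP => [->|/eqP km].
  by case: eqP => [->|/eqP mn] //=; rewrite /tproj_val ?eqxx // (negPf mn).
by case: eqP => [<-|] //=; rewrite /tproj_val (negPf km).
Qed.
Fact tproj_sum x : exists N, x = \sum_(n < N) tproj n x.
Proof.
have [N xN] := dval_fin x; exists N; apply: dsumP => m; rewrite dsum_sumE.
have [mN|Nm] := ltnP m N; last first.
  rewrite xN // big1 // => n _; rewrite /= /tproj_val gtn_eqF //.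
  exact: leq_trans Nm.
rewrite (bigD1 (Ordinal mN)) //= big1 => [|n nm].
  by rewrite /tproj_val eqxx addr0.
rewrite /= /tproj_val; case: eqP => // e; case/eqP: nm; exact: val_inj.
Qed.
HB.instance Definition _ :=
  Zmodule_isGraded.Build tring tprojD tproj_orth tproj_sum.

Lemma thomogP n x : homog tring n x <-> forall m, m != n -> x m = 0.
Proof.
split=> [xn m mn|xn]; first by rewrite -xn /= /tproj_val (negPf mn).
by apply: dsumP => m; rewrite /= /tproj_val; case: eqP => // /eqP /xn.
Qed.

Fact tunit_homog s : homog tring 0 (sunit s).
Proof. by apply/thomogP => -[//|m _]; apply: scaler0. Qed.

Lemma tact_homog n (t : tpow n) m y :
  homog tring m y -> homog tring (n + m) (tact t y).
Proof.
move=> /thomogP ym; apply/thomogP.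
elim/tpow_ind: n / t => [n t u IHt IHu|n|a|n v u IH] k km.
- by rewrite tactD dsumDE IHt // IHu // addr0.
- by rewrite tact0.
- by rewrite /= ym // scaler0.
- rewrite tact_pure; case: k km => [//|k] km /=.
  by rewrite IH ?tpure0r //; apply: contra km => /eqP ->.
Qed.

Fact thomogM m n x y :
  homog tring m x -> homog tring n y -> homog tring (m + n) (x * y).
Proof.
move=> /thomogP xm yn; rewrite [_ * _](@tring_mulE m.+1); last first.
  by move=> k mk; apply: xm; rewrite gtn_eqF.
rewrite big_ord_recr big1 /= ?add0r; first exact: tact_homog.
by move=> i _; rewrite xm ?tact0 // ltn_eqF.
Qed.
HB.instance Definition _ := SRing_isGraded.Build S tring tunit_homog thomogM.

End TensorRing.

Section TensorRingOf.
Variables (S : pzRingType) (A : gradedSRingType S).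

Definition A1 : bimodType S := [the bimodType S of sbtype (homog_subbimod A 1)].
Definition TA : gradedSRingType S := [the gradedSRingType S of tring A1].

(* s |-> s for s : S, and v (x) t |-> v * t.                                  *)
Fixpoint tcan_pow (n : nat) : tpow A1 n -> A :=
  if n is m.+1 return tpow A1 n -> A then
    tens_lift (fun (v : A1) (t : tpow A1 m) => (val v : A) * tcan_pow t)
  else @sunit S A.

Definition tcan (x : TA) : A := dsum_lift tcan_pow x.

(* I_A, the kernel of T_A -> A.                                               *)
Definition rel_ideal : set TA := [set x | tcan x = 0].

End TensorRingOf.
Arguments rel_ideal {S} A.

Definition two_sided_ideal (B : pzRingType) (I : set B) : Prop :=
  subgroup I /\ forall b x, I x -> I (b * x) /\ I (x * b).

Definition gen_ideal (B : pzRingType) (X : set B) : set B :=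
  smallest (@two_sided_ideal B) X.

Lemma gen_ideal_closed (B : pzRingType) (X : set B) :
  two_sided_ideal (gen_ideal X).
Proof.
split; first split.
- by move=> I [[[]]].
- move=> x y xI yI I XI; case: (XI) => -[[_ IB] _] _.
  by apply: IB; [apply: xI|apply: yI].
- move=> b x xI; split=> I XI; case: (XI) => -[_ IM] _.
    by case: (IM b x (xI I XI)).
  by case: (IM b x (xI I XI)).
Qed.

Section QuotientRing.
Variables (B : pzRingType) (I : set B) (idealI : two_sided_ideal I).

Definition qrel (x y : B) : bool := `[< I (x - y) >].

Let I0 : I 0. Proof. by case: idealI => -[]. Qed.
Let IB x y : I x -> I y -> I (x - y).
Proof. by case: idealI => -[_ h] _; apply: h. Qed.
Let IN x : I x -> I (- x). Proof. by move=> Ix; rewrite -sub0r; apply: IB. Qed.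
Let ID x y : I x -> I y -> I (x + y).
Proof. by move=> Ix Iy; rewrite -[y]opprK; apply/IB/IN. Qed.
Let IMl b x : I x -> I (b * x).
Proof. by case: idealI => _ h /(h b)[]. Qed.
Let IMr b x : I x -> I (x * b).
Proof. by case: idealI => _ h /(h b)[]. Qed.

Lemma qrel_refl : reflexive qrel.
Proof. by move=> x; apply/asboolP; rewrite subrr. Qed.
Lemma qrel_sym : symmetric qrel.
Proof. by move=> x y; apply/asbool_equiv_eq; split=> /IN; rewrite opprB. Qed.
Lemma qrel_trans : transitive qrel.
Proof.
move=> y x z /asboolP xy /asboolP yz; apply/asboolP.
by have := ID xy yz; rewrite addrA subrK.
Qed.
Canonical qequiv := EquivRel qrel qrel_refl qrel_sym qrel_trans.

Definition quot_ring := {eq_quot qequiv}.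
HB.instance Definition _ := Choice.on quot_ring.
HB.instance Definition _ := EqQuotient.on quot_ring.

Definition qcl (x : B) : quot_ring := \pi_quot_ring x.

Lemma qclP x y : qcl x = qcl y <-> I (x - y).
Proof. by split=> [/eqmodP/asboolP //|xy]; apply/eqmodP; exact/asboolP. Qed.

Lemma qcl_surj (q : quot_ring) : exists x, q = qcl x.
Proof. by exists (repr q); rewrite /qcl reprK. Qed.

Lemma qcl_repr x : I (repr (qcl x) - x).
Proof. by apply/qclP; rewrite /qcl reprK. Qed.

Let qadd (p q : quot_ring) : quot_ring := qcl (repr p + repr q).
Let qopp (p : quot_ring) : quot_ring := qcl (- repr p).
Let qmul (p q : quot_ring) : quot_ring := qcl (repr p * repr q).

Let qaddE x y : qadd (qcl x) (qcl y) = qcl (x + y).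
Proof. by apply/qclP; rewrite opprD addrACA; apply: ID; apply: qcl_repr. Qed.
Let qoppE x : qopp (qcl x) = qcl (- x).
Proof. by apply/qclP; rewrite -opprD; apply/IN/qcl_repr. Qed.
Let qmulE x y : qmul (qcl x) (qcl y) = qcl (x * y).
Proof.
apply/qclP; set x' := repr _; set y' := repr _.
have -> : x' * y' - x * y = (x' - x) * y' + x * (y' - y).
  by rewrite mulrBl mulrBr addrA subrK.
by apply: ID; [apply/IMr|apply/IMl]; apply: qcl_repr.
Qed.

Fact quot_addA : associative qadd.
Proof.
move=> p q r; have [x ->] := qcl_surj p; have [y ->] := qcl_surj q.
by have [z ->] := qcl_surj r; rewrite !qaddE addrA.
Qed.
Fact quot_addC : commutative qadd.
Proof. by move=> p q; rewrite /qadd addrC. Qed.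
Fact quot_add0 : left_id (qcl 0) qadd.
Proof. by move=> p; have [x ->] := qcl_surj p; rewrite qaddE add0r. Qed.
Fact quot_addN : left_inverse (qcl 0) qopp qadd.
Proof. by move=> p; have [x ->] := qcl_surj p; rewrite qoppE qaddE addNr. Qed.
HB.instance Definition _ :=
  GRing.isZmodule.Build quot_ring quot_addA quot_addC quot_add0 quot_addN.

Fact quot_mulA : associative qmul.
Proof.
move=> p q r; have [x ->] := qcl_surj p; have [y ->] := qcl_surj q.
by have [z ->] := qcl_surj r; rewrite !qmulE mulrA.
Qed.
Fact quot_mul1l : left_id (qcl 1) qmul.
Proof. by move=> p; have [x ->] := qcl_surj p; rewrite qmulE mul1r. Qed.
Fact quot_mul1r : right_id (qcl 1) qmul.
Proof. by move=> p; have [x ->] := qcl_surj p; rewrite qmulE mulr1. Qed.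
Fact quot_mulDl : left_distributive qmul +%R.
Proof.
move=> p q r; have [x ->] := qcl_surj p; have [y ->] := qcl_surj q.
have [z ->] := qcl_surj r; rewrite [_ + _]qaddE !qmulE.
by rewrite [RHS]qaddE mulrDl.
Qed.
Fact quot_mulDr : right_distributive qmul +%R.
Proof.
move=> p q r; have [x ->] := qcl_surj p; have [y ->] := qcl_surj q.
have [z ->] := qcl_surj r; rewrite [X in qmul _ X]qaddE !qmulE.
by rewrite [RHS]qaddE mulrDr.
Qed.
HB.instance Definition _ := GRing.Zmodule_isPzRing.Build quot_ring
  quot_mulA quot_mul1l quot_mul1r quot_mulDl quot_mulDr.

Lemma qclD x y : qcl (x + y) = qcl x + qcl y.
Proof. by rewrite [RHS]qaddE. Qed.
Lemma qclN x : qcl (- x) = - qcl x.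
Proof. by rewrite [RHS]qoppE. Qed.
Lemma qclM x y : qcl (x * y) = qcl x * qcl y.
Proof. by rewrite [RHS]qmulE. Qed.

End QuotientRing.

Record filtration (B : pzRingType) := Filtration {
  filt :> nat -> set B;
  filt_subgroup : forall n, subgroup (filt n);
  filtS : forall n x, filt n x -> filt n.+1 x;
  filt1 : filt 0 1;
  filtM : forall m n x y, filt m x -> filt n y -> filt (m + n)%N (x * y)
}.

(* F^{n-1}, with F^{-1} = 0.                                                  *)
Definition filt_pred (B : pzRingType) (F : filtration B) (n : nat) : set B :=
  if n is m.+1 then filt F m else [set 0].

Section AssociatedGraded.
Variables (B : pzRingType) (F : filtration B).

(* The Rees ring \bigoplus_n F^n, with the convolution product.               *)
Record rees := Rees {
  rval :> nat -> B;
  rval_filt : forall n, filt F n (rval n);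
  rval_fin : exists N, forall n, (N <= n)%N -> rval n = 0
}.

Lemma reesP (f g : rees) : (forall n, f n = g n) -> f = g.
Proof.
case: f g => [f f1 f2] [g g1 g2] /= fg.
have {}fg : f = g by exact: functional_extensionality_dep.
by subst g; congr Rees; apply: Prop_irrelevance.
Qed.

HB.instance Definition _ := gen_eqMixin rees.
HB.instance Definition _ := gen_choiceMixin rees.

Lemma filt0 n : filt F n 0. Proof. by case: (filt_subgroup F n). Qed.
Lemma filtB n x y : filt F n x -> filt F n y -> filt F n (x - y).
Proof. by case: (filt_subgroup F n) => _; apply. Qed.
Lemma filtN n x : filt F n x -> filt F n (- x).
Proof. by move=> xn; rewrite -sub0r; apply/filtB/xn/filt0. Qed.
Lemma filtD n x y : filt F n x -> filt F n y -> filt F n (x + y).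
Proof. by move=> xn yn; rewrite -[y]opprK; apply/filtB/filtN. Qed.
Lemma filt_sum n I r (P : pred I) (G : I -> B) :
  (forall i, P i -> filt F n (G i)) -> filt F n (\sum_(i <- r | P i) G i).
Proof. by move=> h; apply: big_ind => //; [exact: filt0 | exact: filtD]. Qed.

Definition rzero : rees :=
  @Rees (fun=> 0) (fun n => filt0 n) (ex_intro _ 0%N (fun _ _ => erefl)).

Fact ropp_fin (f : rees) : exists N, forall n, (N <= n)%N -> - f n = 0.
Proof. by have [N fN] := rval_fin f; exists N => n /fN ->; rewrite oppr0. Qed.
Definition ropp (f : rees) : rees :=
  @Rees (fun n => - f n) (fun n => filtN (rval_filt f n)) (ropp_fin f).

Fact radd_fin (f g : rees) : exists N, forall n, (N <= n)%N -> f n + g n = 0.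
Proof.
have [N fN] := rval_fin f; have [K gK] := rval_fin g; exists (maxn N K) => n.
by rewrite geq_max => /andP[/fN -> /gK ->]; rewrite addr0.
Qed.
Definition radd (f g : rees) : rees :=
  @Rees (fun n => f n + g n) (fun n => filtD (rval_filt f n) (rval_filt g n))
    (radd_fin f g).

Fact rees_addA : associative radd.
Proof. by move=> f g h; apply: reesP => n; apply: addrA. Qed.
Fact rees_addC : commutative radd.
Proof. by move=> f g; apply: reesP => n; apply: addrC. Qed.
Fact rees_add0 : left_id rzero radd.
Proof. by move=> f; apply: reesP => n; apply: add0r. Qed.
Fact rees_addN : left_inverse rzero ropp radd.
Proof. by move=> f; apply: reesP => n; apply: addNr. Qed.
HB.instance Definition _ :=
  GRing.isZmodule.Build rees rees_addA rees_addC rees_add0 rees_addN.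

Definition rmono_val (n : nat) (x : B) (k : nat) : B := if k == n then x else 0.
Fact rmono_filt n x (xn : filt F n x) k : filt F k (rmono_val n x k).
Proof. by rewrite /rmono_val; case: eqP => [->|_] //; apply: filt0. Qed.
Fact rmono_fin n x : exists N, forall k, (N <= k)%N -> rmono_val n x k = 0.
Proof. by exists n.+1 => k nk; rewrite /rmono_val gtn_eqF. Qed.
Definition rmono n x (xn : filt F n x) : rees :=
  Rees (rmono_filt xn) (rmono_fin n x).

Definition rmul_val (f g : rees) (n : nat) : B :=
  \sum_(i < n.+1) f i * g (n - i)%N.
Fact rmul_filt (f g : rees) n : filt F n (rmul_val f g n).
Proof.
apply: filt_sum => i _; rewrite -[n in filt F n](subnKC (leq_ord i)).
by apply: filtM; apply: rval_filt.
Qed.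
Fact rmul_fin (f g : rees) : exists N, forall n, (N <= n)%N -> rmul_val f g n = 0.
Proof.
have [N fN] := rval_fin f; have [K gK] := rval_fin g; exists (N + K)%N => n NKn.
apply: big1 => i _; have [/fN ->|iN] := leqP N i; first by rewrite mul0r.
by rewrite gK ?mulr0 // leq_subRL ?leq_ord //; apply: leq_trans NKn; rewrite leq_add2r ltnW.
Qed.
Definition rmul (f g : rees) : rees := Rees (rmul_filt f g) (rmul_fin f g).
Definition rone : rees := rmono (filt1 F).

Lemma rmul_rev (f g : rees) n : rmul f g n = \sum_(i < n.+1) f (n - i)%N * g i.
Proof.
rewrite /= /rmul_val (reindex_inj rev_ord_inj) /=.
by apply: eq_bigr => i _; rewrite subSS subKn // leq_ord.
Qed.

Fact rees_mulA : associative rmul.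
Proof.
move=> f g h; apply: reesP => n; rewrite [RHS]rmul_rev [LHS]/= [in RHS]/= /rmul_val.
pose coef3 i j := f i * (g (n - i - j)%N * h j).
transitivity (\sum_(i < n.+1) \sum_(j < n.+1 | (j <= n - i)%N) coef3 i j).
  apply: eq_bigr => i _.
  rewrite rmul_rev big_distrr /= (big_ord_narrow_leq (leq_subr _ _)).
  by apply: eq_bigr => j _.
rewrite (exchange_big_dep predT) //=; apply: eq_bigr => j _.
transitivity (\sum_(i < n.+1 | (i <= n - j)%N) coef3 i j).
  apply: eq_bigl => i; rewrite -ltnS -(ltnS i) -!subSn ?leq_ord //.
  by rewrite -subn_gt0 -(subn_gt0 i) -!subnDA addnC.
rewrite (big_ord_narrow_leq (leq_subr _ _)) mulr_suml.
by apply: eq_bigr => i _; rewrite /coef3 mulrA -!subnDA addnC.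
Qed.
Fact rees_mul1l : left_id rone rmul.
Proof.
move=> f; apply: reesP => n; rewrite /= /rmul_val big_ord_recl big1 ?addr0.
  by rewrite /= /rmono_val mul1r subn0.
by move=> i _; rewrite mul0r.
Qed.
Fact rees_mul1r : right_id rone rmul.
Proof.
move=> f; apply: reesP => n; rewrite rmul_rev big_ord_recl big1 ?addr0.
  by rewrite /= /rmono_val mulr1 subn0.
by move=> i _; rewrite mulr0.
Qed.
Fact rees_mulDl : left_distributive rmul +%R.
Proof.
move=> f g h; apply: reesP => n; rewrite /= /rmul_val -big_split.
by apply: eq_bigr => i _; apply: mulrDl.
Qed.
Fact rees_mulDr : right_distributive rmul +%R.
Proof.
move=> f g h; apply: reesP => n; rewrite /= /rmul_val -big_split.
by apply: eq_bigr => i _; apply: mulrDr.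
Qed.
HB.instance Definition _ := GRing.Zmodule_isPzRing.Build rees
  rees_mulA rees_mul1l rees_mul1r rees_mulDl rees_mulDr.

(* \bigoplus_n F^{n-1} as an ideal of \bigoplus_n F^n.                        *)
Definition rees_pred : set rees := [set f | forall n, filt_pred F n (f n)].

Lemma filt_pred_subgroup n : subgroup (filt_pred F n).
Proof.
case: n => [|n] /=; last exact: filt_subgroup.
by split=> // x y -> ->; rewrite /= subr0.
Qed.
Lemma filt_predMl m n x y :
  filt F m x -> filt_pred F n y -> filt_pred F (m + n) (x * y).
Proof.
case: n => [|n] xm /=; last by rewrite addnS; apply: filtM.
by move=> ->; rewrite mulr0 addn0; case: (filt_pred_subgroup m).
Qed.
Lemma filt_predMr m n x y :
  filt_pred F m x -> filt F n y -> filt_pred F (m + n) (x * y).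
Proof.
case: m => [|m] /= xm yn; last exact: filtM.
by rewrite xm mul0r; case: (filt_pred_subgroup n).
Qed.
Lemma filt_pred_sum n I r (P : pred I) (G : I -> B) :
  (forall i, P i -> filt_pred F n (G i)) ->
  filt_pred F n (\sum_(i <- r | P i) G i).
Proof.
move=> h; have [h0 hB] := filt_pred_subgroup n.
apply: big_ind => // x y xn yn; rewrite -[y]opprK; apply: (hB) => //.
by rewrite -sub0r; apply: hB.
Qed.

Lemma rees_pred_ideal : two_sided_ideal rees_pred.
Proof.
split; first split.
- by move=> n; case: (filt_pred_subgroup n).
- move=> f g fP gP n; case: (filt_pred_subgroup n) => _; apply.
    exact: fP.
  exact: gP.
- move=> b f fP; split=> n; apply: filt_pred_sum => i _.
    rewrite -[n in filt_pred F n](subnKC (leq_ord i)).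
    by apply: filt_predMl; [apply: rval_filt | apply: fP].
  rewrite -[n in filt_pred F n](subnKC (leq_ord i)).
  by apply: filt_predMr; [apply: fP | apply: rval_filt].
Qed.

(* gr = \bigoplus_n F^n / F^{n-1}, with the product induced by that of B.     *)
Definition gr := quot_ring rees_pred_ideal.

Definition grcl n x (xn : filt F n x) : gr := qcl rees_pred_ideal (rmono xn).

Lemma grclP n x y (xn : filt F n x) (yn : filt F n y) :
  grcl xn = grcl yn <-> filt_pred F n (x - y).
Proof.
rewrite qclP; split=> [/(_ n)|xy k]; rewrite /= /rmono_val ?eqxx //.
case: eqP => [->|_] //; rewrite subr0; by case: (filt_pred_subgroup k).
Qed.

End AssociatedGraded.

Section Deformation.
Variables (S : pzRingType) (T : gradedSRingType S).
Implicit Types (P R Q : subbimod (sbim T)).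

Lemma uptoM m n (x y : T) :
  upto T m x -> upto T n y -> upto T (m + n) (x * y).
Proof.
move=> xm yn k mnk; have [N xE] := gproj_fin x; have [K yE] := gproj_fin y.
rewrite xE yE mulr_suml gproj_sum big1 // => i _.
rewrite mulr_sumr gproj_sum big1 // => j _.
have [mi|im] := ltnP m i; first by rewrite xm // mul0r gproj0.
have [nj|jn] := ltnP n j; first by rewrite yn // mulr0 gproj0.
apply: homog_neq (homogM (gproj_homog i x) (gproj_homog j y)) _.
by rewrite gtn_eqF // (leq_ltn_trans _ mnk) // leq_add.
Qed.

Definition quotT (P : set T) : pzRingType :=
  [the pzRingType of quot_ring (gen_ideal_closed P)].
Definition quotT_cl (P : set T) (x : T) : quotT P := qcl (gen_ideal_closed P) x.

Section QuotientFiltration.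
Variable P : set T.

Definition quotT_filt_set (n : nat) : set (quotT P) := quotT_cl P @` upto T n.

Fact quotT_filt_subgroup n : subgroup (quotT_filt_set n).
Proof.
case: (upto_subgroup T n) => T0 TB; split; first by exists 0.
move=> _ _ [x xn <-] [y yn <-]; exists (x - y); first exact: TB.
by rewrite /quotT_cl qclD qclN.
Qed.
Fact quotT_filtS n q : quotT_filt_set n q -> quotT_filt_set n.+1 q.
Proof. by case=> x xn <-; exists x => //; apply: uptoS xn. Qed.
Fact quotT_filt1 : quotT_filt_set 0 1.
Proof. by exists 1 => //; apply: homog_upto; rewrite -(@sunit1 S); apply: sunit_homog. Qed.
Fact quotT_filtM m n p q :
  quotT_filt_set m p -> quotT_filt_set n q -> quotT_filt_set (m + n) (p * q).
Proof.
move=> [x xm <-] [y yn <-]; exists (x * y); first exact: uptoM.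
by rewrite /quotT_cl qclM.
Qed.

Definition quotT_filt : filtration (quotT P) :=
  Filtration quotT_filt_subgroup quotT_filtS quotT_filt1 quotT_filtM.

Lemma quotT_cl_filt n x : homog T n x -> filt quotT_filt n (quotT_cl P x).
Proof. by move=> xn; exists x => //; apply: homog_upto. Qed.

End QuotientFiltration.

(* U(P) = T / <P> is a PBW-deformation of T / <R>. The displayed values       *)
(* determine phi, and make it graded and S-linear.                            *)
Definition PBW_deformation (R P : set T) : Prop :=
  exists2 phi : {rmorphism quotT R -> gr (quotT_filt P)},
    bijective phi &
    forall n x (xn : homog T n x),
      phi (quotT_cl R x) = grcl (quotT_cl_filt P xn).

Section Leading.
Variable P : subbimod (sbim T).

(* R_P, the sum of the p^n (P `&` T^{<= n}).                                   *)
Definition lead_set : set T :=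
  [set x | forall n, (gproj n @` (sbset P `&` upto T n)) (gproj n x)].

Fact lead_subgroup : subgroup (lead_set : set (sbim T)).
Proof.
case: (sb_subgroup P) => P0 PB; split=> [n|x y xP yP n].
  by exists 0; rewrite ?gproj0 //; split=> //; case: (upto_subgroup T n).
have [a [Pa an] ax] := xP n; have [b [Pb bn] yb] := yP n.
exists (a - b); last by rewrite !gprojB ax yb.
by split; [exact: PB | case: (upto_subgroup T n) => _; apply].
Qed.
Fact lead_scale (s : S) (x : sbim T) : lead_set x -> lead_set (s *: x : sbim T).
Proof.
move=> xP n; have [a [Pa an] ax] := xP n; exists (s *: (a : sbim T)).
  split; first exact: sb_scale.
  exact: (uptoM (homog_upto (sunit_homog s)) an).
by rewrite [LHS]gprojZl [RHS]gprojZl ax.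
Qed.
Fact lead_rscale (x : sbim T) (s : S) : lead_set x -> lead_set (rscale x s).
Proof.
move=> xP n; have [a [Pa an] ax] := xP n; exists (rscale (a : sbim T) s).
  split; first exact: sb_rscale.
  by have := uptoM an (homog_upto (sunit_homog s)); rewrite addn0.
by rewrite [LHS]gprojZr [RHS]gprojZr ax.
Qed.

Definition lead : subbimod (sbim T) :=
  Subbimod lead_subgroup lead_scale lead_rscale.
End Leading.

Definition filtered_morphism R (alpha : {linear sbtype R -> sbim T}) : Prop :=
  rlinear alpha /\
  forall n (r : sbtype R), homog T n (val r) ->
    upto T n (alpha r) /\ gproj n (alpha r : T) = val r.

(* Q_n, the sum of the T^{<= i} Q^{<= j} T^{<= k} for i + j + k = n.           *)
Definition filt_gen (Q : set T) (n : nat) : set T :=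
  addspan [set z | exists i j k, (i + j + k = n)%N /\
    exists x q y, [/\ upto T i x, (Q `&` upto T j) q, upto T k y & z = x * q * y]].

Definition jacobi (Q : set T) (n : nat) : Prop :=
  filt_gen Q n.+1 `&` upto T n `<=` filt_gen Q n.

End Deformation.

Definition bimodule_of_relations (S : pzRingType) (A : gradedSRingType S)
    (R : subbimod (sbim (TA A))) : Prop :=
  let I := rel_ideal A in
  let T1 := homog (TA A) 1 in
  let J := setadd (setmulspan T1 I) (setmulspan I T1) in
  [/\ forall n x, sbset R x -> sbset R (gproj n (x : TA A)),
      sbset R `<=` I,
      I = setadd (sbset R) J &
      sbset R `&` J = [set 0]].

(* S as a left and as a right A-module, through the augmentation A -> S.      *)
Definition trivmod (S : pzRingType) (A : connSRingType S) : Type := S.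

Section TrivialModule.
Variables (S : pzRingType) (A : connSRingType S).

Lemma augm_subproof (a : A) : exists s : S, sunit s = gproj 0 a.
Proof. exact/sunit_surj/gproj_homog. Qed.

Definition augm (a : A) : S := projT1 (cid (augm_subproof a)).

Lemma augmE a : sunit (augm a) = gproj 0 a.
Proof. by rewrite /augm; case: cid. Qed.
Lemma augmD a b : augm (a + b) = augm a + augm b.
Proof. by apply: (@sunit_inj S A); rewrite sunitD !augmE gprojD. Qed.
Lemma augm1 : augm 1 = 1.
Proof.
apply: (@sunit_inj S A); rewrite augmE -(@sunit1 S A); exact: sunit_homog.
Qed.
Lemma augmM a b : augm (a * b) = augm a * augm b.
Proof.
apply: (@sunit_inj S A); rewrite sunitM !augmE.
have [N aE] := gproj_fin a; have [K bE] := gproj_fin b.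
rewrite {1}aE {1}bE [in RHS]aE [in RHS]bE !gproj_sum mulr_suml gproj_sum mulr_suml.
apply: eq_bigr => i _; rewrite !mulr_sumr gproj_sum; apply: eq_bigr => j _.
have h := homogM (gproj_homog i a) (gproj_homog j b).
rewrite !gproj_orth; case: (posnP i) => [i0|i_gt0]; last first.
  by rewrite (ltn_eqF i_gt0) mul0r (homog_neq h) // ltn_eqF // addn_gt0 i_gt0.
case: (posnP j) => [j0|j_gt0]; last first.
  rewrite (ltn_eqF j_gt0) mulr0 (homog_neq h) // ltn_eqF // addn_gt0 j_gt0.
  by rewrite orbT.
by have := h; rewrite i0 j0 => /= ->.
Qed.

Local Notation trivmod := (trivmod A).
HB.instance Definition _ := GRing.Zmodule.on trivmod.

Let lsc (a : A) (s : trivmod) : trivmod := augm a * (s : S).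
Let rsc (s : trivmod) (a : A) : trivmod := (s : S) * augm a.

Fact triv_lscA a b s : lsc a (lsc b s) = lsc (a * b) s.
Proof. by rewrite /lsc augmM mulrA. Qed.
Fact triv_lsc1 : left_id 1 lsc.
Proof. by move=> s; rewrite /lsc augm1 mul1r. Qed.
Fact triv_lscDr : right_distributive lsc +%R.
Proof. by move=> a s t; apply: mulrDr. Qed.
Fact triv_lscDl s : {morph lsc^~ s : a b / a + b}.
Proof. by move=> a b; rewrite /lsc augmD mulrDl. Qed.
HB.instance Definition _ := GRing.Zmodule_isLmodule.Build A trivmod
  triv_lscA triv_lsc1 triv_lscDr triv_lscDl.

Fact triv_rscA s a b : rsc (rsc s a) b = rsc s (a * b).
Proof. by rewrite /rsc augmM mulrA. Qed.
Fact triv_rsc1 s : rsc s 1 = s.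
Proof. by rewrite /rsc augm1 mulr1. Qed.
Fact triv_rscDl s t a : rsc (s + t) a = rsc s a + rsc t a.
Proof. exact: mulrDl. Qed.
Fact triv_rscDr s a b : rsc s (a + b) = rsc s a + rsc s b.
Proof. by rewrite /rsc augmD mulrDr. Qed.
HB.instance Definition _ := Zmodule_isRmodule.Build A trivmod
  triv_rscA triv_rsc1 triv_rscDl triv_rscDr.
End TrivialModule.

Section Tor.
Variables (S : pzRingType) (A : connSRingType S).

(* A graded projective resolution of S by left A-modules, S being             *)
(* concentrated in degree 0; a graded module is projective in the graded      *)
(* category if and only if it is projective as a module.                      *)
Record gresolution := GResolution {
  gres :> nat -> gradedLmodType A;
  gres_diff : forall i, {linear gres i.+1 -> gres i};
  gres_augm : {linear gres 0 -> trivmod A};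
  gres_proj : forall i, left_projective (gres i);
  gres_diff_homog : forall i n x,
    homog (gres i.+1) n x -> homog (gres i) n (gres_diff i x);
  gres_augm_homog : forall n x,
    (0 < n)%N -> homog (gres 0) n x -> gres_augm x = 0;
  gres_augm_surj : forall s, exists x, gres_augm x = s;
  gres_exact0 : forall x, gres_augm x = 0 <-> exists y, gres_diff 0 y = x;
  gres_exact : forall i x,
    gres_diff i x = 0 <-> exists y, gres_diff i.+1 y = x
}.

Section TensorComplex.
Variable P : gresolution.

Definition tcomplex (i : nat) : zmodType :=
  [the zmodType of tens (trivmod A) (P i)].

Definition tcomplex_diff (i : nat) : tcomplex i.+1 -> tcomplex i :=
  tens_lift (fun (s : trivmod A) (x : P i.+1) => tpure s (gres_diff P i x)).

Definition tcomplex_homog (i n : nat) : set (tcomplex i) :=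
  addspan [set tpure (s : trivmod A) x | s in setT & x in homog (P i) n].

End TensorComplex.

(* Tor^A_{i+1}(S, S) = 0, resp. Tor^A_{i+1,n}(S, S) = 0: every cycle of       *)
(* S (x)_A P is a boundary. This does not depend on the resolution P.         *)
Definition TorS_zero (i : nat) : Prop :=
  forall (P : gresolution) (z : tcomplex P i.+1),
    tcomplex_diff z = 0 ->
    exists w : tcomplex P i.+2, tcomplex_diff w = z.

Definition TorS_zero_deg (i n : nat) : Prop :=
  forall (P : gresolution) (z : tcomplex P i.+1),
    tcomplex_homog n z -> tcomplex_diff z = 0 ->
    exists2 w : tcomplex P i.+2, tcomplex_homog n w & tcomplex_diff w = z.

Definition complexity : \bar int :=
  if `[< TorS_zero 2 >] then (-1)%:E
  else supremum -oo%E [set (n%:Z - 1)%:E | n in [set n | ~ TorS_zero_deg 2 n]].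

End Tor.

(* Main.v *)
(* Since A^1 and R are left projective, S has a graded resolution by left        *)
(* A-modules starting with A (x) R -> A (x) A^1 -> A, so Tor_3^A(S, S) is        *)
(* M / A_+ M, M being the kernel of A (x) R -> A (x) A^1; here free modules on   *)
(* generating sets replace A (x) A^1 and A (x) R, whose elements are handled     *)
(* through dual bases. The condition (J_n) says that a relation of degree n + 1  *)
(* among products a r b is sent into Q_n when r is replaced by alpha(r). If      *)
(* Tor_{3,n+1} = 0, such a relation is a combination of relations of degree n    *)
(* multiplied by A^1 on the left or on the right and of the trivial relations    *)
(* (r b) r' = r (b r'), which alpha respects modulo Q_n; hence (J_{n-1}) implies *)
(* (J_n). When all (J_n) hold, the leading terms of <alpha(R)> lie in <R>, which *)
(* is the PBW property. Conversely, alpha is a lift of the identity of R_P along *)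
(* the leading term maps of P, and the PBW property gives P <= <alpha(R)> and    *)
(* all the Jacobi conditions by subtracting leading terms.                       *)
Require Import Defs.
From HB Require Import structures.
From mathcomp Require Import all_boot all_order all_algebra.
From mathcomp Require Import boolp classical_sets constructive_ereal.

Set Implicit Arguments.
Unset Strict Implicit.
Unset Printing Implicit Defensive.

Import Order.TTheory GRing.Theory Num.Theory.
Local Open Scope classical_set_scope.
Local Open Scope ring_scope.

(** The graded map A = T/<R> -> gr U(P) is always onto, so PBW says that the forms of degree n in
    <R> = I_A are exactly the leading forms of the elements of <P> of degree at most n
    ([PBW_leading], [PBW_of_leading], [gen_ideal_rel]). The proof works with these leading forms.

    Suppose PBW holds. Projectivity of R_P lifts its degree n components along p^n : P^{<= n} ->
    p^n(P^{<= n}) ([lead_lift]); restricted to R and summed over n, the lifts form alpha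
    ([lift_sum_filtered]). Put Q = alpha(R). An element of <P> of degree at most n has its leading
    form in I_A, hence shares it with an element of Q_n; subtracting and descending puts the element
    itself in Q_n ([PBW_filt_gen]). This gives both P <= <Q> and every (J_n), while [PBW_lead_sub]
    gives <R_P> <= <R>.

    Conversely, if all (J_n) hold, an element of <Q> of degree at most n descends from some Q_m to
    Q_n ([jac_gen_ideal]), and the leading forms of Q_n lie in I_A ([fg_lead]); this is PBW
    ([PBW_of_jac]). It remains to pass from (J_n) to (J_{n+1}) when n + 1 > c(A), so that
    Tor_{3,n+2} = 0 ([jac_step]). By [jacobi_of_jac] only homogeneous relations between products a r
    b of degree n + 2 matter. The terms with scalar b form a cycle in homological degree 2 of a free
    resolution of S; its coefficients lie in A_+, because R meets T^1 I_A + I_A T^1 in 0. Vanishing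
    of Tor makes it a combination of A^1-multiples of cycles of degree n + 1 ([syzygy]), to which
    (J_n) applies. Lifting this combination from A to T leaves an error with coefficients in I_A,
    which [Gr_exchange] absorbs. Now every b has positive degree, the last tensor factor can be
    split off ([Gr_pos_delta]), and (J_n) applies to the coordinates. *)

Section Subgroups.
Variable M : zmodType.
Implicit Types (X Y : set M) (x y : M).

Lemma subgroup0 X : subgroup X -> X 0. Proof. by case. Qed.
Lemma subgroupB X x y : subgroup X -> X x -> X y -> X (x - y).
Proof. by case=> _; apply. Qed.
Lemma subgroupN X x : subgroup X -> X x -> X (- x).
Proof. by move=> sX Xx; rewrite -sub0r; apply: subgroupB => //; case: sX. Qed.
Lemma subgroupD X x y : subgroup X -> X x -> X y -> X (x + y).
Proof.
by move=> sX Xx Xy; rewrite -[y]opprK; apply: subgroupB => //; apply: subgroupN.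
Qed.
Lemma subgroup_sum X J (r : seq J) (P : pred J) (F : J -> M) :
  subgroup X -> (forall i, P i -> X (F i)) -> X (\sum_(i <- r | P i) F i).
Proof.
by move=> sX XF; apply: big_ind => // [|x y]; [case: sX | apply: subgroupD].
Qed.

Lemma addspan_subgroup X : subgroup (addspan X).
Proof.
split=> [Y [[Y0 _] _] //|x y xX yX Y YX]; case: (YX) => -[_ YB] _.
by apply: YB; [apply: xX | apply: yX].
Qed.
Lemma addspan_gen X x : X x -> addspan X x.
Proof. by move=> Xx Y [_]; apply. Qed.
Lemma addspan_ind X Y : subgroup Y -> X `<=` Y -> addspan X `<=` Y.
Proof. by move=> sY XY x; apply. Qed.
Lemma addspan0 X : addspan X 0.
Proof. exact: (subgroup0 (addspan_subgroup X)). Qed.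
Lemma addspanB X x y : addspan X x -> addspan X y -> addspan X (x - y).
Proof. exact: (subgroupB (addspan_subgroup X)). Qed.

Lemma subgroup_preim (N : zmodType) (f : M -> N) (Y : set N) :
  {morph f : x y / x - y} -> subgroup Y -> subgroup (f @^-1` Y).
Proof.
move=> fB sY; split=> [|x y fx fy] /=.
  by rewrite -(subr0 0) fB subrr; case: sY.
by rewrite fB; case: sY => _; apply.
Qed.

End Subgroups.

(** * Free modules *)

Section FreeModule.
Variables (B : pzRingType) (X : choiceType).

Record freemod := Freemod {
  fcoef :> X -> B;
  fcoef_fin : exists s : seq X, forall x, x \notin s -> fcoef x = 0
}.

Lemma freemodP (f g : freemod) : (forall x, f x = g x) -> f = g.
Proof.
case: f g => [f pf] [g pg] /= fg.
have {}fg : f = g by exact: functional_extensionality_dep.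
by subst g; congr Freemod; apply: Prop_irrelevance.
Qed.

HB.instance Definition _ := gen_eqMixin freemod.
HB.instance Definition _ := gen_choiceMixin freemod.

Fact fzero_fin : exists s : seq X, forall x, x \notin s -> (0 : B) = 0.
Proof. by exists [::]. Qed.
Fact fopp_fin (f : freemod) : exists s : seq X, forall x, x \notin s -> - f x = 0.
Proof. by have [s fs] := fcoef_fin f; exists s => x /fs ->; rewrite oppr0. Qed.
Fact fadd_fin (f g : freemod) :
  exists s : seq X, forall x, x \notin s -> f x + g x = 0.
Proof.
have [s fs] := fcoef_fin f; have [t gt] := fcoef_fin g; exists (s ++ t) => x.
by rewrite mem_cat negb_or => /andP[/fs -> /gt ->]; rewrite addr0.
Qed.
Fact fscale_fin b (f : freemod) :
  exists s : seq X, forall x, x \notin s -> b * f x = 0.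
Proof. by have [s fs] := fcoef_fin f; exists s => x /fs ->; rewrite mulr0. Qed.

Let fzero := Freemod fzero_fin.
Let fopp f := Freemod (fopp_fin f).
Let fadd f g := Freemod (fadd_fin f g).
Let fscale b f := Freemod (fscale_fin b f).

Fact fadd_A : associative fadd.
Proof. by move=> f g h; apply: freemodP => x; apply: addrA. Qed.
Fact fadd_C : commutative fadd.
Proof. by move=> f g; apply: freemodP => x; apply: addrC. Qed.
Fact fadd_0 : left_id fzero fadd.
Proof. by move=> f; apply: freemodP => x; apply: add0r. Qed.
Fact fadd_N : left_inverse fzero fopp fadd.
Proof. by move=> f; apply: freemodP => x; apply: addNr. Qed.
HB.instance Definition _ :=
  GRing.isZmodule.Build freemod fadd_A fadd_C fadd_0 fadd_N.

Fact fscale_A a b f : fscale a (fscale b f) = fscale (a * b) f.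
Proof. by apply: freemodP => x; apply: mulrA. Qed.
Fact fscale_1 : left_id 1 fscale.
Proof. by move=> f; apply: freemodP => x; apply: mul1r. Qed.
Fact fscale_Dr : right_distributive fscale +%R.
Proof. by move=> b f g; apply: freemodP => x; apply: mulrDr. Qed.
Fact fscale_Dl f : {morph fscale^~ f : a b / a + b}.
Proof. by move=> a b; apply: freemodP => x; apply: mulrDl. Qed.
HB.instance Definition _ := GRing.Zmodule_isLmodule.Build B freemod
  fscale_A fscale_1 fscale_Dr fscale_Dl.

Lemma fcoefD (f g : freemod) x : (f + g) x = f x + g x. Proof. by []. Qed.
Lemma fcoefB (f g : freemod) x : (f - g) x = f x - g x. Proof. by []. Qed.
Lemma fcoefZ b (f : freemod) x : (b *: f) x = b * f x. Proof. by []. Qed.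

Fact fbasis_fin x :
  exists s : seq X, forall y, y \notin s -> (if y == x then 1 else 0 : B) = 0.
Proof. by exists [:: x] => y; rewrite inE => /negPf ->. Qed.
Definition fbasis x : freemod := Freemod (fbasis_fin x).

Fact frestr_fin (P : pred X) (f : freemod) :
  exists s : seq X, forall y, y \notin s -> (if P y then f y else 0) = 0.
Proof. by have [s fs] := fcoef_fin f; exists s => y /fs ->; case: ifP. Qed.
Definition frestr P f : freemod := Freemod (frestr_fin P f).

Section Fsum.
Variables (M : lmodType B) (phi : X -> M).

Definition fsum (f : freemod) : M :=
  \sum_(x <- undup (projT1 (cid (fcoef_fin f)))) f x *: phi x.

(** [fsum] runs over a support picked by choice; only the terms with nonzero coefficient count,
    which makes the choice immaterial. *)
Lemma fsumE (f : freemod) s : uniq s -> (forall x, x \notin s -> f x = 0) ->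
  fsum f = \sum_(x <- s) f x *: phi x.
Proof.
rewrite /fsum; case: cid => t /= ft us fs.
have aux (r : seq X) : \sum_(x <- r) f x *: phi x =
    \sum_(x <- [seq x <- r | f x != 0]) f x *: phi x.
  rewrite big_filter [LHS](bigID (fun x => f x != 0)) /= [X in _ + X]big1 ?addr0 //.
  by move=> x; rewrite negbK => /eqP ->; rewrite scale0r.
rewrite aux [RHS]aux; apply: perm_big; apply: uniq_perm.
- exact/filter_uniq/undup_uniq.
- exact: filter_uniq.
move=> x; rewrite !mem_filter mem_undup; case: eqVneq => //= fx0.
have -> : x \in t by apply: contraNT fx0 => /ft ->.
by have -> : x \in s by apply: contraNT fx0 => /fs ->.
Qed.

Fact fsum_linear : linear fsum.
Proof.
move=> b f g; have [s fs] := fcoef_fin f; have [t gt] := fcoef_fin g.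
have fs' x : x \notin undup (s ++ t) -> f x = 0.
  by rewrite mem_undup mem_cat negb_or => /andP[/fs].
have gt' x : x \notin undup (s ++ t) -> g x = 0.
  by rewrite mem_undup mem_cat negb_or => /andP[_ /gt].
rewrite (fsumE (undup_uniq (s ++ t)) fs') (fsumE (undup_uniq (s ++ t)) gt').
rewrite (fsumE (undup_uniq (s ++ t))); last first.
  by move=> x xst; rewrite fcoefD fcoefZ fs' // gt' // mulr0 addr0.
rewrite scaler_sumr -big_split; apply: eq_bigr => x _ /=.
by rewrite scalerDl scalerA.
Qed.
HB.instance Definition _ := GRing.isLinear.Build B freemod M _ fsum fsum_linear.

Lemma fsum0 : fsum 0 = 0. Proof. exact: raddf0. Qed.
Lemma fsumD : {morph fsum : f g / f + g}. Proof. exact: raddfD. Qed.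
Lemma fsumB : {morph fsum : f g / f - g}. Proof. exact: raddfB. Qed.
Lemma fsumZ b f : fsum (b *: f) = b *: fsum f.
Proof. exact: linearZ_LR. Qed.

Lemma fsum_basis x : fsum (fbasis x) = phi x.
Proof.
rewrite (@fsumE _ [:: x]) // => [|y]; first by rewrite big_seq1 /= eqxx scale1r.
by rewrite inE /= => /negPf ->.
Qed.

Lemma fsum_ind (P : set M) (f : freemod) : subgroup P -> (forall x, P (f x *: phi x)) -> P (fsum f).
Proof. by move=> sP Pf; apply: subgroup_sum. Qed.

End Fsum.

(** The two sums share their coefficients, a link that would be lost if they were treated one at a
    time. *)
Lemma fsum_ind2 (M N : lmodType B) (phi : X -> M) (psi : X -> N)
    (P : set (M * N)%type) (f : freemod) :
  subgroup P -> (forall x, P (f x *: phi x, f x *: psi x)) ->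
  P (fsum phi f, fsum psi f).
Proof.
move=> sP Pf; rewrite /fsum; elim: (undup _) => [|x s IH].
  by rewrite !big_nil; case: sP.
by rewrite !big_cons; apply: (subgroupD sP (Pf x) IH).
Qed.

Lemma eq_fsum (M : lmodType B) (phi psi : X -> M) (f : freemod) :
  (forall x, f x *: phi x = f x *: psi x) -> fsum phi f = fsum psi f.
Proof. by move=> e; apply: eq_bigr. Qed.

Lemma fsum_fbasis f : fsum fbasis f = f.
Proof.
apply: freemodP => y; have [s fs] := fcoef_fin f.
rewrite (@fsumE _ _ _ (undup s)) ?undup_uniq // => [|x]; last first.
  by rewrite mem_undup; apply: fs.
rewrite (big_morph (fun g : freemod => g y) (id1 := 0) (op1 := +%R)) //.
have [ys|ys] := boolP (y \in s); last first.
  rewrite fs // big1_seq // => x /=; rewrite mem_undup => xs.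
  case: eqP => [e|]; last by rewrite mulr0.
  by rewrite e xs in ys.
rewrite (bigD1_seq y) ?mem_undup ?undup_uniq //= eqxx mulr1 big1 ?addr0 //.
by move=> x xy; rewrite eq_sym (negPf xy) mulr0.
Qed.

Lemma fsum_frestr (M : lmodType B) (phi : X -> M) (P : pred X) f :
  fsum phi (frestr P f) = fsum (fun x => if P x then phi x else 0) f.
Proof.
have [s fs] := fcoef_fin f.
have fs' x : x \notin undup s -> f x = 0 by rewrite mem_undup; apply: fs.
rewrite (fsumE _ (undup_uniq s) fs') (fsumE _ (undup_uniq s)); last first.
  by move=> x /fs' /= ->; case: ifP.
by apply: eq_bigr => x _ /=; case: ifP; rewrite ?scaler0 ?scale0r.
Qed.

Lemma linear_fsum (M N : lmodType B) (D : {linear M -> N}) (phi : X -> M) f :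
  D (fsum phi f) = fsum (D \o phi) f.
Proof. by rewrite raddf_sum; apply: eq_bigr => x _; exact: linearZ_LR. Qed.

Lemma freemod_projective : left_projective freemod.
Proof.
move=> N N' g h g_surj.
exists (fsum (fun x => projT1 (cid (g_surj (h (fbasis x)))))) => f.
rewrite -[in RHS](fsum_fbasis f) !linear_fsum; apply: eq_bigr => x _ /=.
by case: cid => y /= ->.
Qed.

End FreeModule.
Arguments fbasis {B X} x.

Section Functoriality.
Variables (B C : pzRingType) (X : choiceType).

(* Testing for 0 makes the support finite without a condition on the c x.     *)
Fact fmap_fin (c : X -> B -> C) (f : freemod B X) : exists s : seq X,
  forall x, x \notin s -> (if f x == 0 then 0 else c x (f x)) = 0.
Proof. by have [s fs] := fcoef_fin f; exists s => x /fs ->; rewrite eqxx. Qed.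
Definition fmap c f : freemod C X := Freemod (fmap_fin c f).

Lemma fmapE c (f : freemod B X) x : c x 0 = 0 -> fmap c f x = c x (f x).
Proof. by move=> c0 /=; case: eqP => [->|]. Qed.

(** The coefficients are only transported one by one, never added; hence [c] is merely asked to
    preserve 0. The main cases are [sunit] and [tcan]. *)
Lemma fsum_semilinear (c : B -> C) (M : lmodType B) (N : lmodType C)
    (D : M -> N) (phi : X -> M) (f : freemod B X) :
  c 0 = 0 -> {morph D : x y / x - y} -> (forall b x, D (b *: x) = c b *: D x) ->
  D (fsum phi f) = fsum (D \o phi) (fmap (fun=> c) f).
Proof.
move=> c0 DB DZ; have [s fs] := fcoef_fin f.
have us := undup_uniq s.
have fs' x : x \notin undup s -> f x = 0 by rewrite mem_undup; apply: fs.
rewrite (fsumE _ us fs') (fsumE _ us); last first.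
  by move=> x /fs' fx; rewrite fmapE // fx.
have D0 : D 0 = 0 by rewrite -(subrr 0) DB subrr.
have DD : {morph D : x y / x + y}.
  by move=> x y; rewrite -[y in LHS]opprK DB -[- y]sub0r DB D0 sub0r opprK.
rewrite (big_morph D DD D0); apply: eq_bigr => x _.
by rewrite DZ fmapE.
Qed.
End Functoriality.

Lemma fsum_morph (B : pzRingType) (X : choiceType) (M N : lmodType B)
    (D : M -> N) (phi : X -> M) (f : freemod B X) :
  {morph D : x y / x - y} -> (forall b x, D (b *: x) = b *: D x) ->
  D (fsum phi f) = fsum (D \o phi) f.
Proof.
move=> DB DZ; rewrite (@fsum_semilinear _ _ _ id _ _ D) //; congr fsum.
by apply: freemodP => x; rewrite fmapE.
Qed.

(** The dual basis lemma: a free cover of a projective module splits, and the splitting provides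
    coordinates that depend linearly on the element. *)
Lemma left_projective_section (S : pzRingType) (M : lmodType S) (X : choiceType)
    (phi : X -> M) :
  left_projective M -> (forall m, exists f, fsum phi f = m) ->
  exists k : {linear M -> freemod S X}, forall m, fsum phi (k m) = m.
Proof. by move=> pM surj; have [k kE] := pM _ M (fsum phi) idfun surj; exists k. Qed.

(** * Graded modules and graded free modules *)

Section GradedModules.
Variable M : gradedZmodType.

(** [gproj_fin] only supplies some bound; the components between it and any other degree bound
    vanish. *)
Lemma gproj_recover N (x : M) : upto M N x -> x = \sum_(n < N.+1) gproj n x.
Proof.
move=> xN; have [K xE] := gproj_fin x.
have aux L L' : (L <= L')%N -> (forall n, (L <= n)%N -> gproj n x = 0) ->
    \sum_(n < L') gproj n x = \sum_(n < L) gproj n x.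
  move=> LL' xL; rewrite (big_ord_widen _ (fun n => gproj n x) LL').
  rewrite [LHS](bigID (fun n : 'I_L' => (n < L)%N)) /= [X in _ + X]big1 ?addr0 //.
  by move=> n; rewrite -leqNgt => /xL.
rewrite {1}xE; case: (leqP K N.+1) => [KN|/ltnW NK].
  apply/esym/aux => // n Kn; rewrite xE gproj_sum big1 // => i _.
  by rewrite gproj_orth gtn_eqF // (leq_trans _ Kn).
exact: aux.
Qed.

Lemma gproj_ind (P : set M) x : subgroup P -> (forall n, P (gproj n x)) -> P x.
Proof.
move=> sP Px; have [N xN] := gproj_fin x.
by rewrite xN; apply: subgroup_sum.
Qed.

Lemma homog_sum n J (r : seq J) (P : pred J) (F : J -> M) :
  (forall i, P i -> homog M n (F i)) -> homog M n (\sum_(i <- r | P i) F i).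
Proof. exact: (subgroup_sum _ (homog_subgroup M n)). Qed.

Lemma gproj_morph (N : gradedZmodType) (D : M -> N) :
  {morph D : x y / x - y} ->
  (forall n x, homog M n x -> homog N n (D x)) ->
  forall n x, gproj n (D x) = D (gproj n x).
Proof.
move=> DB Dh n x; have D0 : D 0 = 0 by rewrite -(subrr 0) DB subrr.
apply: (@gproj_ind [set x | gproj n (D x) = D (gproj n x)]) => [|m] /=.
  split=> [|a b] /=; first by rewrite gproj0 D0 gproj0.
  by move=> ea eb; rewrite gprojB !DB gprojB ea eb.
have [->|nm] := eqVneq n m; first by rewrite gproj_orth eqxx; exact/Dh/gproj_homog.
rewrite gproj_orth (negPf nm) D0.
exact: homog_neq (Dh _ _ (gproj_homog m x)) nm.
Qed.
End GradedModules.

(* The generator x is placed in degree deg x.                                 *)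
Definition gfree (S : pzRingType) (A : gradedSRingType S) (X : choiceType)
  (deg : X -> nat) : Type := freemod A X.

Section GradedFree.
Variables (S : pzRingType) (A : gradedSRingType S).
Variables (X : choiceType) (deg : X -> nat).
Local Notation gfree := (gfree A deg).
HB.instance Definition _ := GRing.Lmodule.on gfree.
Implicit Types f g : gfree.

Fact gfree_proj_fin n f : exists s : seq X, forall x, x \notin s ->
  (if (deg x <= n)%N then gproj (n - deg x) (f x) else 0) = 0.
Proof.
have [s fs] := fcoef_fin f; exists s => x /fs ->; rewrite gproj0.
by case: ifP.
Qed.
Definition gfree_proj n f : gfree := Freemod (gfree_proj_fin n f).

Fact gfree_projD n f g : gfree_proj n (f + g) = gfree_proj n f + gfree_proj n g.
Proof.
apply: freemodP => x; rewrite fcoefD /=; case: ifP => _; last by rewrite addr0.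
by rewrite gprojD.
Qed.
Fact gfree_proj_orth m n f :
  gfree_proj m (gfree_proj n f) = if m == n then gfree_proj n f else 0.
Proof.
apply: freemodP => x /=; case: ifP => [dm|dm].
  case: ifP => [dn|dn].
    rewrite gproj_orth -(eqn_add2r (deg x)) !subnK //.
    by case: (m == n) => //=; rewrite dn.
  by rewrite gproj0; case: ifP => //= _; rewrite dn.
by case: eqP => //= e; rewrite -e dm.
Qed.
Fact gfree_proj_sum f : exists N, f = \sum_(n < N) gfree_proj n f.
Proof.
have [s fs] := fcoef_fin f.
pose b x := projT1 (cid (upto_fin (f x))).
have bP x : upto A (b x) (f x) by rewrite /b; case: cid.
exists (\max_(x <- s) (b x + deg x)).+1; apply: freemodP => x.
rewrite (big_morph (fun g : gfree => g x) (id1 := 0) (op1 := +%R)) //=.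
have [xs|xs] := boolP (x \in s); last first.
  by rewrite fs // big1 // => n _; rewrite gproj0; case: ifP.
have bN : (b x + deg x <= \max_(x <- s) (b x + deg x))%N.
  exact: (leq_bigmax_seq (F := fun x => (b x + deg x)%N) x xs).
move: (\max_(_ <- _) _)%N bN => N bN.
have dN : (deg x <= N.+1)%N by rewrite (leq_trans (leq_addl (b x) _)) // ltnW.
rewrite -(big_mkord predT (fun n => if (deg x <= n)%N then gproj (n - deg x) (f x) else 0)).
rewrite (big_cat_nat (leq0n (deg x)) dN) /= big_nat big1 ?add0r; last first.
  by move=> n /andP[_ nd]; rewrite leqNgt nd.
rewrite -{1}[deg x]add0n big_addn big_mkord.
have dN' : (deg x <= N)%N by rewrite (leq_trans (leq_addl (b x) _)).
rewrite (subSn dN').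
rewrite {1}(@gproj_recover _ (N - deg x) (f x)); last first.
  by apply: uptoS (bP x); rewrite leq_subRL // addnC.
by apply: eq_bigr => n _; rewrite leq_addl addnK.
Qed.
HB.instance Definition _ :=
  Zmodule_isGraded.Build gfree gfree_projD gfree_proj_orth gfree_proj_sum.

Lemma gfree_projE n f x :
  gproj n f x = if (deg x <= n)%N then gproj (n - deg x) (f x) else 0.
Proof. by []. Qed.

Lemma gfree_homogP n f : homog gfree n f <->
  forall x, if (deg x <= n)%N then homog A (n - deg x) (f x) else f x = 0.
Proof.
split=> [fn x|fn]; last first.
  apply: freemodP => x; rewrite gfree_projE; have := fn x.
  by case: ifP => _ // ->.
rewrite -fn gfree_projE; case: ifP => dn; rewrite dn //; exact: gproj_homog.
Qed.

Fact gfree_homogZ m n (a : A) f :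
  homog A m a -> homog gfree n f -> homog gfree (m + n) (a *: f).
Proof.
move=> am /gfree_homogP fn; apply/gfree_homogP => x; have := fn x; rewrite fcoefZ.
case: (leqP (deg x) n) => [dn fx|dn ->].
  by rewrite (leq_trans dn (leq_addl _ _)) -addnBA //; apply: homogM.
by rewrite mulr0; case: ifP => // _; rewrite /homog /= gproj0.
Qed.
HB.instance Definition _ := Lmodule_isGradedLmod.Build S A gfree gfree_homogZ.

Lemma gfree_basis_homog x : homog gfree (deg x) (fbasis x).
Proof.
apply/gfree_homogP => y /=; case: eqP => [->|_]; last first.
  by case: ifP => // _; rewrite /homog /= gproj0.
rewrite leqnn subnn -(@sunit1 S A); exact: sunit_homog.
Qed.

Lemma fsum_homog (M : gradedLmodType A) (phi : X -> M) n f :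
  (forall x, homog M (deg x) (phi x)) -> homog gfree n f ->
  homog M n (fsum phi f).
Proof.
move=> ph /gfree_homogP fn; apply: homog_sum => x _; have := fn x.
case: ifP => [dn fx|_ ->]; last by rewrite scale0r /homog /= gproj0.
by rewrite -[n in homog M n](subnK dn); apply: homogZ.
Qed.

Lemma gfree_projective : left_projective gfree.
Proof. exact: freemod_projective. Qed.

End GradedFree.

Section GradedMul.
Variables (S : pzRingType) (B : gradedSRingType S).
Implicit Types x y : B.

Lemma gprojMl m n x y : homog B m x ->
  gproj n (x * y) = if (m <= n)%N then x * gproj (n - m) y else 0.
Proof.
move=> xm; apply: (@gproj_ind _ [set y |
  gproj n (x * y) = if (m <= n)%N then x * gproj (n - m) y else 0]) => [|k] /=.
  split=> [|a b] /=; first by rewrite mulr0 !gproj0 mulr0 if_same.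
  move=> ea eb; rewrite mulrBr !gprojB ea eb mulrBr.
  by case: ifP => _ //; rewrite subr0.
have xk := homogM xm (gproj_homog k y); rewrite gproj_orth.
case: (leqP m n) => [mn|nm]; last first.
  by rewrite (homog_neq xk) // ltn_eqF // (leq_trans nm) ?leq_addr.
case: eqP => [nk|nk]; first by move: xk; rewrite -nk subnKC.
rewrite mulr0 (homog_neq xk) //; apply/eqP => nE; case: nk.
by rewrite nE addnC addnK.
Qed.

Lemma gprojMr m n x y : homog B m y ->
  gproj n (x * y) = if (m <= n)%N then gproj (n - m) x * y else 0.
Proof.
move=> ym; apply: (@gproj_ind _ [set x |
  gproj n (x * y) = if (m <= n)%N then gproj (n - m) x * y else 0]) => [|k] /=.
  split=> [|a b] /=; first by rewrite mul0r !gproj0 mul0r if_same.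
  move=> ea eb; rewrite mulrBl !gprojB ea eb mulrBl.
  by case: ifP => _ //; rewrite subr0.
have xk := homogM (gproj_homog k x) ym; rewrite gproj_orth.
case: (leqP m n) => [mn|nm]; last first.
  by rewrite (homog_neq xk) // ltn_eqF // (leq_trans nm) ?leq_addl.
case: eqP => [nk|nk]; first by move: xk; rewrite -nk subnK.
rewrite mul0r (homog_neq xk) //; apply/eqP => nE; case: nk.
by rewrite nE addnK.
Qed.

Lemma gprojM n x y : gproj n (x * y) = \sum_(i < n.+1) gproj i x * gproj (n - i) y.
Proof.
apply: (@gproj_ind _ [set x |
  gproj n (x * y) = \sum_(i < n.+1) gproj i x * gproj (n - i) y]) => [|k] /=.
  split=> [|a b] /=.
    by rewrite mul0r gproj0 big1 // => i _; rewrite gproj0 mul0r.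
  move=> ea eb; rewrite mulrBl gprojB ea eb -sumrB.
  by apply: eq_bigr => i _; rewrite gprojB mulrBl.
rewrite (gprojMl _ _ (gproj_homog k x)).
case: (leqP k n) => [kn|nk]; last first.
  rewrite big1 // => i _; rewrite gproj_orth ltn_eqF ?mul0r //.
  exact: leq_ltn_trans (leq_ord i) nk.
rewrite (bigD1 (Ordinal (kn : (k < n.+1)%N))) //= gproj_orth eqxx big1 ?addr0 //.
move=> i ik; rewrite gproj_orth; case: eqP => [e|_]; last by rewrite mul0r.
by case/eqP: ik; apply: val_inj.
Qed.

End GradedMul.

(** * Free resolutions and Tor *)

Section FreeResolution.
Variables (S : pzRingType) (A : connSRingType S).

(** Source, target and map are bundled so that the construction [cover] of a next stage can be
    iterated. *)
Record stage := Stage {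
  dom_gen : choiceType; dom_deg : dom_gen -> nat;
  cod_gen : choiceType; cod_deg : cod_gen -> nat;
  stage_map : dom_gen -> gfree A cod_deg;
  stage_homog : forall x, homog (gfree A cod_deg) (dom_deg x) (stage_map x)
}.

Definition stage_diff (s : stage) :
  {linear gfree A (@dom_deg s) -> gfree A (@cod_deg s)} := fsum (@stage_map s).

Lemma stage_diff_homog (s : stage) n x :
  homog (gfree A (@dom_deg s)) n x -> homog (gfree A (@cod_deg s)) n (stage_diff s x).
Proof. exact/fsum_homog/stage_homog. Qed.

Lemma stage_diff_proj (s : stage) n x :
  gproj n (stage_diff s x) = stage_diff s (gproj n x).
Proof.
apply: gproj_morph => [y z|m y]; [exact: raddfB | exact: stage_diff_homog].
Qed.

Section Cover.
Variable s : stage.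
Local Notation F := (gfree A (@dom_deg s)).

(* Indexing the generators by all pairs (n, f), instead of by the homogeneous *)
(* elements of the kernel, avoids dependent types.                            *)
Definition cover_map (p : nat * F) : F :=
  if stage_diff s (gproj p.1 p.2) == 0 then gproj p.1 p.2 else 0.

Lemma cover_homog p : homog F p.1 (cover_map p).
Proof.
rewrite /cover_map; case: ifP => _; first exact: gproj_homog.
by case: (homog_subgroup F p.1).
Qed.

Definition cover : stage :=
  @Stage (nat * F)%type fst (dom_gen s) (@dom_deg s) cover_map cover_homog.

Lemma cover_exact x :
  stage_diff s x = 0 <-> exists y, stage_diff cover y = x.
Proof.
split=> [x0|[y <-]]; last first.
  rewrite [stage_diff s _]linear_fsum.
  rewrite [LHS]big1 // => p _ /=.
  suff -> : stage_diff s (cover_map p) = 0 by rewrite scaler0.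
  by rewrite /cover_map; case: eqP => // _; rewrite raddf0.
have [N xN] := gproj_fin x.
exists (\sum_(n < N) fbasis (n : nat, x) : freemod A (nat * F)%type).
rewrite raddf_sum [RHS]xN; apply: eq_bigr => n _.
by rewrite [LHS]fsum_basis /= /cover_map /= -stage_diff_proj x0 gproj0 eqxx.
Qed.

End Cover.

Section Resolve.
Variables (X1 : choiceType) (deg1 : X1 -> nat).
Variable phi1 : X1 -> gfree A (fun _ : unit => 0%N).
Hypothesis phi1_homog : forall x, homog (gfree A (fun _ : unit => 0%N)) (deg1 x) (phi1 x).
Variables (X2 : choiceType) (deg2 : X2 -> nat) (phi2 : X2 -> gfree A deg1).
Hypothesis phi2_homog : forall x, homog (gfree A deg1) (deg2 x) (phi2 x).

Let s1 := Stage phi1_homog.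
Let s2 := Stage phi2_homog.

Definition res_aug : {linear gfree A (fun _ : unit => 0%N) -> trivmod A} :=
  fsum (fun=> (1 : S) : trivmod A).

Hypothesis exact0 : forall x, res_aug x = 0 <-> exists y, stage_diff s1 y = x.
Hypothesis exact1 : forall x, stage_diff s1 x = 0 <-> exists y, stage_diff s2 y = x.

Definition res_stage i : stage := match i with 0 => s1 | i.+1 => iter i cover s2 end.

Definition res_mod i : gradedLmodType A :=
  match i with
  | 0 => [the gradedLmodType A of gfree A (fun _ : unit => 0%N)]
  | i.+1 => [the gradedLmodType A of gfree A (@dom_deg (res_stage i))]
  end.

(** The target of a cover is by conversion the source of the stage it covers; the two given stages
    [s1] and [s2] are not covers and need their own cases. *)
Definition res_diff i : {linear res_mod i.+1 -> res_mod i} :=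
  match i with
  | 0 => stage_diff s1
  | 1 => stage_diff s2
  | i.+2 => stage_diff (res_stage i.+2)
  end.

Lemma res_augE f : res_aug f = augm (f tt).
Proof.
rewrite [LHS](@fsumE _ _ _ _ _ [:: tt]) //.
by rewrite big_seq1; exact: mulr1.
Qed.

Fact res_proj i : left_projective (res_mod i).
Proof. by case: i => [|i]; apply: gfree_projective. Qed.

Fact res_diff_homog i n x :
  homog (res_mod i.+1) n x -> homog (res_mod i) n (res_diff i x).
Proof. by case: i x => [|[|i]] x; apply: stage_diff_homog. Qed.

Fact res_aug_homog n x : (0 < n)%N -> homog (res_mod 0) n x -> res_aug x = 0.
Proof.
move=> n_gt0 /gfree_homogP /(_ tt); rewrite subn0 /= => xn.
apply: (@sunit_inj S A); rewrite res_augE augmE (homog_neq xn) ?ltn_eqF //.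
by apply: (addIr (sunit 0)); rewrite -sunitD !add0r.
Qed.

Fact res_aug_surj s : exists x, res_aug x = s.
Proof.
exists (sunit (s : S) *: fbasis tt); rewrite res_augE /= mulr1.
apply: (@sunit_inj S A); rewrite augmE; exact: sunit_homog.
Qed.

Fact res_exact i x :
  res_diff i x = 0 <-> exists y, res_diff i.+1 y = x.
Proof.
case: i x => [|[|i]] x; first exact: exact1; first exact: (@cover_exact s2 x).
exact: (@cover_exact (res_stage i.+2) x).
Qed.

Definition resolution : gresolution A :=
  GResolution res_proj res_diff_homog res_aug_homog res_aug_surj exact0 res_exact.

End Resolve.

End FreeResolution.

(** A substitute for the map that a tensor product would induce into M / N: balancedness is required
    modulo N only, and no quotient is formed. *)
Lemma tens_eq_sum (A : pzRingType) (X : rmodType A) (Y : lmodType A)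
    (M : zmodType) (N : set M) (f : X -> Y -> M) s t :
  subgroup N ->
  (forall x x' y, f (x + x') y = f x y + f x' y) ->
  (forall x y y', f x (y + y') = f x y + f x y') ->
  (forall x a y, N (f (rscale x a) y - f x (a *: y))) ->
  tens_eq s t -> N (\sum_(p <- s) f p.1 p.2 - \sum_(p <- t) f p.1 p.2).
Proof.
move=> sN fDl fDr fb; have N0 := subgroup0 sN.
elim=> {s t} [s|s t _ IH|s t u _ IH1 _ IH2|s s' t t' _ IH1 _ IH2|s t|y|x x' y|x y y'|x a y].
- by rewrite subrr.
- by rewrite -opprB; apply: (subgroupN sN).
- by have := subgroupD sN IH1 IH2; rewrite addrA subrK.
- by rewrite !big_cat /= opprD addrACA; apply: (subgroupD sN).
- by rewrite !big_cat /= [X in X - _]addrC subrr.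
- have f0 : f 0 y = 0 by apply: (addIr (f 0 y)); rewrite -fDl !add0r.
  by rewrite big_seq1 big_nil /= f0 subrr.
- by rewrite !big_cons big_nil /= fDl !addr0 subrr.
- by rewrite !big_cons big_nil /= fDr !addr0 subrr.
- by rewrite !big_seq1 /=; apply: fb.
Qed.

Lemma tpurer0 (A : pzRingType) (X : rmodType A) (Y : lmodType A) (x : X) :
  tpure x (0 : Y) = 0.
Proof. by apply: (addIr (tpure x 0)); rewrite -tpureDr !add0r. Qed.

Section AugmentationSubmodule.
Variables (S : pzRingType) (A : connSRingType S).

Definition augspan (Y : lmodType A) (K : set Y) : set Y :=
  addspan [set a *: y | a in [set a : A | augm a = 0] & y in K].

Lemma augm_sunit (s : S) : augm (sunit s : A) = s.
Proof. by apply: (@sunit_inj S A); rewrite augmE; apply: sunit_homog. Qed.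

Lemma augmB (a b : A) : augm (a - b) = augm a - augm b.
Proof.
by apply: (addIr (augm b)); rewrite -augmD !subrK.
Qed.

(** This is S (x)_A Y = Y / A_+ Y. The map (s, y) |-> s y is balanced modulo A_+ Y, since s augm(a)
    - s a has augmentation 0. *)
Lemma tpure1_eq0 (Y : lmodType A) (y : Y) :
  tpure (1 : trivmod A) y = 0 -> augspan setT y.
Proof.
move=> /tens_piP e; pose f (s : trivmod A) y := sunit (s : S) *: y : Y.
have := @tens_eq_sum _ _ _ _ (augspan setT) f _ _ (addspan_subgroup _) _ _ _ e.
rewrite big_seq1 big_nil subr0 /f /= (@sunit1 S A) scale1r; apply.
- by move=> s s' x; rewrite sunitD scalerDl.
- by move=> s x x'; rewrite scalerDr.
move=> s a x; apply: addspan_gen.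
exists (sunit ((s : S) * augm a) - sunit (s : S) * a).
  by rewrite /= augmB augmM !augm_sunit subrr.
by exists x => //; rewrite scalerBl scalerA.
Qed.

Lemma tpure1_surj (Y : lmodType A) (z : tens (trivmod A) Y) :
  exists y, z = tpure (1 : trivmod A) y.
Proof.
elim/tens_ind: z => [|s y _ [y' ->]].
  by exists 0; rewrite tpurer0.
exists (sunit (s : S) *: y + y'); rewrite tpureDr; congr (_ + _).
rewrite -tpure_balanced; congr tpure; by rewrite /= [RHS]mul1r augm_sunit.
Qed.

Lemma tpure1_aug (Y : lmodType A) (y : Y) :
  augspan setT y -> tpure (1 : trivmod A) y = 0.
Proof.
apply: (@addspan_ind _ _ [set y | tpure (1 : trivmod A) y = 0]).
  split=> [|u v] /= ; first exact: tpurer0.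
  move=> u0 v0; apply: (addIr (tpure (1 : trivmod A) v)).
  by rewrite -tpureDr subrK add0r u0 v0.
move=> _ [a /= a0 [x _ <-]]; rewrite /= -tpure_balanced.
have -> : rscale (1 : trivmod A) a = 0 by rewrite [LHS]mul1r.
by apply: (addIr (tpure (0 : trivmod A) x)); rewrite -tpureDl !add0r.
Qed.

(* Minimality in homological degree 2 enters as the assumption that z lies in *)
(* A_+ P_2.                                                                   *)
Lemma Tor_zero_syzygy (P : gresolution A) n (z : P 2) :
  TorS_zero A 2 \/ TorS_zero_deg A 2 n ->
  homog (P 2) n z -> gres_diff P 1 z = 0 -> augspan setT z ->
  augspan [set y | gres_diff P 1 y = 0] z.
Proof.
move=> Tor zn dz zaug.
have [q0 q0E] := (gres_exact z).1 dz.
have dB i : {morph gres_diff P i : x y / x - y} by move=> x y; exact: raddfB.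
(* The component of degree n is still a preimage of [z], and is homogeneous as the graded vanishing
   of Tor requires. *)
pose q := gproj n q0.
have qE : gres_diff P 2 q = z.
  rewrite /q -(@gproj_morph _ _ (gres_diff P 2)) ?q0E //; first exact: dB.
  by move=> m x; apply: gres_diff_homog.
have bal i : balanced (fun (s : trivmod A) (x : P i.+1) => tpure s (gres_diff P i x)).
  split=> [s s' x|s x y|s a x]; first exact: tpureDl.
    by rewrite raddfD tpureDr.
  by rewrite linearZ_LR tpure_balanced.
pose t : tcomplex P 3 := tpure (1 : trivmod A) q.
have dt : tcomplex_diff t = 0.
  by rewrite /tcomplex_diff /t (tens_liftE (bal 2)) qE tpure1_aug.
have tn : tcomplex_homog n t.
  by apply: addspan_gen; exists 1 => //; exists q => //; apply: gproj_homog.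
have [w wE] : exists w, tcomplex_diff w = t.
  by case: Tor => [T0|Tn]; [exact: T0 | have [w _ wE] := Tn P t tn dt; exists w].
have [p pE] := tpure1_surj w.
(* In S (x) P_3 the class of [q] is that of the boundary of [p], so the difference lies in A_+ P_3;
   applying the differential puts [z] in A_+ times cycles. *)
have qp : augspan setT (q - gres_diff P 3 p).
  apply: tpure1_eq0; apply: (addIr (tpure (1 : trivmod A) (gres_diff P 3 p))).
  rewrite -tpureDr subrK add0r -/t -wE pE /tcomplex_diff.
  by rewrite (tens_liftE (bal 3)).
have -> : z = gres_diff P 2 (q - gres_diff P 3 p).
  rewrite dB qE; have -> : gres_diff P 2 (gres_diff P 3 p) = 0.
    by apply/gres_exact; exists p.
  by rewrite subr0.
move: qp; apply: (addspan_ind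
  (Y := gres_diff P 2 @^-1` augspan [set y | gres_diff P 1 y = 0])).
  exact: (subgroup_preim (dB 2) (addspan_subgroup _)).
move=> _ [a a0 [x _ <-]] /=; rewrite linearZ_LR; apply: addspan_gen.
exists a => //; exists (gres_diff P 2 x) => //=.
by apply/gres_exact; exists x.
Qed.

End AugmentationSubmodule.

Lemma rscale0r (S : pzRingType) (V : rmodType S) (v : V) : rscale v 0 = 0.
Proof. by apply: (addIr (rscale v 0)); rewrite -rscaleDr !add0r. Qed.

Lemma sunit0 (S : pzRingType) (B : sringType S) : sunit 0 = 0 :> B.
Proof. by apply: (addIr (sunit 0)); rewrite -sunitD !add0r. Qed.

Lemma dsum_liftB (M : nat -> zmodType) (B : zmodType) (f : forall n, M n -> B) :
  (forall n (x y : M n), f n (x - y) = f n x - f n y) ->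
  {morph @dsum_lift M B f : x y / x - y}.
Proof.
move=> fB x y; have f0 n : f n 0 = 0 by rewrite -(subrr 0) fB subrr.
have [N xN] := dval_fin x; have [K yK] := dval_fin y.
have b (z : dsum M) L : (forall n, (L <= n)%N -> z n = 0) -> (L <= maxn N K)%N ->
    forall n, (maxn N K <= n)%N -> z n = 0.
  by move=> zL LM n Mn; apply: zL; apply: leq_trans Mn.
have xb := b x N xN (leq_maxl _ _); have yb := b y K yK (leq_maxr _ _).
rewrite (dsum_liftE f0 xb) (dsum_liftE f0 yb) (dsum_liftE (N := maxn N K) f0).
  by rewrite -sumrB; apply: eq_bigr => n _; apply: fB.
by move=> n Mn; change (x n - y n = 0); rewrite xb // yb // subrr.
Qed.

(** * The tensor ring *)

Section TensorRingTheory.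
Variables (S : pzRingType) (V : bimodType S).
Local Notation T := (tring V).
Implicit Types (x y : T) (v : V) (s : S).

Definition tgen v : T := lmulv v 1.

Lemma lmulvE v y : lmulv v y = tgen v * y.
Proof. by rewrite [RHS]tring_mulvl tring_mul1l. Qed.

Lemma tgenB : {morph tgen : v w / v - w}.
Proof.
have tD v w : tgen (v + w) = tgen v + tgen w by apply: lmulvDl.
by move=> v w; apply: (addIr (tgen w)); rewrite -tD !subrK.
Qed.
Lemma tgen0 : tgen 0 = 0. Proof. by rewrite -(subrr 0) tgenB subrr. Qed.
Lemma tgenZ s v : tgen (s *: v) = sunit s * tgen v.
Proof. by rewrite /tgen -scale_lmulv [RHS]tring_mulZl tring_mul1l. Qed.
Lemma tgen_rscale v s : tgen (rscale v s) = tgen v * sunit s.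
Proof. by rewrite -lmulvE /tgen lmulv_balanced. Qed.

Lemma tunitE s y : sunit s * y = s *: y.
Proof. by rewrite [LHS]tring_mulZl tring_mul1l. Qed.

Lemma tring_ind (P : set T) : subgroup P -> (forall s, P (sunit s)) ->
  (forall v y, P y -> P (tgen v * y)) -> forall x, P x.
Proof.
move=> sP Ps Pv x; have [N xN] := dval_fin x.
rewrite -[x]mulr1 [_ * _](tring_mulE _ xN); apply: (subgroup_sum _ sP) => n _.
elim/tpow_ind: {n}_ / (x n) => [n t u|n|a|n v u] //.
- by rewrite tactD; apply: (subgroupD sP).
- by rewrite tact0; case: sP.
- exact: Ps.
- by rewrite tact_pure lmulvE => Pu; apply: Pv.
Qed.

Definition eps x : S := x 0%N.
Arguments eps : simpl never.

Lemma epsB : {morph eps : x y / x - y}. Proof. by []. Qed.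
Lemma eps_sunit s : eps (sunit s) = s. Proof. exact: mulr1. Qed.
Lemma eps_tgen v y : eps (tgen v * y) = 0. Proof. by rewrite -lmulvE. Qed.
Lemma epsM x y : eps (x * y) = eps x * eps y.
Proof.
apply: (@tring_ind [set x | eps (x * y) = eps x * eps y]) => [|s|v z _] /=.
- split=> [|a b] /=; [|move=> ea eb]; first by rewrite mul0r -[eps 0]/(0 : S) mul0r.
  by rewrite mulrBl !epsB ea eb mulrBl.
- by rewrite eps_sunit tunitE.
- by rewrite -mulrA !eps_tgen mul0r.
Qed.

Lemma eps_gproj0 x : gproj 0 x = sunit (eps x).
Proof.
apply: dsumP => -[|n] /=; first by rewrite /tproj_val /= [RHS]mulr1.
by rewrite /tproj_val /= scaler0.
Qed.

Lemma eps_homog n x : (0 < n)%N -> homog T n x -> eps x = 0.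
Proof. by move=> n_gt0 /thomogP xn; rewrite /eps xn // ltn_eqF. Qed.

Lemma tgen_homog v : homog T 1 (tgen v).
Proof. by apply/thomogP => -[|[|n]] //= _; apply: tpure0r. Qed.

Lemma gproj_tgen n v y : gproj n.+1 (tgen v * y) = tgen v * gproj n y.
Proof.
rewrite -!lmulvE; apply: dsumP => -[|m] //=; rewrite /tproj_val /= eqSS.
by case: eqP => // _; rewrite tpure0r.
Qed.

Lemma thomog0P x : homog T 0 x -> x = sunit (eps x).
Proof. by move=> <-; rewrite eps_gproj0 eps_sunit. Qed.

Lemma thomogSP n x : homog T n.+1 x ->
  addspan [set tgen v * y | v in setT & y in homog T n] x.
Proof.
move=> <-.
apply: (@tring_ind (gproj n.+1 @^-1` addspan [set tgen v * y | v in setT & y in homog T n])).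
- exact: (subgroup_preim (gprojB _) (addspan_subgroup _)).
- move=> s /=; rewrite (homog_neq (sunit_homog s)) //; exact: addspan0.
- move=> v y _ /=; rewrite gproj_tgen; apply: addspan_gen.
  by exists v => //; exists (gproj n y) => //; apply: gproj_homog.
Qed.

Section Coordinates.
Variable kV : {linear V -> freemod S V}.
Hypothesis kVE : forall v, fsum id (kV v) = v.

Definition kT v : freemod T V := fmap (fun=> sunit) (kV v).

Lemma kTE v w : kT v w = sunit (kV v w).
Proof. by rewrite fmapE // sunit0. Qed.
Lemma kTB : {morph kT : v w / v - w}.
Proof.
move=> v w; apply: freemodP => u; rewrite fcoefB !kTE raddfB fcoefB.
by apply: (addIr (sunit (kV w u))); rewrite -sunitD !subrK.
Qed.
Lemma kTD : {morph kT : v w / v + w}.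
Proof.
by move=> v w; apply: freemodP => u; rewrite fcoefD !kTE raddfD fcoefD sunitD.
Qed.
Lemma kT0 : kT 0 = 0.
Proof. by rewrite -(subrr 0) kTB subrr. Qed.
Lemma kTZ s v : kT (s *: v) = sunit s *: kT v.
Proof.
apply: freemodP => u; rewrite fcoefZ !kTE linearZ_LR fcoefZ; exact: sunitM.
Qed.
Lemma fsum_kT v : fsum (tgen : V -> T^o) (kT v) = tgen v.
Proof.
rewrite -[in RHS](kVE v).
rewrite (@fsum_semilinear _ _ _ sunit _ T^o tgen) //; first exact: sunit0.
  exact: tgenB.
exact: tgenZ.
Qed.

Definition eps_pow n : tpow V n -> S := match n with 0 => id | _ => fun=> 0 end.

(** The recursion peels factors from the left although the last factor is the one to be expanded:
    [eps_pow] is nonzero only when the remaining tensor is a scalar, that is, when [v] is last. *)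
Fixpoint delta_pow n : tpow V n -> freemod T V :=
  match n return tpow V n -> freemod T V with
  | 0 => fun=> 0
  | m.+1 => tens_lift (fun (v : V) (u : tpow V m) =>
      tgen v *: delta_pow u + kT (rscale v (eps_pow u)))
  end.

Lemma delta_pow_props n :
  [/\ forall t u : tpow V n, delta_pow (t + u) = delta_pow t + delta_pow u,
      @delta_pow n 0 = 0,
      forall s (t : tpow V n), delta_pow (s *: t) = sunit s *: delta_pow t &
      balanced (fun (v : V) (u : tpow V n) =>
        tgen v *: delta_pow u + kT (rscale v (eps_pow u)))].
Proof.
elim: n => [|n [dD d0 dZ bal]].
  split=> //=; first by move=> *; rewrite addr0.
    by move=> *; rewrite scaler0.
  split=> [v v' s|v s s'|v a s]; rewrite ?scaler0 ?add0r /=.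
  - by rewrite rscaleDl kTD.
  - by rewrite rscaleDr kTD.
  - by rewrite rscaleA.
have dD' (t u : tpow V n.+1) : delta_pow (t + u) = delta_pow t + delta_pow u.
  exact: (tens_liftD bal).
have dP v (u : tpow V n) : @delta_pow n.+1 (tpure v u) =
    tgen v *: delta_pow u + kT (rscale v (eps_pow u)) := tens_liftE bal v u.
have dZ' s (t : tpow V n.+1) : delta_pow (s *: t) = sunit s *: delta_pow t.
  elim/tens_ind: t => [|v u t IH]; first by rewrite !scaler0 [delta_pow _](tens_lift0 bal) scaler0.
  rewrite scalerDr !dD' scalerDr IH scale_tpure !dP.
  by rewrite tgenZ -scalerA -scale_rscale kTZ scalerDr.
split=> //; first exact: (tens_lift0 bal).
split=> [v v' s|v s s'|v a s]; rewrite ?rscale0r ?kT0 ?addr0.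
- by rewrite /tgen lmulvDl scalerDl.
- by rewrite dD' scalerDr.
- by rewrite dZ' tgen_rscale scalerA.
Qed.

Lemma delta_powB n (t u : tpow V n) : delta_pow (t - u) = delta_pow t - delta_pow u.
Proof.
have [dD _ _ _] := delta_pow_props n.
by apply: (addIr (delta_pow u)); rewrite -dD !subrK.
Qed.
Lemma delta_pow0 n : @delta_pow n 0 = 0.
Proof. by have [] := delta_pow_props n. Qed.
Lemma delta_pow_pure n v (u : tpow V n) :
  @delta_pow n.+1 (tpure v u) = tgen v *: delta_pow u + kT (rscale v (eps_pow u)).
Proof. by have [_ _ _ bal] := delta_pow_props n; apply: (tens_liftE bal). Qed.

(* T_+ is the left T-module T (x)_S V, which the section kV embeds in T^(V);  *)
(* delta is this embedding, extended by 0 on S.                               *)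
Definition delta : T -> freemod T V := dsum_lift delta_pow.

Lemma deltaB : {morph delta : x y / x - y}.
Proof. exact/dsum_liftB/delta_powB. Qed.
Lemma delta0 : delta 0 = 0. Proof. by rewrite -(subrr 0) deltaB subrr. Qed.
Lemma deltaD : {morph delta : x y / x + y}.
Proof. by move=> x y; apply: (addIr (- delta y)); rewrite -deltaB !addrK. Qed.

Lemma delta_sunit s : delta (sunit s) = 0.
Proof.
rewrite /delta (dsum_liftE (N := 1) delta_pow0) ?big_ord1 //.
by case=> // n _; apply: scaler0.
Qed.

Lemma delta_tgen v y : delta (tgen v * y) = tgen v *: delta y + kT (rscale v (eps y)).
Proof.
have [N yN] := dval_fin y; rewrite -lmulvE /delta.
have yN' n : (N.+1 <= n)%N -> y n = 0 by move=> /ltnW /yN.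
rewrite (dsum_liftE delta_pow0 yN') (dsum_liftE (N := N.+2) delta_pow0); last first.
  by case=> // n /= Nn; rewrite yN' ?tpure0r.
rewrite big_ord_recl add0r scaler_sumr.
transitivity (\sum_(i < N.+1)
    (tgen v *: delta_pow (y i) + kT (rscale v (eps_pow (y i))))).
  by apply: eq_bigr => i _; exact: delta_pow_pure.
rewrite big_split /=; congr (_ + _).
rewrite big_ord_recl /= big1 ?addr0 // => i _.
by rewrite rscale0r kT0.
Qed.

Lemma delta_mulZ s y : delta (sunit s * y) = sunit s *: delta y.
Proof.
apply: (@tring_ind [set y | delta (sunit s * y) = sunit s *: delta y]) => [|a|v z IH] /=.
- split=> [|a b] /=; [|move=> ea eb]; first by rewrite mulr0 delta0 scaler0.
  by rewrite mulrBr !deltaB ea eb scalerBr.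
- by rewrite -sunitM !delta_sunit scaler0.
- by rewrite mulrA -tgenZ !delta_tgen tgenZ -scalerA -scale_rscale kTZ scalerDr.
Qed.

(** Linearity is confined to T_+: for a scalar y the coordinates of x y are those of x with its last
    factor changed, whereas delta y = 0. *)
Lemma delta_mul x y : eps y = 0 -> delta (x * y) = x *: delta y.
Proof.
move=> y0.
apply: (@tring_ind [set x | delta (x * y) = x *: delta y]) => [|a|v z IH] /=.
- split=> [|a b] /=; [|move=> ea eb]; first by rewrite mul0r delta0 scale0r.
  by rewrite mulrBl !deltaB ea eb scalerBl.
- exact: delta_mulZ.
- by rewrite -mulrA delta_tgen IH epsM y0 mulr0 rscale0r kT0 addr0 scalerA.
Qed.

Lemma delta_gen v : delta (tgen v) = kT v.
Proof.
by rewrite -[tgen v]mulr1 delta_tgen -(@sunit1 S T) delta_sunit eps_sunit scaler0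
  add0r rscale1.
Qed.

Lemma fsum_delta x : fsum (tgen : V -> T^o) (delta x) = x - sunit (eps x).
Proof.
apply: (@tring_ind [set x | fsum (tgen : V -> T^o) (delta x) = x - sunit (eps x)])
  => [|a|v z IH] /=.
- split=> [|a b] /=; [|move=> ea eb]; first by rewrite delta0 fsum0 -[eps 0]/(0 : S) sunit0 subr0.
  rewrite deltaB fsumB ea eb epsB; have -> : sunit (eps a - eps b) = sunit (eps a) - sunit (eps b) :> T.
    by apply: (addIr (sunit (eps b))); rewrite -sunitD !subrK.
  by rewrite !opprD !opprK addrACA.
- by rewrite delta_sunit fsum0 eps_sunit subrr.
- rewrite delta_tgen fsumD fsumZ IH fsum_kT eps_tgen sunit0 subr0 tgen_rscale.
  by rewrite [_ *: _]mulrBr subrK.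
Qed.

(** Thus [fsum kT] is the idempotent projection of T^(V) onto its summand T (x) V. *)
Lemma delta_fsum f : delta (fsum (tgen : V -> T^o) f) = fsum kT f.
Proof.
rewrite (big_morph delta deltaD delta0); apply: eq_bigr => v _.
by rewrite [_ *: _]/(_ * _) delta_mul ?delta_gen // -[tgen v]mulr1 eps_tgen.
Qed.

Lemma delta_homog n x v : homog T n.+1 x -> homog T n (delta x v).
Proof.
elim: n x => [|n IH] x /thomogSP.
  apply: (addspan_ind (Y := [set x | homog T 0 (delta x v)])).
    split=> [|a b] /=; [|move=> ea eb]; first by rewrite delta0; case: (homog_subgroup T 0).
    by rewrite deltaB; apply: (subgroupB (homog_subgroup T 0)).
  move=> _ [w _ [y /thomog0P -> <-]] /=.
  by rewrite delta_tgen delta_sunit scaler0 add0r kTE; apply: sunit_homog.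
apply: (addspan_ind (Y := [set x | homog T n.+1 (delta x v)])).
  split=> [|a b] /=; [|move=> ea eb]; first by rewrite delta0; case: (homog_subgroup T n.+1).
  by rewrite deltaB; apply: (subgroupB (homog_subgroup T n.+1)).
move=> _ [w _ [y yn <-]] /=; rewrite delta_mul ?(eps_homog _ yn) //.
exact: (homogM (tgen_homog w) (IH _ yn)).
Qed.

End Coordinates.
End TensorRingTheory.

(** * The canonical map T -> A and reduction of coefficients *)

Section CanonicalMap.
Variables (S : pzRingType) (A : gradedSRingType S).
Local Notation V := (A1 A).
Local Notation T := (TA A).
Implicit Types (x y : T) (v : V).

Lemma tcan_pow_props n :
  [/\ forall t u : tpow V n, tcan_pow (t + u) = tcan_pow t + tcan_pow u,
      forall s (t : tpow V n), tcan_pow (s *: t) = sunit s * tcan_pow t &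
      balanced (fun (v : V) (u : tpow V n) => (val v : A) * tcan_pow u)].
Proof.
elim: n => [|n [cD cZ bal]].
  split; [exact: (@sunitD S A) | exact: (@sunitM S A) |].
  split=> [v v' s|v s s'|v a s] /=; first exact: mulrDl.
    by rewrite sunitD mulrDr.
  by rewrite sunitM mulrA.
have cD' (t u : tpow V n.+1) : tcan_pow (t + u) = tcan_pow t + tcan_pow u.
  exact: (tens_liftD bal).
have cP v (u : tpow V n) : @tcan_pow _ A n.+1 (tpure v u) = (val v : A) * tcan_pow u.
  exact: (tens_liftE bal).
have c0 : @tcan_pow _ A n.+1 0 = 0 by exact: (tens_lift0 bal).
have cZ' s (t : tpow V n.+1) : tcan_pow (s *: t) = sunit s * tcan_pow t.
  elim/tens_ind: t => [|v u t IH]; first by rewrite scaler0 c0 mulr0.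
  by rewrite scalerDr !cD' mulrDr IH scale_tpure !cP mulrA.
split=> //; split=> [v v' s|v s s'|v a s].
- exact: mulrDl.
- by rewrite cD' mulrDr.
- by rewrite cZ' mulrA.
Qed.

Lemma tcan_powB n (t u : tpow V n) : tcan_pow (t - u) = tcan_pow t - tcan_pow u.
Proof.
by have [cD _ _] := tcan_pow_props n; apply: (addIr (tcan_pow u)); rewrite -cD !subrK.
Qed.
Lemma tcan_pow0 n : @tcan_pow _ A n 0 = 0.
Proof. by rewrite -(subrr 0) tcan_powB subrr. Qed.
Lemma tcan_pow_pure n v (u : tpow V n) :
  @tcan_pow _ A n.+1 (tpure v u) = (val v : A) * tcan_pow u.
Proof. by have [_ _ bal] := tcan_pow_props n; apply: (tens_liftE bal). Qed.

Lemma tcanB : {morph @tcan S A : x y / x - y}.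
Proof. exact/dsum_liftB/tcan_powB. Qed.
Lemma tcan0 : tcan (0 : T) = 0. Proof. by rewrite -(subrr 0) tcanB subrr. Qed.

Lemma tcan_sunit s : tcan (sunit s : T) = sunit s.
Proof.
rewrite /tcan (dsum_liftE (N := 1) tcan_pow0) ?big_ord1 /=; last first.
  by case=> // n _; apply: scaler0.
by congr sunit; apply: mulr1.
Qed.

Lemma tcan_tgen v y : tcan (tgen v * y : T) = (val v : A) * tcan y.
Proof.
have [N yN] := dval_fin y; rewrite -lmulvE /tcan.
rewrite (dsum_liftE tcan_pow0 yN) (dsum_liftE (N := N.+1) tcan_pow0); last first.
  by case=> // n /= Nn; rewrite yN ?tpure0r.
rewrite big_ord_recl tcan_pow0 add0r mulr_sumr.
by apply: eq_bigr => i _; exact: tcan_pow_pure.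
Qed.

Lemma tcan_gen v : tcan (tgen v : T) = val v.
Proof.
by rewrite -[tgen v]mulr1 tcan_tgen -(@sunit1 S T) tcan_sunit (@sunit1 S A) mulr1.
Qed.

Lemma tcanM x y : tcan (x * y) = tcan x * tcan y.
Proof.
apply: (@tring_ind _ V [set x | tcan (x * y : T) = tcan x * tcan y]) => [|s|v z IH].
- split=> [|a b] /=; first by rewrite mul0r tcan0 mul0r.
  by move=> ea eb; rewrite mulrBl !tcanB ea eb mulrBl.
- apply: (@tring_ind _ V [set y | tcan (sunit s * y : T) = tcan (sunit s : T) * tcan y])
    => [|a|v z IH].
  + split=> [|a b] /=; first by rewrite mulr0 tcan0 mulr0.
    by move=> ea eb; rewrite mulrBr !tcanB ea eb mulrBr.
  + by rewrite /= -sunitM !tcan_sunit sunitM.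
  + by rewrite /= mulrA -tgenZ !tcan_tgen tcan_sunit mulrA.
- by rewrite /= -mulrA !tcan_tgen IH mulrA.
Qed.

Lemma tcan_homog n x : homog T n x -> homog A n (tcan x).
Proof.
elim: n x => [|n IH] x.
  by move/thomog0P => ->; rewrite tcan_sunit; apply: sunit_homog.
move/thomogSP; apply: (addspan_ind (Y := [set x | homog A n.+1 (tcan x)])).
  exact: (subgroup_preim tcanB (homog_subgroup A n.+1)).
move=> _ [v _ [y yn <-]] /=; rewrite tcan_tgen.
by apply: (homogM (m := 1) _ (IH _ yn)); have /sbpredP := valP v.
Qed.

Lemma tcan_gproj n x : gproj n (tcan x) = tcan (gproj n x).
Proof. exact: (gproj_morph tcanB tcan_homog). Qed.

Lemma tgen_surj x : homog T 1 x -> exists v, x = tgen v.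
Proof.
move/thomogSP; apply: (addspan_ind (Y := [set x | exists v, x = tgen v])).
  split; first by exists 0; rewrite tgen0.
  by move=> _ _ [v ->] [w ->]; exists (v - w); rewrite tgenB.
move=> _ [v _ [y /thomog0P -> <-]].
by exists (rscale v (eps y)); rewrite tgen_rscale.
Qed.

Lemma rel_idealMl x y : rel_ideal A y -> rel_ideal A (x * y).
Proof. by rewrite /rel_ideal /= tcanM => ->; rewrite mulr0. Qed.
Lemma rel_idealMr x y : rel_ideal A x -> rel_ideal A (x * y).
Proof. by rewrite /rel_ideal /= tcanM => ->; rewrite mul0r. Qed.
Lemma rel_ideal_subgroup : subgroup (rel_ideal A).
Proof.
split=> [|x y]; first exact: tcan0.
by rewrite /rel_ideal /= tcanB => -> ->; rewrite subrr.
Qed.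
Lemma rel_ideal_gproj n x : rel_ideal A x -> rel_ideal A (gproj n x).
Proof. by rewrite /rel_ideal /= -tcan_gproj => ->; rewrite gproj0. Qed.

Lemma rel_ideal1 x : rel_ideal A x -> homog T 1 x -> x = 0.
Proof.
move=> + /tgen_surj[v xE]; rewrite xE /rel_ideal /= tcan_gen => v0.
by rewrite (_ : v = 0) ?tgen0 //; apply: val_inj.
Qed.

End CanonicalMap.

Section ConnectedCanonicalMap.
Variables (S : pzRingType) (A : connSRingType S).
Local Notation V := (A1 A).
Local Notation T := (TA A).
Implicit Types (x y : T) (v : V).

Lemma augm_tcan x : augm (tcan x) = eps x.
Proof.
apply: (@sunit_inj S A); rewrite augmE tcan_gproj.
by rewrite [gproj 0 x]eps_gproj0 tcan_sunit.
Qed.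

Lemma augm0 : augm (0 : A) = 0. Proof. by rewrite -(subrr 0) augmB subrr. Qed.

Lemma augm_homog n (a : A) : (0 < n)%N -> homog A n a -> augm a = 0.
Proof.
move=> n_gt0 an; apply: (@sunit_inj S A).
by rewrite augmE (homog_neq an) ?sunit0 // ltn_eqF.
Qed.

Lemma rel_ideal_eps x : rel_ideal A x -> eps x = 0.
Proof. by rewrite -augm_tcan => ->; exact: augm0. Qed.

(** By A^{n+1} = A^1 A^n and A^0 = S, the degree 1 part generates A over S. *)
Lemma tcan_surj (strongA : strongly_graded A) (a : A) : exists x : T, tcan x = a.
Proof.
apply: (@gproj_ind _ [set a | exists x : T, tcan x = a]) => [|n].
  split=> [|_ _ [x <-] [y <-]]; first by exists 0; apply: tcan0.
  by exists (x - y); rewrite tcanB.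
move: (gproj n a) (gproj_homog n a) => {a}.
elim: n => [|n IH] a /= an.
  by have [s <-] := @sunit_surj S A a an; exists (sunit s : T); apply: tcan_sunit.
have := strongA 1%N n; rewrite add1n => e; rewrite -e in an.
move: an; apply: (addspan_ind (Y := [set a | exists x : T, tcan x = a])).
  split=> [|_ _ [x <-] [y <-]]; first by exists 0; apply: tcan0.
  by exists (x - y); rewrite tcanB.
move=> _ [b b1 [c cn <-]]; have [x xE] := IH c cn.
pose v : V := exist _ (b : sbim A) (introT (sbpredP (homog_subbimod A 1) b) b1).
by exists (tgen v * x : T); rewrite tcan_tgen xE.
Qed.

End ConnectedCanonicalMap.

Lemma subrACA (M : zmodType) (a b c d : M) : a - b - (c - d) = a - c - (b - d).
Proof. by rewrite !opprD !opprK addrACA. Qed.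

Lemma mulr_sum3 (B : pzRingType) i j k (F G H : nat -> B) :
  (\sum_(a < i) F a) * (\sum_(b < j) G b) * (\sum_(c < k) H c) =
  \sum_(a < i) \sum_(b < j) \sum_(c < k) F a * G b * H c.
Proof.
rewrite !mulr_suml; apply: eq_bigr => a _; rewrite [X in X * _]mulr_sumr mulr_suml.
by apply: eq_bigr => b _; rewrite mulr_sumr.
Qed.

Section ReductionOfCoefficients.
Variables (S : pzRingType) (A : gradedSRingType S) (X : choiceType).
Local Notation T := (TA A).

Definition tmap (f : freemod T X) : freemod A X := fmap (fun=> @tcan S A) f.

Lemma tmapE f x : tmap f x = tcan (f x).
Proof. by rewrite /tmap fmapE // tcan0. Qed.
Lemma tmapB : {morph tmap : f g / f - g}.
Proof. by move=> f g; apply: freemodP => x; rewrite fcoefB !tmapE fcoefB tcanB. Qed.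
Lemma tmap0 : tmap 0 = 0.
Proof. by rewrite -(subrr 0) tmapB subrr. Qed.
Lemma tmapZ t f : tmap (t *: f) = tcan t *: tmap f.
Proof. by apply: freemodP => x; rewrite fcoefZ !tmapE fcoefZ tcanM. Qed.

Lemma tmap_homog (deg : X -> nat) n f :
  homog (gfree T deg) n f -> homog (gfree A deg) n (tmap f).
Proof.
move=> /gfree_homogP fn; apply/gfree_homogP => x; have := fn x; rewrite tmapE.
by case: ifP => _; [exact: tcan_homog | move=> ->; exact: tcan0].
Qed.

Lemma fsum_tcan (M : lmodType T) (N : lmodType A) (D : M -> N) (phi : X -> M) f :
  {morph D : x y / x - y} -> (forall t m, D (t *: m) = tcan t *: D m) ->
  D (fsum phi f) = fsum (D \o phi) (tmap f).
Proof. by move=> DB DZ; apply: fsum_semilinear => //; apply: tcan0. Qed.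

End ReductionOfCoefficients.

Lemma tmap_lift (S : pzRingType) (A : connSRingType S) (X : choiceType)
    (deg : X -> nat) (strongA : strongly_graded A) n (f : gfree A deg) :
  homog (gfree A deg) n f -> exists2 F : gfree (TA A) deg,
    homog (gfree (TA A) deg) n F & tmap F = f.
Proof.
move=> fn; pose sec (a : A) : TA A := projT1 (cid (tcan_surj strongA a)).
have secE a : tcan (sec a) = a by rewrite /sec; case: cid.
pose F : gfree (TA A) deg := fmap (fun=> sec) f.
have FE : tmap F = f.
  by apply: freemodP => x; rewrite tmapE /=; case: eqP => [->|_]; rewrite ?tcan0.
(* A coefficientwise lift need not be homogeneous; its degree n part is, and it still lifts f
   because [tcan] respects degrees. *)
exists (gproj n F); first exact: gproj_homog.
rewrite -[RHS]fn -FE; apply: freemodP => x; rewrite tmapE !gfree_projE.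
by case: ifP => _; [rewrite tmapE tcan_gproj | exact: tcan0].
Qed.

(** * Relations, syzygies and Jacobi conditions *)

Section Relations.
Variables (S : pzRingType) (A : connSRingType S).
Variable R : subbimod (sbim (TA A)).
Hypothesis relR : bimodule_of_relations R.
Local Notation V := (A1 A).
Local Notation T := (TA A).
Implicit Types (x y : T) (v : V).

Definition rel_set : set T := sbset R.

Lemma rel_gproj n x : rel_set x -> rel_set (gproj n x).
Proof. by case: relR => h _ _ _; apply: h. Qed.

Lemma rel_sub x : rel_set x -> rel_ideal A x.
Proof. by case: relR => _ h _ _; apply: h. Qed.

(** T and A agree in degrees 0 and 1, so relations start in degree 2. The degree drops by one used
    later rest on this. *)
Lemma rel_low n x : (n <= 1)%N -> rel_set x -> homog T n x -> x = 0.
Proof.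
case: n => [|[|//]] _ /rel_sub xI xn; last exact: rel_ideal1 xI xn.
by rewrite (thomog0P xn) rel_ideal_eps ?sunit0.
Qed.

Definition rel_span n : set T := addspan [set z | exists i j k a r b,
  [/\ (i + j + k = n)%N, homog T i a, rel_set r /\ homog T j r, homog T k b &
      z = a * r * b]].

Lemma rel_span_subgroup n : subgroup (rel_span n).
Proof. exact: addspan_subgroup. Qed.

Lemma rel_spanMl m n x y : homog T m x -> rel_span n y -> rel_span (m + n) (x * y).
Proof.
move=> xm; apply: (addspan_ind (Y := [set y | rel_span (m + n) (x * y)])).
  split=> [|a b] /=; first by rewrite mulr0; apply: addspan0.
  by rewrite mulrBr; apply: addspanB.
move=> _ [i [j [k [a [r [b [e ai rj bk ->]]]]]]]; apply: addspan_gen.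
exists (m + i)%N, j, k, (x * a), r, b; split=> //.
- by rewrite -!addnA -e -!addnA.
- exact: homogM.
- by rewrite !mulrA.
Qed.

Lemma rel_spanMr m n x y : homog T m x -> rel_span n y -> rel_span (n + m) (y * x).
Proof.
move=> xm; apply: (addspan_ind (Y := [set y | rel_span (n + m) (y * x)])).
  split=> [|a b] /=; first by rewrite mul0r; apply: addspan0.
  by rewrite mulrBl; apply: addspanB.
move=> _ [i [j [k [a [r [b [e ai rj bk ->]]]]]]]; apply: addspan_gen.
exists i, j, (k + m)%N, a, r, (b * x); split=> //.
- by rewrite -e !addnA.
- exact: homogM.
- by rewrite !mulrA.
Qed.

(** In I_A = R + (T^1 I_A + I_A T^1), the degree n + 1 part of the last two summands involves I_A in
    degree n only; hence R generates I_A by induction on the degree. *)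
Lemma rel_span_gproj n x : rel_ideal A x -> rel_span n (gproj n x).
Proof.
elim: n x => [|n IH] x.
  by move=> xI; rewrite [gproj 0 x]eps_gproj0 rel_ideal_eps // sunit0; apply: addspan0.
have [_ _ defI _] := relR; rewrite {1}defI => -[r rR [_ [u uI [w wI <-]] <-]].
rewrite !gprojD; have sS := rel_span_subgroup n.+1.
apply: (subgroupD sS); last apply: (subgroupD sS).
- apply: addspan_gen; exists 0%N, n.+1, 0%N, 1, (gproj n.+1 (r : T)), 1.
  have h1 : homog T 0 1 by rewrite -(@sunit1 S T); apply: sunit_homog.
  split=> //; last by rewrite mul1r mulr1.
  + by rewrite addn0.
  + by split; [exact: rel_gproj | exact: gproj_homog].
- move: u uI; apply: (addspan_ind (Y := gproj n.+1 @^-1` rel_span n.+1)).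
    exact: (subgroup_preim (gprojB _) (addspan_subgroup _)).
  move=> _ [t t1 [j jI <-]] /=; rewrite (gprojMl _ _ t1) /= subn1.
  exact: (rel_spanMl t1 (IH _ jI)).
- move: w wI; apply: (addspan_ind (Y := gproj n.+1 @^-1` rel_span n.+1)).
    exact: (subgroup_preim (gprojB _) (addspan_subgroup _)).
  move=> _ [j jI [t t1 <-]] /=; rewrite (gprojMr _ _ t1) subn1 /= -addn1.
  exact: (rel_spanMr t1 (IH _ jI)).
Qed.

Definition rel_proj n (r : sbtype R) : sbtype R :=
  exist _ (gproj n (val r : T) : sbim T)
    (introT (sbpredP R _) (rel_gproj n (elimT (sbpredP R _) (valP r)))).

Lemma rel_projE n r : val (rel_proj n r) = gproj n (val r : T). Proof. by []. Qed.
Lemma rel_projB n : {morph rel_proj n : r s / r - s}.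
Proof. by move=> r s; apply: val_inj; rewrite rel_projE [LHS]gprojB. Qed.
Lemma rel_projZ n a r : rel_proj n (a *: r) = a *: rel_proj n r.
Proof. by apply: val_inj; rewrite rel_projE [LHS]gprojZl. Qed.

Lemma rel_val_mem (r : sbtype R) : rel_set (val r).
Proof. exact: (elimT (sbpredP R _) (valP r)). Qed.

Definition rel_mk x (xR : rel_set x) : sbtype R :=
  exist _ (x : sbim T) (introT (sbpredP R _) xR).

(* Generators of the degree 2 term of the resolution: inl (n, r) stands for   *)
(* the degree n part of r, and inr v is mapped to v - kV v, which compensates *)
(* for taking the free module A^(V) instead of A (x) V in degree 1.           *)
Definition gen2 : choiceType := (nat * sbtype R + V)%type.
Definition deg2 (x : gen2) : nat := match x with inl p => p.1 | inr _ => 1%N end.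
Definition rho (x : gen2) : sbtype R :=
  match x with inl p => rel_proj p.1 p.2 | inr _ => 0 end.

Lemma rho_surj (r : sbtype R) : exists f : freemod S gen2, fsum rho f = r.
Proof.
have [N rN] := gproj_fin (val r : T).
exists (\sum_(n < N) fbasis (inl (n : nat, r) : gen2)).
rewrite (big_morph (fsum rho) (fsumD rho) (fsum0 rho)).
apply: val_inj; rewrite [RHS]rN.
rewrite (big_morph (val : sbtype R -> sbim T) (id1 := 0) (op1 := +%R)) //.
by apply: eq_bigr => n _; rewrite fsum_basis.
Qed.

(** * The beginning of a free resolution of S *)

Section DualBases.
Variable kV : {linear V -> freemod S V}.
Hypothesis kVE : forall v, fsum id (kV v) = v.
Variable kR : {linear sbtype R -> freemod S gen2}.
Hypothesis kRE : forall r, fsum rho (kR r) = r.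

(* Only the coordinates of degree d are kept, so that kRd d r is homogeneous.   *)
Definition in_deg d (x : gen2) : bool :=
  match x with inl p => p.1 == d | inr _ => false end.
Definition kRd d (r : sbtype R) : freemod S gen2 := frestr (in_deg d) (kR r).
Arguments kRd : simpl never.

Lemma kRd_coef d r (x : gen2) : kRd d r x = if in_deg d x then kR r x else 0.
Proof. by []. Qed.

Lemma kRdE d (r : sbtype R) : homog T d (val r) -> fsum rho (kRd d r) = r.
Proof.
move=> rd; have rE : rel_proj d r = r by apply: val_inj; rewrite rel_projE.
rewrite -[RHS]rE -[r in RHS]kRE (fsum_morph (D := rel_proj d)); last 2 first.
- exact: rel_projB.
- exact: rel_projZ.
rewrite fsum_frestr; apply: eq_fsum => -[[n s]|v] /=.
  congr (_ *: _); apply: val_inj; rewrite [RHS]/= gproj_orth eq_sym.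
  by case: eqP.
by congr (_ *: _); apply: val_inj; rewrite [RHS]gproj0.
Qed.

Local Notation deg1 := (fun _ : V => 1%N).
Local Notation deg0 := (fun _ : unit => 0%N).

Definition kA v : freemod A V := fmap (fun=> sunit) (kV v).
Lemma kAE v w : kA v w = sunit (kV v w).
Proof. by rewrite fmapE // sunit0. Qed.
Lemma kA_tmap v : kA v = tmap (kT kV v : freemod T V).
Proof. by apply: freemodP => w; rewrite kAE tmapE [kT _ _ _]kTE tcan_sunit. Qed.

(** On T_+ = T (x) V this is the reduction to A (x) V, embedded in A^(V) by the dual basis. Its
    kernel on T_+ is I_A T^1 (see [dbar_rel] and [dbar_ideal]). *)
Definition dbar x : freemod A V := tmap (delta kV x : freemod T V).

Lemma dbarB : {morph dbar : x y / x - y}.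
Proof. by move=> x y; rewrite /dbar [delta _ _]deltaB [LHS]tmapB. Qed.
Lemma dbar0 : dbar 0 = 0. Proof. by rewrite -(subrr 0) dbarB subrr. Qed.
Lemma dbar_mul x y : eps y = 0 -> dbar (x * y) = tcan x *: dbar y.
Proof. by move=> y0; rewrite /dbar [delta _ _]delta_mul // [LHS]tmapZ. Qed.
Lemma dbar_mulZ s y : dbar (sunit s * y) = sunit s *: dbar y.
Proof. by rewrite /dbar [delta _ _]delta_mulZ [LHS]tmapZ tcan_sunit. Qed.
Lemma dbar_gen v : dbar (tgen v) = kA v.
Proof. by rewrite /dbar [delta _ _]delta_gen kA_tmap. Qed.

Lemma dbar_homog n x : homog T n x -> homog (gfree A deg1) n (dbar x).
Proof.
case: n => [|n] xn.
  rewrite (thomog0P xn) /dbar [delta _ _]delta_sunit [X in homog _ _ X]tmap0.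
  by case: (homog_subgroup (gfree A deg1) 0).
apply: tmap_homog; apply/gfree_homogP => v /=; rewrite subn1.
exact: (delta_homog _ _ xn).
Qed.

Lemma dbar_rel x y : rel_ideal A x -> eps y = 0 -> dbar (x * y) = 0.
Proof. by move=> xI y0; rewrite dbar_mul // [tcan x]xI scale0r. Qed.

Definition phi1 v : gfree A deg0 := (val v : A) *: fbasis tt.
Definition phi2 (x : gen2) : gfree A deg1 :=
  match x with
  | inl p => dbar (val (rel_proj p.1 p.2))
  | inr v => fbasis v - kA v
  end.

Lemma phi1_homog v : homog (gfree A deg0) 1 (phi1 v).
Proof.
have v1 : homog A 1 (val v) by have /sbpredP := valP v.
exact: (homogZ 1 0 _ _ v1 (gfree_basis_homog A deg0 tt)).
Qed.

Lemma phi2_homog (x : gen2) : homog (gfree A deg1) (deg2 x) (phi2 x).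
Proof.
case: x => [[n r]|v] /=; first exact/dbar_homog/gproj_homog.
apply: (subgroupB (homog_subgroup (gfree A deg1) 1)).
  exact: (gfree_basis_homog A deg1 v).
rewrite -dbar_gen; exact/dbar_homog/tgen_homog.
Qed.

Lemma fsum_phi1 (F : freemod T V) :
  fsum phi1 (tmap F) = tcan (fsum (@tgen S V : V -> T^o) F) *: fbasis tt.
Proof.
rewrite (@fsum_tcan _ _ _ T^o (gfree A deg0)
  (fun x : T => tcan x *: fbasis tt)) //.
- by apply: eq_fsum => v; rewrite /= tcan_gen.
- by move=> x y; rewrite tcanB scalerBl.
- by move=> x y; rewrite [tcan _]tcanM scalerA.
Qed.

Lemma fsum_phi1_dbar x : fsum phi1 (dbar x) = tcan (x - sunit (eps x)) *: fbasis tt.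
Proof. by rewrite fsum_phi1 fsum_delta. Qed.

Lemma phi1_phi2 (x : gen2) : fsum phi1 (phi2 x) = 0.
Proof.
case: x => [[n r]|v] /=.
  have xI : rel_ideal A (gproj n (val r : T)).
    exact/rel_ideal_gproj/rel_sub/rel_val_mem.
  by rewrite fsum_phi1_dbar [eps _]rel_ideal_eps // sunit0 subr0 [tcan _]xI scale0r.
have v0 : eps (tgen v) = 0 by rewrite -[tgen v]mulr1 eps_tgen.
by rewrite fsumB fsum_basis -dbar_gen fsum_phi1_dbar v0 sunit0 subr0 tcan_gen subrr.
Qed.

Lemma freemod_unit (f : freemod A unit) : f = f tt *: fbasis tt.
Proof. by apply: freemodP => -[]; rewrite fcoefZ /= mulr1. Qed.

Lemma exact_deg0 (strongA : strongly_graded A) (f : gfree A deg0) :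
  augm (f tt) = 0 <-> exists g : gfree A deg1, fsum phi1 g = f.
Proof.
split=> [f0|[g <-]]; last first.
  apply: (@fsum_ind _ _ _ _ [set f : gfree A deg0 | augm (f tt) = 0]) => [|v] /=.
    split=> [|a b] /=; first exact: augm0.
    by move=> ea eb; change (augm (a tt - b tt) = 0); rewrite augmB ea eb subrr.
  have v1 : homog A 1 (val v) by have /sbpredP := valP v.
  by rewrite !augmM (augm_homog _ v1) // mul0r mulr0.
have [x xE] := tcan_surj strongA (f tt).
have x0 : eps x = 0 by rewrite -augm_tcan xE.
exists (dbar x); rewrite fsum_phi1_dbar x0 sunit0 subr0 xE.
exact/esym/freemod_unit.
Qed.

Lemma fsum_phi2_rel d (r : sbtype R) : homog T d (val r) ->
  fsum phi2 (fmap (fun=> sunit) (kRd d r)) = dbar (val r).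
Proof.
move=> rd; rewrite -[r in RHS](kRdE rd).
rewrite [RHS](@fsum_semilinear _ _ _ (@sunit S A) _ (freemod A V)
  (fun r : sbtype R => dbar (val r))); first last.
- by move=> s q; apply: dbar_mulZ.
- by move=> q q'; apply: dbarB.
- exact: sunit0.
apply: eq_fsum => -[p|v] //=.
by rewrite eqxx !scale0r.
Qed.

Lemma phi2_range_subgroup :
  subgroup [set f : gfree A deg1 | exists g : gfree A deg2, fsum phi2 g = f].
Proof.
split=> [|_ _ [g <-] [h <-]] /=; first by exists 0; rewrite fsum0.
by exists (g - h); rewrite fsumB.
Qed.

(** I_A is spanned by products a r b. If b has positive degree, [dbar] kills the product; if b is a
    scalar, r b is again in R and its coordinates, multiplied by a, give a preimage. *)
Lemma phi2_range_dbar x : rel_ideal A x ->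
  exists g : gfree A deg2, fsum phi2 g = dbar x.
Proof.
move=> xI; apply: (@gproj_ind _ [set x : T | exists g : gfree A deg2, fsum phi2 g = dbar x]).
  exact: (subgroup_preim dbarB phi2_range_subgroup).
move=> n; move: (rel_span_gproj (n := n) xI).
apply: (addspan_ind (Y := [set x : T | exists g : gfree A deg2, fsum phi2 g = dbar x])).
  exact: (subgroup_preim dbarB phi2_range_subgroup).
move=> _ [i [j [k [a [r [b [e ai [rR rj] bk ->]]]]]]] /=.
case: k bk {e} => [|k] bk; last first.
  exists 0; rewrite fsum0 dbar_rel ?(eps_homog _ bk) //.
  exact/rel_idealMl/rel_sub.
have rbR : rel_set (r * b).
  rewrite (thomog0P bk); exact: (sb_rscale (eps b) (rR : sbset R (r : sbim T))).
have rbj : homog T j (r * b) by rewrite -(addn0 j); apply: homogM.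
exists (tcan a *: fmap (fun=> sunit) (kRd j (rel_mk rbR))).
rewrite fsumZ (@fsum_phi2_rel j (rel_mk rbR) rbj) -mulrA [RHS]dbar_mul //.
exact/rel_ideal_eps/rel_sub.
Qed.

Lemma fsum_kA f : dbar (fsum (@tgen S V : V -> T^o) f) = fsum kA (tmap f).
Proof.
rewrite /dbar [delta _ _]delta_fsum (@fsum_tcan _ _ _ _ (freemod A V) (@tmap S A V)).
- by apply: eq_fsum => v; rewrite /= kA_tmap.
- exact: tmapB.
- exact: tmapZ.
Qed.

(** The projection [fsum kA] splits f. The part f - [fsum kA f] is a combination of the v - kA v,
    images of the auxiliary generators; the part in A (x) V is [dbar] of an element of T which phi1
    f = 0 forces into I_A. *)
Lemma exact_deg1 (strongA : strongly_graded A) (f : gfree A deg1) :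
  fsum phi1 f = 0 <-> exists g : gfree A deg2, fsum phi2 g = f.
Proof.
split=> [f0|[g <-]]; last first.
  rewrite [fsum phi1 _](fsum_morph (D := fsum phi1)); last 2 first.
  - exact: fsumB.
  - exact: fsumZ.
  by rewrite [LHS]big1 // => x _; rewrite [X in _ *: X]phi1_phi2 scaler0.
have sIm := phi2_range_subgroup.
rewrite -(subrK (fsum kA f) f); apply: (subgroupD sIm); last first.
  pose F : freemod T V :=
    fmap (fun=> fun a => projT1 (cid (tcan_surj strongA a))) f.
  have FE : tmap F = f.
    apply: freemodP => v; rewrite tmapE /=; case: eqP => [->|_]; first exact: tcan0.
    by case: cid.
  rewrite -FE -fsum_kA; apply: phi2_range_dbar.
  have := fsum_phi1 F; rewrite FE f0 => /(congr1 (fun g : freemod A unit => g tt)).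
  by rewrite /= mulr1.
rewrite -[f in f - _]fsum_fbasis -sumrB.
apply: (subgroup_sum _ sIm) => v _; rewrite -scalerBr.
by exists (f v *: fbasis (inr v : gen2)); rewrite fsumZ fsum_basis.
Qed.

Definition rhoT (x : gen2) : T^o := val (rho x).

Lemma rhoT_mem (x : gen2) : rel_set (rhoT x). Proof. exact: rel_val_mem. Qed.

Lemma fsum_rhoT_rel (F : freemod T gen2) : rel_ideal A (fsum rhoT F).
Proof.
apply: (@fsum_ind _ _ T^o rhoT (rel_ideal A) F) => [|x]; first exact: rel_ideal_subgroup.
exact/rel_idealMl/rel_sub/rhoT_mem.
Qed.

Lemma dbar_fsum_rhoT (F : freemod T gen2) :
  dbar (fsum rhoT F) = fsum (fun x : gen2 => dbar (rhoT x)) (tmap F).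
Proof.
rewrite -[F in LHS]fsum_fbasis.
rewrite (@fsum_tcan _ _ _ _ (freemod A V) (fun F : freemod T gen2 => dbar (fsum rhoT F))).
- by apply: eq_fsum => x /=; rewrite fsum_basis.
- by move=> f g; rewrite fsumB dbarB.
- by move=> t f; rewrite fsumZ dbar_mul //; exact/rel_ideal_eps/fsum_rhoT_rel.
Qed.

Lemma fsum_kA_dbar x : fsum kA (dbar x) = dbar x.
Proof.
transitivity (dbar (x - sunit (eps x))); first by rewrite -fsum_kA fsum_delta.
rewrite dbarB; by rewrite {2}/dbar [delta _ (sunit _)]delta_sunit tmap0 subr0.
Qed.

(** The projection onto A (x) V kills the images of the auxiliary generators and fixes those of the
    relations. *)
Lemma fsum_kA_phi2 (m : gfree A deg2) :
  fsum kA (fsum phi2 m) = fsum (fun x : gen2 => dbar (rhoT x)) m.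
Proof.
rewrite linear_fsum; apply: eq_fsum => -[p|v] /=; first by rewrite [fsum _ _]fsum_kA_dbar.
rewrite [fsum _ _]fsumB fsum_basis -dbar_gen fsum_kA_dbar subrr.
by congr (_ *: _); apply/esym/dbar0.
Qed.

Lemma phi2_ker_lift (F : freemod T gen2) :
  fsum phi2 (tmap F) = 0 -> dbar (fsum rhoT F) = 0.
Proof. by move=> F0; rewrite dbar_fsum_rhoT -fsum_kA_phi2 F0 fsum0. Qed.

Lemma phi2_ker_of_dbar (F : freemod T gen2) : (forall v, F (inr v) = 0) ->
  dbar (fsum rhoT F) = 0 -> fsum phi2 (tmap F) = 0.
Proof.
move=> F0; rewrite dbar_fsum_rhoT => <-; apply: eq_fsum => -[p|v] //.
by rewrite tmapE F0 tcan0 !scale0r.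
Qed.

Lemma gproj_scale1 (M : gradedLmodType A) n (b : A) (y : M) : homog A 1 b ->
  gproj n.+1 (b *: y) = b *: gproj n y.
Proof.
move=> b1; apply: (@gproj_ind _ [set y | gproj n.+1 (b *: y) = b *: gproj n y]) => [|k] /=.
  split=> [|z w] /=; first by rewrite scaler0 !gproj0 scaler0.
  by move=> ez ew; rewrite scalerBr !gprojB ez ew scalerBr.
have h : homog M k.+1 (b *: gproj k y) := homogZ 1 k _ _ b1 (gproj_homog k y).
rewrite gproj_orth; case: eqP => [->|nk]; first exact: h.
by rewrite scaler0 (homog_neq h) // eqSS; apply/eqP.
Qed.

(** Coefficients in A_+ make m vanish in S (x) P_2, so the vanishing of Tor_3 puts it in A_+ times
    the syzygies. As A_+ = A^1 A, factors from A^1 suffice, the rest being absorbed by the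
    syzygy. *)
Lemma syzygy (strongA : strongly_graded A) n (m : gfree A deg2) :
  TorS_zero A 2 \/ TorS_zero_deg A 2 n.+1 ->
  homog (gfree A deg2) n.+1 m -> fsum phi2 m = 0 -> (forall x : gen2, augm (m x) = 0) ->
  addspan [set (val v : A) *: m' | v in [set: V] &
    m' in [set m' : gfree A deg2 | homog (gfree A deg2) n m' /\ fsum phi2 m' = 0]] m.
Proof.
move=> Tor mn m0 maug; set span := addspan _.
have ex0 f : res_aug A f = 0 <-> exists g, stage_diff (Stage phi1_homog) g = f.
  by rewrite res_augE; apply: exact_deg0.
pose P := resolution ex0 (exact_deg1 strongA : forall f,
  stage_diff (Stage phi1_homog) f = 0 <-> exists g, stage_diff (Stage phi2_homog) g = f).
have maug' : augspan setT (m : P 2).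
  have sA : subgroup (augspan [set: gfree A deg2]) by exact: addspan_subgroup.
  rewrite -[m]fsum_fbasis; apply: (subgroup_sum _ sA) => x _.
  by apply: addspan_gen; exists (m x); [exact: maug | exists (fbasis x)].
suff: (gproj n.+1 @^-1` span) m by rewrite /= [gproj _ m]mn.
have sspan : subgroup span by exact: addspan_subgroup.
move: (@Tor_zero_syzygy S A P n.+1 m Tor mn m0 maug').
apply: addspan_ind; first exact: (subgroup_preim (gprojB _) sspan).
move=> _ [a /= a0 [y y0 <-]].
have {}y0 : fsum phi2 (y : gfree A deg2) = 0 by exact: y0.
(* The component of degree k + 1 is a sum of products b d with b in A^1; then d y is a syzygy, and
   its component of degree n is one too. *)
have h0 k (c : A) : span (gproj n.+1 (gproj k.+1 c *: (y : gfree A deg2))).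
  move: (gproj_homog k.+1 c); rewrite -[k.+1]add1n -(strongA 1%N k).
  move: (gproj _ c) => {c} c.
  apply: (addspan_ind (Y := [set c | span (gproj n.+1 (c *: (y : gfree A deg2)))])).
    split=> [|u v] /=; first by rewrite scale0r gproj0; apply: addspan0.
    by rewrite scalerBl gprojB; apply: addspanB.
  move=> _ [b b1 [d _ <-]] /=; rewrite -scalerA gproj_scale1 //.
  apply: addspan_gen.
  exists (exist _ (b : sbim A) (introT (sbpredP (homog_subbimod A 1) b) b1)) => //.
  exists (gproj n (d *: (y : gfree A deg2))) => //; split; first exact: gproj_homog.
  have := @stage_diff_proj S A (Stage phi2_homog) n (d *: (y : gfree A deg2)).
  by rewrite [stage_diff _ _]fsumZ [fsum _ y]y0 scaler0 gproj0 => <-.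
have [N ->] := gproj_fin a; rewrite scaler_suml /= gproj_sum.
apply: (subgroup_sum _ sspan) => -[[|i] _] _ /=; last exact: h0.
by rewrite -augmE a0 sunit0 scale0r gproj0; apply: addspan0.
Qed.

(** * Products of relations lifted along alpha, and the Jacobi conditions *)

Section Lifting.
Variable alpha : {linear sbtype R -> sbim T}.
Hypothesis alphaF : filtered_morphism alpha.

Local Notation Q := (range alpha : set T).
Local Notation fg := (filt_gen Q).

Definition alT (x : gen2) : T^o := alpha (rho x).

(** The predecessor truncates at j = 0, which is harmless because R has no nonzero element of degree
    0. *)
Lemma alpha_low j (r : sbtype R) : homog T j (val r) ->
  upto T j.-1 ((alpha r : T) - val r).
Proof.
move=> rj; have [_ /(_ j r rj)[au ag]] := alphaF.
move=> m; case: j rj au ag => [|j] rj au ag /= jm.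
  have r0 : r = 0 by apply: val_inj; apply: rel_low rj => //; apply: rel_val_mem.
  by rewrite r0 raddf0 [X in gproj _ X]subrr gproj0.
have [->|mj] := eqVneq m j.+1; first by rewrite gprojB ag [gproj _ (val r)]rj subrr.
rewrite gprojB au ?(homog_neq rj) ?subr0 //.
by rewrite ltn_neqAle eq_sym mj.
Qed.

Lemma fg_subgroup n : subgroup (fg n). Proof. exact: addspan_subgroup. Qed.

Lemma fg_gen i j k n (x q y : T) : (i + j + k <= n)%N ->
  upto T i x -> Q q -> upto T j q -> upto T k y -> fg n (x * q * y).
Proof.
move=> le xi Qq qj yk; apply: addspan_gen; exists i, j, (k + (n - (i + j + k)))%N.
split; first by rewrite addnA subnKC.
exists x, q, y; split=> //; exact: uptoS (leq_addr _ _) yk.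
Qed.

Lemma fg_Ml m n (x z : T) : upto T m x -> fg n z -> fg (m + n) (x * z).
Proof.
move=> xm; apply: (addspan_ind (Y := [set z | fg (m + n) (x * z)])).
  split=> [|a b] /=; first by rewrite mulr0; apply: addspan0.
  by rewrite mulrBr; apply: addspanB.
move=> _ [i [j [k [<- [a [q [b [ai [Qq qj] bk ->]]]]]]]] /=.
rewrite !mulrA; apply: (@fg_gen (m + i) j k) => //; first by rewrite !addnA.
exact: uptoM.
Qed.

Lemma fg_Mr m n (x z : T) : upto T m x -> fg n z -> fg (n + m) (z * x).
Proof.
move=> xm; apply: (addspan_ind (Y := [set z | fg (n + m) (z * x)])).
  split=> [|a b] /=; first by rewrite mul0r; apply: addspan0.
  by rewrite mulrBl; apply: addspanB.
move=> _ [i [j [k [<- [a [q [b [ai [Qq qj] bk ->]]]]]]]] /=.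
rewrite -!mulrA mulrA; apply: (@fg_gen i j (k + m)) => //; first by rewrite !addnA.
exact: uptoM.
Qed.

(* Gr K n is the image of the degree n part of T (x) R (x) T in T x T under   *)
(* (multiplication, 1 (x) alpha (x) 1), the degrees of the right factors      *)
(* being restricted to K.                                                     *)
Definition Gr (K : pred nat) n : set (T * T)%type := addspan [set p |
  exists i j k a (r : sbtype R) b, [/\ (i + j + k = n)%N /\ K k, homog T i a,
    homog T j (val r), homog T k b & p = (a * (val r : T) * b, a * (alpha r : T) * b)]].

Local Notation Gr_all := (Gr predT).
Local Notation Gr_pos := (Gr (ltn 0)).

Lemma Gr_subgroup K n : subgroup (Gr K n). Proof. exact: addspan_subgroup. Qed.

Lemma Gr_sub (K K' : pred nat) n : (forall k, K k -> K' k) -> Gr K n `<=` Gr K' n.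
Proof.
move=> KK'; apply: addspan_ind; first exact: Gr_subgroup.
move=> _ [i [j [k [a [r [b [[e Kk] ai rj bk ->]]]]]]]; apply: addspan_gen.
by exists i, j, k, a, r, b; split=> //; split=> //; apply: KK'.
Qed.

Lemma Gr_homog K n p : Gr K n p -> homog T n p.1.
Proof.
apply: (addspan_ind (Y := [set p | homog T n p.1])).
  by split=> [|x y]; [case: (homog_subgroup T n)|exact: (subgroupB (homog_subgroup T n))].
move=> _ [i [j [k [a [r [b [[<- _] ai rj bk ->]]]]]]] /=.
exact: homogM (homogM ai rj) bk.
Qed.

Lemma Gr_fg K n p : Gr K n p -> fg n p.2.
Proof.
apply: (addspan_ind (Y := [set p | fg n p.2])).
  by split=> [|x y]; [exact: addspan0|exact: addspanB].
move=> _ [i [j [k [a [r [b [[e _] ai rj bk ->]]]]]]] /=.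
have [_ /(_ j r rj)[au _]] := alphaF.
apply: (@fg_gen i j k); [by rewrite e|exact: homog_upto|by exists r|exact: au|].
exact: homog_upto.
Qed.

Lemma homogM_top i j (x y : T) : upto T i x -> upto T j y ->
  gproj (i + j) (x * y) = gproj i x * gproj j y.
Proof.
move=> xi yj; rewrite gprojM.
have ij : (i < (i + j).+1)%N by rewrite ltnS leq_addr.
rewrite (bigD1 (Ordinal ij)) //= addKn big1 ?addr0 // => k ki.
have [ik|] := ltnP i k; first by rewrite xi ?mul0r.
rewrite leq_eqVlt => /orP[/eqP e|kj]; first by case/eqP: ki; apply: val_inj.
by rewrite yj ?mulr0 // ltn_subRL ltn_add2r.
Qed.

Lemma Gr_upto K n p : Gr K n p -> upto T n p.2 /\ gproj n p.2 = p.1.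
Proof.
apply: (addspan_ind (Y := [set p | upto T n p.2 /\ gproj n p.2 = p.1])).
  split=> [|x y [xn xg] [yn yg]].
    by split; [case: (upto_subgroup T n) | rewrite /= gproj0].
  split; first exact: (subgroupB (upto_subgroup T n)).
  by rewrite /= gprojB xg yg.
move=> _ [i [j [k [a [r [b [[<- _] ai rj bk ->]]]]]]] /=.
have [_ /(_ j r rj)[au ag]] := alphaF.
have ai' := homog_upto ai; have bk' := homog_upto bk.
split; first exact: uptoM (uptoM _ _) _.
by rewrite homogM_top ?homogM_top ?ag ?[gproj _ a]ai ?[gproj _ b]bk //; apply: uptoM.
Qed.

Lemma Gr_Ml K m n x p : homog T m x -> Gr K n p -> Gr K (m + n) (x * p.1, x * p.2).
Proof.
move=> xm; apply: (addspan_ind (Y := [set p | Gr K (m + n) (x * p.1, x * p.2)])).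
  split=> [|p1 p2] /=; first by rewrite !mulr0; apply: addspan0.
  by move=> h1 h2; rewrite !mulrBr; apply: (subgroupB (Gr_subgroup K (m + n)) h1 h2).
move=> _ [i [j [k [a [r [b [[<- Kk] ai rj bk ->]]]]]]] /=; apply: addspan_gen.
exists (m + i)%N, j, k, (x * a), r, b; rewrite !mulrA !addnA; split=> //.
exact: homogM.
Qed.

Lemma Gr_tgen n v p : Gr_all n p -> Gr_pos n.+1 (p.1 * tgen v, p.2 * tgen v).
Proof.
apply: (addspan_ind (Y := [set p | Gr_pos n.+1 (p.1 * tgen v, p.2 * tgen v)])).
  split=> [|p1 p2] /=; first by rewrite !mul0r; apply: addspan0.
  by move=> h1 h2; rewrite !mulrBl; apply: (subgroupB (Gr_subgroup _ n.+1) h1 h2).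
move=> _ [i [j [k [a [r [b [[<- _] ai rj bk ->]]]]]]] /=; apply: addspan_gen.
exists i, j, k.+1, a, r, (b * tgen v); rewrite addnS -!mulrA; split=> //.
rewrite -addn1; exact: homogM bk (tgen_homog v).
Qed.

(** Terms with a scalar on the right are elements of T (x) R, on which the resolution gives
    information; the others die under [dbar] and allow a factor from V to be removed on the
    right. *)
Lemma Gr_split n p : Gr_all n p ->
  exists p0 p1, [/\ Gr (pred1 0%N) n p0, Gr_pos n p1 & p = p0 + p1].
Proof.
apply: (addspan_ind (Y := [set p | exists p0 p1,
  [/\ Gr (pred1 0%N) n p0, Gr_pos n p1 & p = p0 + p1]])).
  split=> [|_ _ [p0 [p1 [h0 h1 ->]]] [q0 [q1 [g0 g1 ->]]]].
    by exists 0, 0; split; rewrite ?addr0 //; apply: addspan0.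
  exists (p0 - q0), (p1 - q1); split; last by rewrite opprD addrACA.
    exact: (subgroupB (Gr_subgroup _ n)).
  exact: (subgroupB (Gr_subgroup _ n)).
move=> {}p [i [j [k [a [r [b [[e _] ai rj bk pE]]]]]]].
have [k0|k_gt0] := posnP k.
  exists p, 0; split; rewrite ?addr0 //; last exact: addspan0.
  by apply: addspan_gen; exists i, j, k, a, r, b; rewrite /= k0 in e bk *.
exists 0, p; split; rewrite ?add0r //; first exact: addspan0.
by apply: addspan_gen; exists i, j, k, a, r, b.
Qed.

Lemma Gr_rel_span n x : rel_span n x -> exists y, Gr_all n (x, y).
Proof.
apply: (addspan_ind (Y := [set x | exists y, Gr_all n (x, y)])).
  split=> [|x1 x2 [y1 h1] [y2 h2]]; first by exists 0; apply: addspan0.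
  by exists (y1 - y2); apply: (subgroupB (Gr_subgroup _ n) h1 h2).
move=> _ [i [j [k [a [r [b [e ai [rR rj] bk ->]]]]]]].
exists (a * (alpha (rel_mk rR) : T) * b); apply: addspan_gen.
by exists i, j, k, a, (rel_mk rR), b.
Qed.

(** Writing x as the sum of the c_v v with c = delta x, the assumption [dbar x = 0] puts each c_v in
    I_A, where it is spanned by products a r b. *)
Lemma Gr_pos_exists n x : homog T n x -> eps x = 0 -> dbar x = 0 ->
  exists y, Gr_pos n (x, y).
Proof.
have sZ : subgroup [set x | exists y, Gr_pos n (x, y)].
  split=> [|x1 x2 [y1 h1] [y2 h2]]; first by exists 0; apply: addspan0.
  by exists (y1 - y2); apply: (subgroupB (Gr_subgroup _ n) h1 h2).
case: n sZ => [|n] sZ xn x0 dx; first by rewrite (thomog0P xn) x0 sunit0; case: sZ.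
have -> : x = fsum (@tgen S V : V -> T^o) (delta kV x : freemod T V).
  by have := fsum_delta kVE x; rewrite x0 sunit0 subr0.
apply: (subgroup_sum _ sZ) => v _.
have dI : rel_ideal A (delta kV x v).
  by rewrite /rel_ideal /= -(tmapE (delta kV x : freemod T V)) [tmap _]dx.
have dn := delta_homog kV v xn.
have [y Gy] := Gr_rel_span (rel_span_gproj (n := n) dI).
exists (y * tgen v); rewrite [gproj n _]dn in Gy.
exact: (Gr_tgen v Gy).
Qed.

Lemma Gr_pos_dbar n p : Gr_pos n p -> dbar p.1 = 0.
Proof.
apply: (addspan_ind (Y := [set p | dbar p.1 = 0])).
  split=> [|p1 p2] /=; first exact: dbar0.
  by rewrite dbarB => -> ->; rewrite subrr.
move=> _ [i [j [k [a [r [b [[_ k_gt0] ai rj bk ->]]]]]]] /=.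
rewrite dbar_rel ?(eps_homog k_gt0 bk) //.
exact/rel_idealMl/rel_sub/rel_val_mem.
Qed.

Lemma dbar_ideal x : eps x = 0 -> dbar x = 0 ->
  setmulspan (rel_ideal A : set T) (homog T 1) x.
Proof.
move=> x0 dx; have -> : x = fsum (@tgen S V : V -> T^o) (delta kV x : freemod T V).
  by have := fsum_delta kVE x; rewrite x0 sunit0 subr0.
apply: (subgroup_sum _ (addspan_subgroup _)) => v _; apply: addspan_gen.
exists (delta kV x v); last by exists (tgen v) => //; apply: tgen_homog.
by rewrite /rel_ideal /= -(tmapE (delta kV x : freemod T V)) [tmap _]dx.
Qed.

(* With c = a r' b, the element y is a alpha(r') b r: modulo Q_n, alpha kills  *)
(* the trivial relation a r' b (x) r (x) 1 - a (x) r' (x) b r.                 *)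
Lemma Gr_exchange i j n c (r : sbtype R) : (i + j = n.+1)%N ->
  rel_ideal A c -> homog T i c -> homog T j (val r) ->
  exists2 y, Gr_pos n.+1 (c * val r, y) & fg n (c * (alpha r : T) - y).
Proof.
move=> ijn cI ci rj; have sF := fg_subgroup n.
have sG := Gr_subgroup (ltn 0) n.+1.
have [j0|j_gt0] := posnP j.
  have r0 : r = 0.
    by apply: val_inj; apply: (rel_low _ (rel_val_mem r) rj); rewrite j0.
  exists 0; first by rewrite r0 mulr0; case: sG.
  by rewrite r0 raddf0 mulr0 subr0; case: sF.
have := rel_span_gproj (n := i) cI; rewrite ci.
apply: (addspan_ind (Y := [set c | exists2 y, Gr_pos n.+1 (c * val r, y) &
  fg n (c * (alpha r : T) - y)])).
  split=> [|x1 x2 [y1 g1 f1] [y2 g2 f2]] /=.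
    by exists 0; rewrite !mul0r ?subr0; [case: sG | case: sF].
  exists (y1 - y2); rewrite !mulrBl; first exact: (subgroupB sG g1 g2).
  by rewrite subrACA; apply: (subgroupB sF f1 f2).
move=> _ [i' [j' [k' [a [r' [b [e ai [rR' rj'] bk' ->]]]]]]] /=.
pose s := rel_mk rR'.
exists (a * (alpha s : T) * (b * val r)).
  apply: addspan_gen; exists i', j', (k' + j)%N, a, s, (b * val r).
  rewrite -!mulrA; split=> //; last exact: homogM.
  by split; [rewrite addnA e | rewrite /= addn_gt0 j_gt0 orbT].
have [_ aF] := alphaF; have [au _] := aF j r rj; have [bu _] := aF j' s rj'.
have lr := alpha_low rj; have ls := @alpha_low j' s rj'.
(* Each of the two terms contains a difference alpha(r) - r or alpha(r') - r', whose degree is lower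
   by one; this is what brings Q_{n+1} down to Q_n. *)
have -> : a * r' * b * (alpha r : T) - a * (alpha s : T) * (b * val r) =
    a * (alpha s : T) * (b * ((alpha r : T) - val r)) -
    a * ((alpha s : T) - r') * b * (alpha r : T).
  by rewrite !(mulrBr, mulrBl) !mulrA subrACA subrr sub0r opprB.
apply: (subgroupB sF).
  apply: (@fg_gen i' j' (k' + j.-1)); [|exact: homog_upto|by exists s|exact: bu|].
    by rewrite addnA e -ltnS -ijn -[X in (_ < _ + X)%N](prednK j_gt0) addnS.
  exact: uptoM (homog_upto bk') lr.
have [j'0|j'_gt0] := posnP j'.
  have s0 : s = 0.
    by apply: val_inj; apply: (rel_low _ rR' rj'); rewrite j'0.
  have r'0 : r' = 0 by have := congr1 val s0.
  rewrite r'0 s0 raddf0 subr0 mulr0 !mul0r; by case: sF.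
rewrite -[_ * alpha r]mulr1.
apply: (@fg_gen (i' + j'.-1 + k') j 0);
  [|exact: uptoM (uptoM (homog_upto ai) ls) (homog_upto bk')|by exists r|exact: au|].
  by rewrite addn0 -ltnS -ijn -e -[X in (_ < _ + X + _ + _)%N](prednK j'_gt0) addnS !addSn.
apply: homog_upto; rewrite -(@sunit1 S T); exact: sunit_homog.
Qed.

(** A right factor b in T_+ is the sum of the delta(b)_v v. By left linearity of delta on T_+ the
    first components become the coordinates of [p.1]; if that is 0, each [W v] is a partner of 0 one
    degree lower. *)
Lemma Gr_pos_delta n p : Gr_pos n.+1 p -> exists2 W : freemod T V,
  p.2 = fsum (@tgen S V : V -> T^o) W & forall v, Gr_all n (delta kV p.1 v, W v).
Proof.
have sG := Gr_subgroup predT n.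
apply: (addspan_ind (Y := [set p | exists2 W : freemod T V,
  p.2 = fsum (@tgen S V : V -> T^o) W & forall v, Gr_all n (delta kV p.1 v, W v)])).
  split=> [|[x1 y1] [x2 y2] /= [W1 -> h1] [W2 -> h2]] /=.
    by exists 0; rewrite ?fsum0 // => v; rewrite [delta _ _]delta0; case: sG.
  exists (W1 - W2); first by rewrite fsumB.
  by move=> v; rewrite [delta _ _]deltaB; apply: (subgroupB sG (h1 v) (h2 v)).
move=> _ [i [j [[|k] [a [r [b [[e k_gt0] ai rj bk ->]]]]]]] //=.
have b0 : eps b = 0 := eps_homog k_gt0 bk.
exists ((a * (alpha r : T)) *: (delta kV b : freemod T V)).
  rewrite fsumZ; congr (_ * _).
  by have := fsum_delta kVE b; rewrite b0 sunit0 subr0 => ->.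
move=> v; rewrite [delta _ (_ * b)]delta_mul //; apply: addspan_gen.
exists i, j, k, a, r, (delta kV b v); split=> //; last exact: delta_homog bk.
by split=> //; apply/eqP; rewrite -eqSS -addnS e.
Qed.

(* The form of (J_n) that mentions neither T^{<= n} nor inhomogeneous elements.  *)
Definition jac n := forall y, Gr_all n.+1 (0, y) -> fg n y.

(** A product a r b of degree 1 contains a relation of degree at most 1, which is 0. *)
Lemma jac0 : jac 0.
Proof.
have sG : subgroup [set p : T * T | p = 0].
  by split=> // x y /= -> ->; rewrite subr0.
suff h : Gr_all 1 `<=` [set p : T * T | p = 0].
  by move=> y /h[->]; case: (fg_subgroup 0).
apply: addspan_ind => // _ [i [j [k [a [r [b [[e _] ai rj bk ->]]]]]]] /=.
have j1 : (j <= 1)%N by rewrite -e -addnA addnCA leq_addr.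
have -> : r = 0 by apply: val_inj; apply: (rel_low j1 (rel_val_mem r) rj).
by rewrite raddf0 !mulr0 !mul0r.
Qed.

Lemma Gr_free n (h : gfree T deg2) : homog (gfree T deg2) n h ->
  Gr_all n (fsum rhoT h, fsum alT h).
Proof.
move=> /gfree_homogP hn; have sG := Gr_subgroup predT n.
apply: (@fsum_ind2 _ _ T^o T^o rhoT alT (Gr_all n) h sG) => -[[d r]|v].
  have := hn (inl (d, r)); rewrite /=; case: ifP => [dn hd|_ ->]; last first.
    by rewrite !scale0r; case: sG.
  apply: addspan_gen; exists (n - d)%N, d, 0%N, (h (inl (d, r))), (rel_proj d r), 1.
  rewrite !mulr1 addn0 subnK //; split=> //; first exact: gproj_homog.
  rewrite -(@sunit1 S T); exact: sunit_homog.
have -> : rhoT (inr v) = 0 by [].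
have -> : alT (inr v) = 0 by apply: raddf0.
by rewrite !scaler0; case: sG.
Qed.

Lemma kRdB d : {morph kRd d : r s / r - s}.
Proof.
move=> r s; apply: freemodP => x; rewrite fcoefB !kRd_coef raddfB fcoefB.
by case: ifP => //; rewrite subr0.
Qed.
Lemma kRd0 d : kRd d 0 = 0.
Proof. by apply: freemodP => x; rewrite kRd_coef raddf0; case: ifP. Qed.
Lemma kRdZ d a r : kRd d (a *: r) = a *: kRd d r.
Proof.
apply: freemodP => x; rewrite fcoefZ !kRd_coef linearZ_LR fcoefZ.
by case: ifP => //; rewrite mulr0.
Qed.

Definition kRdT d r : gfree T deg2 := fmap (fun=> sunit) (kRd d r).
Lemma kRdTE d r (x : gen2) : kRdT d r x = sunit (kRd d r x).
Proof. by rewrite /kRdT fmapE // sunit0. Qed.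
Lemma fsum_rhoT_kRd d r : homog T d (val r) -> fsum rhoT (kRdT d r) = val r.
Proof.
move=> rd; rewrite -[r in RHS](kRdE rd).
by rewrite [RHS](@fsum_semilinear _ _ _ (@sunit S T) _ T^o
  (fun r : sbtype R => val r : T^o)) //; apply: sunit0.
Qed.
Lemma fsum_alT_kRd d r : homog T d (val r) -> fsum alT (kRdT d r) = alpha r.
Proof.
move=> rd; rewrite -[r in RHS](kRdE rd).
rewrite [RHS](@fsum_semilinear _ _ _ (@sunit S T) _ T^o
  (fun r : sbtype R => alpha r : T^o)) //.
- exact: sunit0.
- exact: raddfB.
- exact: linearZ_LR.
Qed.

Lemma kRdT_homog d r : homog (gfree T deg2) d (kRdT d r).
Proof.
apply/gfree_homogP => x; rewrite kRdTE.
have [<-|dx] := eqVneq (deg2 x) d; first by rewrite leqnn subnn; apply: sunit_homog.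
have -> : kRd d r x = 0 by rewrite kRd_coef; case: x dx => [p|v] //= /negPf ->.
rewrite sunit0; by case: ifP => // _; case: (homog_subgroup T (d - deg2 x)).
Qed.

Lemma thomog_left_ideal n x y : homog T n.+1 x -> rel_ideal A y ->
  setmulspan (homog T 1) (rel_ideal A : set T) (x * y).
Proof.
move=> /thomogSP + yI; set J := setmulspan _ _.
have sJ : subgroup J by exact: addspan_subgroup.
apply: (addspan_ind (Y := [set x | J (x * y)])).
  split=> [|a b] /=; first by rewrite mul0r; case: sJ.
  by rewrite mulrBl; apply: (subgroupB sJ).
move=> _ [v _ [z zn <-]] /=; rewrite -mulrA; apply: addspan_gen.
exists (tgen v); first exact: tgen_homog.
by exists (z * y) => //; apply: rel_idealMl.
Qed.

(* The coordinates h of p modulo T_+ R are the constants given by r0.         *)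
Lemma Gr_zero_coords n p : Gr (pred1 0%N) n p ->
  exists (h : gfree T deg2) (r0 : sbtype R), [/\ homog (gfree T deg2) n h,
    forall v, h (inr v) = 0, fsum rhoT h = p.1, fsum alT h = p.2 &
    (forall x : gen2, deg2 x = n -> h x = sunit (kRd n r0 x)) /\
    setmulspan (homog T 1) (rel_ideal A : set T) (p.1 - val r0)].
Proof.
have sJ : subgroup (setmulspan (homog T 1) (rel_ideal A : set T)).
  exact: addspan_subgroup.
apply: (addspan_ind (Y := [set p | exists (h : gfree T deg2) (r0 : sbtype R),
  [/\ homog (gfree T deg2) n h, forall v, h (inr v) = 0, fsum rhoT h = p.1,
    fsum alT h = p.2 & (forall x : gen2, deg2 x = n -> h x = sunit (kRd n r0 x)) /\
    setmulspan (homog T 1) (rel_ideal A : set T) (p.1 - val r0)]])).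
  split=> [|[x1 y1] [x2 y2] /= [h1 [r1 [hn1 hv1 <- <- [hc1 hJ1]]]]
      [h2 [r2 [hn2 hv2 <- <- [hc2 hJ2]]]]].
    exists 0, 0; rewrite !fsum0; split=> //.
      by case: (homog_subgroup (gfree T deg2) n).
    split=> [x _|]; last by rewrite /= subr0; case: sJ.
    by rewrite kRd0 [RHS]sunit0.
  exists (h1 - h2), (r1 - r2); rewrite !fsumB; split=> //.
  - exact: (subgroupB (homog_subgroup (gfree T deg2) n)).
  - by move=> v; rewrite [LHS]fcoefB hv1 hv2 subrr.
  split=> [x xn|]; last by rewrite /= subrACA; apply: (subgroupB sJ).
  rewrite [LHS]fcoefB hc1 // hc2 //.
  transitivity (sunit (kRd n r1 x - kRd n r2 x) : T).
    by apply: (addIr (sunit (kRd n r2 x))); rewrite -sunitD !subrK.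
  by congr sunit; rewrite -fcoefB -kRdB.
move=> _ [i [j [k [a [r [b [[e /eqP k0] ai rj bk ->]]]]]]].
rewrite {}k0 in e bk *; rewrite addn0 in e.
pose r' := rscale r (eps b); have [aR _] := alphaF.
have r'E : val r' = val r * b by rewrite [in RHS](thomog0P bk).
have ar'E : (alpha r' : T) = (alpha r : T) * b by rewrite [in RHS](thomog0P bk) aR.
have r'j : homog T j (val r') by rewrite r'E -(addn0 j); apply: homogM.
exists (a *: kRdT j r'); have hn : homog (gfree T deg2) n (a *: kRdT j r').
  by rewrite -e; apply: homogZ => //; apply: kRdT_homog.
have hv v : (a *: kRdT j r') (inr v) = 0 by rewrite [LHS]fcoefZ kRdTE kRd_coef /= sunit0 mulr0.
have h1 : fsum rhoT (a *: kRdT j r') = a * val r * b.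
  by rewrite fsumZ fsum_rhoT_kRd // r'E [LHS]mulrA.
have h2 : fsum alT (a *: kRdT j r') = a * (alpha r : T) * b.
  by rewrite fsumZ fsum_alT_kRd // ar'E [LHS]mulrA.
case: i ai e => [|i] ai e.
  exists (eps a *: r'); split=> //; split=> [x xn|].
    rewrite [LHS]fcoefZ kRdTE kRdZ fcoefZ sunitM -(thomog0P ai).
    by rewrite -e add0n.
  have -> : val (eps a *: r') = a * val r * b :> T.
    rewrite -mulrA -r'E [in RHS](thomog0P ai) //.
  by rewrite /= subrr; case: sJ.
exists 0; split=> //; split=> [x xn|].
  rewrite [LHS]fcoefZ kRdTE kRd0 [RHS]sunit0.
  have -> : kRd j r' x = 0.
    rewrite kRd_coef; case: x xn => [q|v] //= qn; rewrite qn -e; case: eqP => // /eqP.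
    by rewrite -[X in _ == X]add0n eqn_add2r.
  by rewrite sunit0 mulr0.
rewrite /= subr0 -mulrA -r'E; apply: thomog_left_ideal ai _.
exact/rel_sub/rel_val_mem.
Qed.

(** Terms with a scalar on the right can here be traded for terms with a positive right degree, at
    the price of an error in Q_n. The next three lemmas and [jac_step] carry out this trade. *)
Definition Gr_pos_mod n : set (T * T)%type :=
  [set p | exists2 y, Gr_pos n.+1 (p.1, y) & fg n (p.2 - y)].

Lemma Gr_pos_mod_subgroup n : subgroup (Gr_pos_mod n).
Proof.
have sG := Gr_subgroup (ltn 0) n.+1; have sF := fg_subgroup n.
split=> [|[x1 y1] [x2 y2] /= [z1 g1 f1] [z2 g2 f2]].
  by exists 0; [case: sG | rewrite /= subr0; case: sF].
exists (z1 - z2); first exact: (subgroupB sG g1 g2).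
by rewrite /= subrACA; apply: (subgroupB sF f1 f2).
Qed.

(** Coefficients in I_A are combinations of trivial syzygies, each handled by [Gr_exchange]. *)
Lemma Gr_pos_mod_ideal n (h : gfree T deg2) : homog (gfree T deg2) n.+1 h ->
  (forall x : gen2, rel_ideal A (h x)) -> Gr_pos_mod n (fsum rhoT h, fsum alT h).
Proof.
move=> /gfree_homogP hn hI; have sZ := Gr_pos_mod_subgroup n.
apply: (@fsum_ind2 _ _ T^o T^o rhoT alT (Gr_pos_mod n) h sZ) => -[[d r]|v].
  have := hn (inl (d, r)); rewrite [deg2 _]/=; case: ifP => [dn hd|_ ->]; last first.
    by rewrite !scale0r; case: sZ.
  have rd : homog T d (val (rel_proj d r)) by apply: gproj_homog.
  by have [y Gy Fy] := Gr_exchange (subnK dn) (hI (inl (d, r))) hd rd; exists y.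
have -> : rhoT (inr v) = 0 by [].
have -> : alT (inr v) = 0 by apply: raddf0.
by rewrite !scaler0; case: sZ.
Qed.

(** The product of the syzygy lies in I_A T^1 and so has a second partner in [Gr_pos]. By [jac n]
    the two partners differ by an element of Q_n, which v moves into Q_{n+1}. *)
Lemma Gr_pos_mod_ker n (h : gfree T deg2) : jac n -> homog (gfree T deg2) n.+1 h ->
  fsum phi2 (tmap h) = 0 -> forall v,
  Gr_pos_mod n.+1 (tgen v * fsum rhoT h, tgen v * fsum alT h).
Proof.
move=> Cn hn h0 v; have Gh := Gr_free hn.
have [y Gy] : exists y, Gr_pos n.+1 (fsum rhoT h, y).
  apply: Gr_pos_exists; first exact: (Gr_homog Gh).
    exact/rel_ideal_eps/fsum_rhoT_rel.
  exact: phi2_ker_lift.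
exists (tgen v * y); first exact: (Gr_Ml (tgen_homog v) Gy).
rewrite /= -mulrBr; apply: (fg_Ml (homog_upto (tgen_homog v))); apply: Cn.
have Gy' := Gr_sub (fun _ _ => isT) Gy.
have : Gr_all n.+1 (fsum rhoT h - fsum rhoT h, fsum alT h - y).
  exact: (subgroupB (Gr_subgroup predT n.+1) Gh Gy').
by rewrite subrr.
Qed.

(** The summand with scalar right factors is replaced by one with positive right degree modulo
    Q_{n+1}: its coordinates form a syzygy over A, which Tor decomposes. After that, one factor from
    V is removed on the right and [jac n] is applied. *)
Lemma jac_step (strongA : strongly_graded A) n :
  TorS_zero A 2 \/ TorS_zero_deg A 2 n.+2 -> jac n -> jac n.+1.
Proof.
move=> Tor Cn y /Gr_split[[t0 y0] [[t1 y1] [G0 G1 pE]]].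
have t01 : t0 + t1 = 0 := esym (congr1 fst pE).
have y01 : y0 + y1 = y := esym (congr1 snd pE).
have sF := fg_subgroup n.+1; have sZ := Gr_pos_mod_subgroup n.+1.
have [h [r0 [hn hv ht0 hy0 [hc hJ]]]] := Gr_zero_coords G0.
rewrite /= in ht0 hy0 hJ.
have t0E : t0 = - t1 by apply: (addIr t1); rewrite t01 addNr.
have dt0 : dbar t0 = 0 by rewrite t0E -sub0r dbarB (Gr_pos_dbar G1) dbar0 subr0.
have et0 : eps t0 = 0 := eps_homog (isT : (0 < n.+2)%N) (Gr_homog G0).
(* [t0] lies in I_A T^1 and [t0 - r0] in T^1 I_A, so [r0] lies in R and in T^1 I_A + I_A T^1, which
   meet in 0. *)
have r00 : r0 = 0.
  apply: val_inj; have [_ _ _ RJ] := relR.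
  suff : (sbset R `&` setadd (setmulspan (homog T 1) (rel_ideal A))
    (setmulspan (rel_ideal A) (homog T 1))) (val r0) by rewrite RJ.
  split; first exact: rel_val_mem.
  exists (- (t0 - val r0)); first exact: (subgroupN (addspan_subgroup _) hJ).
  by exists t0; [exact: dbar_ideal | rewrite opprB subrK].
have h0 : fsum phi2 (tmap h) = 0 by apply: phi2_ker_of_dbar => //; rewrite ht0.
(* A generator of degree n + 2 has as coefficient a scalar, namely a coordinate of [r0] = 0; one of
   lower degree has a coefficient of positive degree. *)
have haug (x : gen2) : augm (tmap h x) = 0.
  rewrite tmapE augm_tcan; have /gfree_homogP/(_ x) := hn.
  have [xn|xn|xn] := ltngtP (deg2 x) n.+2.
  - by apply: eps_homog; rewrite subn_gt0.
  - by move=> ->.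
  - by rewrite hc // r00 kRd0 [sunit _]sunit0.
(* [H] is a lift to T of the expression of [tmap h] through A^1-multiples of syzygies; [h - H] then
   has coefficients in I_A. *)
have [H [Hn HE HZ]] : exists H : gfree T deg2, [/\ homog (gfree T deg2) n.+2 H,
    tmap H = tmap h & Gr_pos_mod n.+1 (fsum rhoT H, fsum alT H)].
  move: (syzygy strongA Tor (tmap_homog hn) h0 haug).
  apply: (addspan_ind (Y := [set m | exists H : gfree T deg2,
    [/\ homog (gfree T deg2) n.+2 H, tmap H = m &
        Gr_pos_mod n.+1 (fsum rhoT H, fsum alT H)]])).
    split=> [|_ _ [H1 [Hn1 <- HZ1]] [H2 [Hn2 <- HZ2]]].
      exists 0; split; [by case: (homog_subgroup (gfree T deg2) n.+2)|exact: tmap0|].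
      by rewrite !fsum0; case: sZ.
    exists (H1 - H2); split; [|exact: tmapB|].
      exact: (subgroupB (homog_subgroup (gfree T deg2) n.+2)).
    by rewrite !fsumB; apply: (subgroupB sZ HZ1 HZ2).
  move=> _ [v _ [m [mn m0] <-]].
  have [H' Hn' HE'] := tmap_lift strongA mn.
  exists (tgen v *: H'); split.
  - exact: (homogZ 1 n.+1 _ _ (tgen_homog v) Hn').
  - by rewrite tmapZ HE' tcan_gen.
  - by rewrite !fsumZ; apply: Gr_pos_mod_ker => //; rewrite HE'.
have : Gr_pos_mod n.+1 (t0, y0).
  have hH : Gr_pos_mod n.+1 (fsum rhoT (h - H), fsum alT (h - H)).
    apply: Gr_pos_mod_ideal => [|x].
      exact: (subgroupB (homog_subgroup (gfree T deg2) n.+2)).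
    by rewrite /rel_ideal /= -(tmapE (h - H)) tmapB HE subrr.
  have : Gr_pos_mod n.+1
      (fsum rhoT (h - H) + fsum rhoT H, fsum alT (h - H) + fsum alT H).
    exact: (subgroupD sZ hH HZ).
  by rewrite !fsumB !subrK ht0 hy0.
move=> [y' G' F']; rewrite -y01 -[y0](subrK y') -addrA; apply: (subgroupD sF F').
have : Gr_pos n.+2 (t0 + t1, y' + y1).
  exact: (subgroupD (Gr_subgroup (ltn 0) n.+2) G' G1).
(* All right factors are positive now: splitting off the last v leaves partners of 0 in degree n +
   1, and [jac n] applies to them. *)
rewrite t01 => /Gr_pos_delta[W /= -> WG].
apply: (subgroup_sum _ sF) => v _; rewrite -addn1.
apply: (fg_Mr (homog_upto (tgen_homog v))); apply: Cn.
by have := WG v; rewrite [delta _ _]delta0.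
Qed.

Lemma jac_of_jacobi n : jacobi Q n -> jac n.
Proof.
move=> J y Gy; apply: J; split; first exact: (Gr_fg Gy).
have [yn yg] := Gr_upto Gy; move=> m; rewrite leq_eqVlt => /orP[/eqP <- //|].
exact: yn.
Qed.

Lemma alpha_upto N (r : sbtype R) : upto T N (val r) ->
  upto T N (alpha r) /\ gproj N (alpha r : T) = gproj N (val r : T).
Proof.
move=> rN; have [_ aF] := alphaF.
have rE : r = \sum_(d < N.+1) rel_proj d r.
  apply: val_inj; rewrite [LHS](gproj_recover rN).
  by rewrite (big_morph (val : sbtype R -> sbim T) (id1 := 0) (op1 := +%R)).
have aE : alpha r = \sum_(d < N.+1) alpha (rel_proj d r) :> T.
  by rewrite {1}rE raddf_sum.
have au d : upto T d (alpha (rel_proj d r)).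
  by have [] := aF d (rel_proj d r) (gproj_homog d _).
have ag d : gproj d (alpha (rel_proj d r) : T) = gproj d (val r : T).
  by have [_ ->] := aF d (rel_proj d r) (gproj_homog d _).
split=> [m Nm|].
  rewrite aE gproj_sum big1 // => d _; apply: au.
  exact: leq_ltn_trans (leq_ord d) Nm.
rewrite {1}aE gproj_sum big_ord_recr /= ag big1 ?add0r // => d _.
exact: au.
Qed.

(** Since alpha keeps top components, a component of r above degree j would survive in alpha(r).
    Hence Q^{<= j} is the image of R^{<= j}. *)
Lemma upto_of_alpha j (r : sbtype R) : upto T j (alpha r) -> upto T j (val r).
Proof.
move=> aj; have [N rN] := upto_fin (val r : T).
elim: N rN => [|N IH] rN; first exact: uptoS rN.
have [Nj|jN] := leqP N.+1 j; first exact: uptoS rN.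
apply: IH => m; rewrite leq_eqVlt => /orP[/eqP <-|]; last exact: rN.
by have [_ <-] := alpha_upto rN; apply: aj.
Qed.

Lemma fg_homog_gen n i j k x (r : sbtype R) y : (i + j + k <= n)%N ->
  homog T i x -> homog T j (val r) -> homog T k y ->
  fg n (x * (alpha r : T) * y).
Proof.
move=> le xi rj yk; have [_ /(_ j r rj)[au _]] := alphaF.
by apply: fg_gen le (homog_upto xi) _ au (homog_upto yk); exists r.
Qed.

Lemma jacobi_of_jac n : jac n -> jacobi Q n.
Proof.
move=> Cn x [xn1 xn].
have sG := Gr_subgroup predT n.+1; have sF := fg_subgroup n.
(* [W] writes x as a partner of its component of degree n + 1 plus an element of Q_n; when that
   component is 0, [jac n] covers the first summand. *)
pose W : set T := [set x | exists y z, [/\ Gr_all n.+1 (gproj n.+1 x, y), fg n z & x = y + z]].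
have sW : subgroup W.
  split=> [|x1 x2 [y1 [z1 [g1 f1 e1]]] [y2 [z2 [g2 f2 e2]]]].
    by exists 0, 0; rewrite gproj0 addr0; split=> //; [case: sG | case: sF].
  exists (y1 - y2), (z1 - z2); split; last by rewrite e1 e2 opprD addrACA.
    by rewrite gprojB; apply: (subgroupB sG g1 g2).
  exact: (subgroupB sF f1 f2).
suff [y [z [Gy Fz xE]]] : W x.
  by rewrite xE; apply: (subgroupD sF) => //; apply: Cn; rewrite -(xn n.+1).
move: xn1; apply: (addspan_ind sW) => {xn x}.
move=> _ [i [j [k [e [x [_ [y [xi [[r _ <-] /upto_of_alpha rj] yk ->]]]]]]]].
have -> : x * (alpha r : T) * y = \sum_(a < i.+1) \sum_(b < j.+1) \sum_(c < k.+1)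
    gproj a x * (alpha (rel_proj b r) : T) * gproj c y.
  have rE : alpha r = \sum_(d < j.+1) alpha (rel_proj d r) :> T.
    rewrite -[RHS](raddf_sum alpha); congr (alpha _); apply: val_inj.
    rewrite [LHS](gproj_recover rj).
    by rewrite (big_morph (val : sbtype R -> sbim T) (id1 := 0) (op1 := +%R)).
  rewrite {1}(gproj_recover xi) {1}rE {1}(gproj_recover yk).
  exact: (mulr_sum3 _ _ _ (fun a => gproj a x)
    (fun b => alpha (rel_proj b r) : T) (fun c => gproj c y)).
apply: (subgroup_sum _ sW) => a _; apply: (subgroup_sum _ sW) => b _.
apply: (subgroup_sum _ sW) => c _.
have rb : homog T b (val (rel_proj b r)) by apply: gproj_homog.
have abc : (a + b + c <= n.+1)%N by rewrite -e !leq_add ?leq_ord.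
move: abc; rewrite leq_eqVlt => /orP[/eqP abc|abc].
  exists (gproj a x * (alpha (rel_proj b r) : T) * gproj c y), 0.
  rewrite addr0; split=> //; last by case: sF.
  have Gx : Gr_all n.+1 (gproj a x * (val (rel_proj b r) : T) * gproj c y,
      gproj a x * (alpha (rel_proj b r) : T) * gproj c y).
    apply: addspan_gen; exists a, b, c, (gproj a x), (rel_proj b r), (gproj c y).
    by split=> //; apply: gproj_homog.
  by have [_ ->] := Gr_upto Gx.
exists 0, (gproj a x * (alpha (rel_proj b r) : T) * gproj c y).
split; last by rewrite add0r.
  have [au _] := alpha_upto (homog_upto rb).
  rewrite (uptoM (uptoM (homog_upto (gproj_homog a x)) au)
    (homog_upto (gproj_homog c y))) //.
  by case: sG.
by apply: (@fg_homog_gen n a b c) => //; apply: gproj_homog.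
Qed.

Lemma fg_le m n x : (m <= n)%N -> fg m x -> fg n x.
Proof.
move=> mn; have h1 : upto T (n - m) 1.
  apply: (@uptoS _ 0) => //; apply: homog_upto.
  by rewrite -(@sunit1 S T); apply: sunit_homog.
by move=> /(fg_Ml h1); rewrite mul1r subnK.
Qed.

Lemma gen_ideal_fg x : gen_ideal Q x -> exists n, fg n x.
Proof.
move=> /(_ [set x | exists n, fg n x]); apply; split; last first.
  move=> q [r _ <-]; have [N rN] := upto_fin (alpha r : T); exists N.
  have h1 : upto T 0 1.
    by apply: homog_upto; rewrite -(@sunit1 S T); apply: sunit_homog.
  rewrite -[alpha r](mulr1 (alpha r : T)) -[_ * 1]mul1r mulrA.
  by apply: (@fg_gen 0 N 0) => //; rewrite addn0.
split=> [|b y [n yn]].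
  split=> [|y z [m ym] [n zn]]; first by exists 0%N; case: (fg_subgroup 0).
  exists (maxn m n); apply: (subgroupB (fg_subgroup _)).
    exact: fg_le (leq_maxl _ _) ym.
  exact: fg_le (leq_maxr _ _) zn.
have [N bN] := upto_fin b.
by split; [exists (N + n)%N; apply: fg_Ml | exists (n + N)%N; apply: fg_Mr].
Qed.

Lemma fg_gen_ideal n x : fg n x -> gen_ideal Q x.
Proof.
have [sI IM] := gen_ideal_closed Q.
apply: (addspan_ind sI) => _ [i [j [k [_ [a [q [b [_ [Qq _] _ ->]]]]]]]].
have qI : gen_ideal Q q by move=> I [_]; apply.
have [aq _] := IM a q qI; by have [_] := IM b _ aq.
Qed.

(** The top component of a alpha(r) b is the product of the top components of a, r and b, with that
    of r in R. *)
Lemma fg_lead n x : fg n x -> rel_ideal A (gproj n x).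
Proof.
have sI := rel_ideal_subgroup A.
apply: (addspan_ind (Y := gproj n @^-1` rel_ideal A)).
  exact: (subgroup_preim (gprojB _) sI).
move=> _ [i [j [k [<- [a [_ [b [ai [[r _ <-] aj] bk ->]]]]]]]] /=.
have [_ ag] := alpha_upto (upto_of_alpha aj).
rewrite !homogM_top //; last exact: uptoM.
apply: rel_idealMr; apply: rel_idealMl; rewrite ag.
exact/rel_sub/rel_gproj/rel_val_mem.
Qed.

(** An element of <Q> lies in some Q_m; while m > n, the condition (J_{m-1}) lowers m by one. *)
Lemma jac_gen_ideal n x : (forall m, jac m) -> gen_ideal Q x -> upto T n x -> fg n x.
Proof.
move=> C /gen_ideal_fg[m xm] xn.
have [/fg_le|nm] := leqP m n; first exact.
have {nm} [d mE] : exists d, m = (n + d)%N.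
  by exists (m - n)%N; rewrite subnKC // ltnW.
subst m; elim: d xm => [|d IH]; first by rewrite addn0.
rewrite addnS => xm; apply: IH; apply: (jacobi_of_jac (C _)); split=> //.
exact: uptoS (leq_addr _ _) xn.
Qed.

End Lifting.

End DualBases.
Lemma gen_ideal_rel : gen_ideal rel_set = rel_ideal A.
Proof.
rewrite predeqE => x; split.
  move=> /(_ (rel_ideal A)); apply; split; last by move=> y; apply: rel_sub.
  split=> [|b y yI]; first exact: rel_ideal_subgroup.
  by split; [exact: rel_idealMl | exact: rel_idealMr].
move=> xI; have [sI IM] := gen_ideal_closed rel_set.
apply: (gproj_ind sI) => n; move: (rel_span_gproj (n := n) xI).
apply: (addspan_ind sI) => _ [i [j [k [a [r [b [_ _ [rR _] _ ->]]]]]]].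
have rI : gen_ideal rel_set r by move=> I [_]; apply.
have [ar _] := IM a r rI; by have [_] := IM b _ ar.
Qed.

End Relations.

(** * The complexity as a supremum of integers *)

Section SupremumInt.
Variable B : set nat.

Lemma nat_set_bounded_max : (exists M, forall n, B n -> (n <= M)%N) ->
  (exists n, B n) -> exists2 m, B m & forall n, B n -> (n <= m)%N.
Proof.
move=> [M BM] [n0 Bn0].
have ex : exists n, `[< B n >] by exists n0; apply/asboolP.
have bd n : `[< B n >] -> (n <= M)%N by move=> /asboolP/BM.
have [m /asboolP Bm mB] := ex_maxnP ex bd.
by exists m => // n Bn; apply: mB; apply/asboolP.
Qed.

(** [supremum] is an upper bound only if a least upper bound exists. Here it does: a maximum when B
    is bounded, and +oo otherwise. *)
Lemma supremum_int_ub n : B n ->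
  ((n%:Z - 1)%:E <= supremum -oo%E [set (n%:Z - 1)%:E | n in B])%E.
Proof.
move=> Bn; set E := [set _ | _ in _].
have E0 : E (n%:Z - 1)%:E by exists n.
suff [s sE] : supremums E !=set0.
  rewrite /supremum; case: eqP => [Ee|_]; first by rewrite Ee in E0.
  have [ub _] : supremums E (xget -oo%E (supremums E)) by apply: xgetPex; exists s.
  exact: ub.
have [bd|nbd] := pselect (exists M, forall n, B n -> (n <= M)%N).
  have [m Bm mB] := nat_set_bounded_max bd (ex_intro _ n Bn).
  exists (m%:Z - 1)%:E; split=> [_ [k Bk <-]|u]; last first.
    by move=> uE; apply: uE; exists m.
  by rewrite lee_fin lerB // lez_nat mB.
exists +oo%E; split=> [x _|u uE]; first exact: leey.
case: u uE => [r| |] uE; first 1 last; first exact: lexx.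
  by have := uE _ E0; rewrite leeNy_eq.
case: nbd; exists (absz (r + 1)) => k Bk.
have := uE _ (ex_intro2 _ _ k Bk erefl); rewrite lee_fin lerBlDr => kr.
by rewrite -lez_nat (le_trans kr) // lez_abs.
Qed.
End SupremumInt.

(** The internal degree is n + 1 because c(A) shifts internal degrees down by one. *)
Lemma Tor_zero_above (S : pzRingType) (A : connSRingType S) n :
  ~ (n%:Z%:E <= complexity A)%E -> TorS_zero A 2 \/ TorS_zero_deg A 2 n.+1.
Proof.
rewrite /complexity; case: asboolP => [T0 _|_ nle]; first by left.
right; apply: contrapT => Tn; apply: nle.
have := @supremum_int_ub [set n | ~ TorS_zero_deg A 2 n] n.+1 Tn.
by rewrite -addn1 PoszD addrK.
Qed.

(** * PBW-deformations and leading terms *)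

Section Symbols.
Variables (S : pzRingType) (T : gradedSRingType S) (R P : set T).
Implicit Types x y : T.

Lemma qcl0 (B : pzRingType) (I : set B) (idI : two_sided_ideal I) :
  qcl idI 0 = 0.
Proof. by rewrite -(subrr 0) qclD qclN subrr. Qed.

Lemma quotT_clB (X : set T) x y : quotT_cl X (x - y) = quotT_cl X x - quotT_cl X y.
Proof. by rewrite /quotT_cl qclD qclN. Qed.
Lemma quotT_cl0 (X : set T) : quotT_cl X 0 = 0. Proof. exact: qcl0. Qed.
Lemma quotT_cl_eq0 (X : set T) x : quotT_cl X x = 0 <-> gen_ideal X x.
Proof. by rewrite -(quotT_cl0 X) -[x in X in _ <-> X]subr0; apply: qclP. Qed.

Definition leading n x : Prop :=
  exists y, [/\ gen_ideal P y, upto T n y & gproj n y = x].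

(** If x is congruent modulo <P> to an element z of lower degree, then x - z lies in <P> with
    leading form x, and conversely. In degree 0 there is no room for z, as F^{-1} = 0. *)
Lemma filt_pred_leading n x : homog T n x ->
  filt_pred (quotT_filt P) n (quotT_cl P x) <-> leading n x.
Proof.
move=> xn; case: n xn => [|n] xn /=.
  rewrite quotT_cl_eq0; split=> [xP|[y [yP yn <-]]].
    by exists x; split=> //; exact: homog_upto.
  by have := gproj_recover yn; rewrite big_ord1 => <-.
split=> [[z zn zx]|[y [yP yn yx]]].
  exists (x - z); split.
  - by apply/quotT_cl_eq0; rewrite quotT_clB zx subrr.
  - apply: (subgroupB (upto_subgroup T n.+1)); first exact: homog_upto.
    exact: uptoS zn.
  - by rewrite gprojB xn zn ?subr0.
exists (x - y); last by rewrite quotT_clB ((quotT_cl_eq0 P y).2 yP) subr0.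
move=> m; rewrite leq_eqVlt => /orP[/eqP <-|nm]; first by rewrite gprojB yx xn subrr.
by rewrite gprojB yn // (homog_upto xn) // subrr.
Qed.

(** This is the injectivity of the graded map read off in degree n: a symbol vanishes exactly on the
    leading forms of <P>. *)
Lemma PBW_leading : PBW_deformation R P ->
  forall n x, homog T n x -> gen_ideal R x <-> leading n x.
Proof.
move=> [phi [psi phiK _] phiE] n x xn; rewrite -filt_pred_leading //.
have h0 : homog T n 0 by case: (homog_subgroup T n).
have := grclP (quotT_cl_filt P xn) (quotT_cl_filt P h0).
rewrite -!phiE quotT_cl0 subr0 => <-; rewrite -quotT_cl_eq0 -(quotT_cl0 R).
by split=> [->//|/(can_inj phiK)].
Qed.

Section Construction.
Hypothesis R_graded : forall n x, gen_ideal R x -> gen_ideal R (gproj n x).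
Hypothesis R_leading : forall n x, homog T n x -> gen_ideal R x <-> leading n x.

Fact symbol_filt x n : filt (quotT_filt P) n (quotT_cl P (gproj n x)).
Proof. exact/quotT_cl_filt/gproj_homog. Qed.
Fact symbol_fin x : exists N, forall n, (N <= n)%N -> quotT_cl P (gproj n x) = 0.
Proof.
have [N xN] := upto_fin x; exists N.+1 => n Nn.
by rewrite xN // quotT_cl0.
Qed.
(** Placing each component in its own step of the filtration gives a ring map from T to the Rees
    ring, from which the map to gr is obtained by passing to quotients. *)
Definition symbol x : rees (quotT_filt P) := Rees (symbol_filt x) (symbol_fin x).

Lemma symbolB : {morph symbol : x y / x - y}.
Proof. by move=> x y; apply: reesP => n /=; rewrite gprojB quotT_clB. Qed.
Lemma symbolM : {morph symbol : x y / x * y}.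
Proof.
move=> x y; apply: reesP => n /=; rewrite gprojM /rmul_val.
elim/big_rec2: _ => [|i a b _ <-]; first exact: quotT_cl0.
by rewrite /quotT_cl qclD qclM.
Qed.
Lemma symbol_homog n x (xn : homog T n x) : symbol x = rmono (quotT_cl_filt P xn).
Proof.
apply: reesP => m /=; rewrite /rmono_val; case: eqP => [->|/eqP mn]; first by rewrite xn.
by rewrite (homog_neq xn) // quotT_cl0.
Qed.

Let sidl := rees_pred_ideal (quotT_filt P).

Lemma symbol_pred x : rees_pred (symbol x) <-> gen_ideal R x.
Proof.
split=> [xP|xR n]; last first.
  apply/(filt_pred_leading (gproj_homog n x)).
  by apply/(R_leading (gproj_homog n x)); apply: R_graded.
have [sI _] := gen_ideal_closed R; apply: (gproj_ind sI) => n.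
apply/(R_leading (gproj_homog n x)); apply/(filt_pred_leading (gproj_homog n x)).
exact: xP.
Qed.

Definition symbol_map (q : quotT R) : gr (quotT_filt P) := qcl sidl (symbol (repr q)).

Lemma symbol_mapE x : symbol_map (quotT_cl R x) = qcl sidl (symbol x).
Proof. by apply/qclP; rewrite -symbolB; apply/symbol_pred; apply: qcl_repr. Qed.

Fact symbol_map_additive : {morph symbol_map : p q / p - q}.
Proof.
move=> p q; have [x ->] := qcl_surj p; have [y ->] := qcl_surj q.
have := quotT_clB R x y; rewrite /quotT_cl => <-.
by rewrite -!/(quotT_cl R _) !symbol_mapE symbolB qclD qclN.
Qed.
Fact symbol_map_mul : GRing.monoid_morphism symbol_map.
Proof.
split=> [|p q].
  have -> : 1 = quotT_cl R 1 by [].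
  have h1 : homog T 0 1 by rewrite -(@sunit1 S T); apply: sunit_homog.
  rewrite symbol_mapE (symbol_homog h1).
  by have -> : rmono (quotT_cl_filt P h1) = rone (quotT_filt P) by apply: reesP.
have [x ->] := qcl_surj p; have [y ->] := qcl_surj q.
by rewrite -qclM -!/(quotT_cl R _) !symbol_mapE symbolM qclM.
Qed.

Lemma symbol_map_bij : bijective symbol_map.
Proof.
have inj : injective symbol_map.
  move=> p q; have [x ->] := qcl_surj p; have [y ->] := qcl_surj q.
  rewrite -!/(quotT_cl R _) !symbol_mapE => /qclP; rewrite -symbolB => /symbol_pred.
  by move=> xy; apply/qclP.
(* If [x n] represents the degree n entry of q, so does its component of degree n: the rest lies in
   F^{n-1}. *)
have surj q : exists p, symbol_map p = q.
  have [g ->] := qcl_surj q.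
  have ex n : exists x, upto T n x /\ quotT_cl P x = g n.
    by have [x xn xg] := rval_filt g n; exists x.
  pose x n := projT1 (cid (ex n)).
  have [xn xg] : (forall n, upto T n (x n)) /\ forall n, quotT_cl P (x n) = g n.
    by split=> n; rewrite /x; case: cid => ? [].
  have [N gN] := rval_fin g.
  exists (quotT_cl R (\sum_(n < N) gproj n (x n))); rewrite symbol_mapE.
  apply/qclP => n; change (filt_pred (quotT_filt P) n
    (quotT_cl P (gproj n (\sum_(m < N) gproj m (x m))) - g n)).
  have [Nn|nN] := leqP N n.
    rewrite gN // subr0 gproj_sum big1 ?quotT_cl0.
      by case: (filt_pred_subgroup (quotT_filt P) n).
    by move=> m _; rewrite gproj_orth gtn_eqF // (leq_trans _ Nn).
  rewrite gproj_sum (bigD1 (Ordinal nN)) //= big1 => [|m mn]; last first.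
    rewrite gproj_orth; case: eqP => // e; case/eqP: mn; exact: val_inj.
  rewrite addr0 gproj_orth eqxx -xg -quotT_clB.
  case: n nN {xg} (xn n) => [|n] nN xn0 /=.
    by rewrite {2}(gproj_recover xn0) big_ord1 subrr quotT_cl0.
  exists (gproj n.+1 (x n.+1) - x n.+1) => // m.
  rewrite leq_eqVlt => /orP[/eqP <-|nm]; first by rewrite gprojB gproj_homog subrr.
  by rewrite gprojB (xn0 m nm) (homog_upto (gproj_homog _ _)) // subr0.
pose inv q := projT1 (cid (surj q)).
have invK q : symbol_map (inv q) = q by rewrite /inv; case: cid.
by exists inv => // p; apply: inj; rewrite invK.
Qed.

HB.instance Definition _ :=
  GRing.isZmodMorphism.Build (quotT R) (gr (quotT_filt P)) symbol_map symbol_map_additive.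
HB.instance Definition _ :=
  GRing.isMonoidMorphism.Build (quotT R) (gr (quotT_filt P)) symbol_map symbol_map_mul.

Lemma PBW_of_leading : PBW_deformation R P.
Proof.
exists symbol_map; first exact: symbol_map_bij.
by move=> n x xn; rewrite [LHS]symbol_mapE (symbol_homog xn).
Qed.

End Construction.
End Symbols.

Lemma sb_val_linear (S : pzRingType) (M : bimodType S) (X : subbimod M) a
    (x y : sbtype X) : val (a *: x + y) = a *: val x + val y.
Proof. by []. Qed.
Lemma sb_val_rscale (S : pzRingType) (M : bimodType S) (X : subbimod M) a
    (x : sbtype X) : val (rscale x a) = rscale (val x) a.
Proof. by []. Qed.

(** * Construction of alpha from the projectivity of R_P *)

Section FilteredLift.
Variables (S : pzRingType) (A : connSRingType S) (R P : subbimod (sbim (TA A))).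
Hypothesis relR : bimodule_of_relations R.
Hypothesis R_lead : sbset R `<=` sbset (lead P).
Hypothesis proj_lead : bimod_projective (sbtype (lead P)).
Local Notation T := (TA A).

Section Degree.
Variable n : nat.

Definition upto_part : set (sbim T) := sbset P `&` upto T n.

Fact upto_part_subgroup : subgroup upto_part.
Proof.
have [P0 PB] := sb_subgroup P; have [U0 UB] := upto_subgroup T n.
by split=> [|x y [Px ux] [Py uy]]; split=> //; [exact: PB | exact: UB].
Qed.
Fact upto_part_scale (s : S) x : upto_part x -> upto_part (s *: x).
Proof.
move=> [Px ux]; split; first exact: sb_scale.
exact: (uptoM (homog_upto (sunit_homog s)) ux).
Qed.
Fact upto_part_rscale x (s : S) : upto_part x -> upto_part (rscale x s).
Proof.
move=> [Px ux]; split; first exact: sb_rscale.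
by have := uptoM ux (homog_upto (sunit_homog s)); rewrite addn0.
Qed.
Definition upto_bimod : subbimod (sbim T) :=
  Subbimod upto_part_subgroup upto_part_scale upto_part_rscale.

Definition lead_part : set (sbim T) := [set x | exists2 y, upto_part y & gproj n (y : T) = x].

Fact lead_part_subgroup : subgroup lead_part.
Proof.
have [U0 UB] := upto_part_subgroup.
split=> [|_ _ [x ux <-] [y uy <-]]; first by exists 0 => //; apply: gproj0.
by exists (x - y); [exact: UB | exact: gprojB].
Qed.
Fact lead_part_scale (s : S) x : lead_part x -> lead_part (s *: x).
Proof.
move=> [y uy <-]; exists (s *: y); first exact: upto_part_scale.
exact: gprojZl.
Qed.
Fact lead_part_rscale x (s : S) : lead_part x -> lead_part (rscale x s).
Proof.
move=> [y uy <-]; exists (rscale y s); first exact: upto_part_rscale.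
exact: gprojZr.
Qed.
Definition lead_bimod : subbimod (sbim T) :=
  Subbimod lead_part_subgroup lead_part_scale lead_part_rscale.

Lemma top_mem (x : sbtype upto_bimod) : gproj n (val x : T) \in sbpred lead_bimod.
Proof. by apply/sbpredP; exists (val x) => //; exact: (elimT (sbpredP _ _) (valP x)). Qed.
Definition top (x : sbtype upto_bimod) : sbtype lead_bimod :=
  exist _ (gproj n (val x : T) : sbim T) (top_mem x).
Fact top_linear : linear top.
Proof. by move=> s x y; apply: val_inj; rewrite /= gprojD [in LHS]gprojZl. Qed.
HB.instance Definition _ :=
  GRing.isLinear.Build S (sbtype upto_bimod) (sbtype lead_bimod) _ top top_linear.

Lemma lead_top_mem (x : sbtype (lead P)) : gproj n (val x : T) \in sbpred lead_bimod.
Proof.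
apply/sbpredP; have /sbpredP/(_ n)[y uy yE] := valP x; exists y => //.
Qed.
Definition lead_top (x : sbtype (lead P)) : sbtype lead_bimod :=
  exist _ (gproj n (val x : T) : sbim T) (lead_top_mem x).
Fact lead_top_linear : linear lead_top.
Proof. by move=> s x y; apply: val_inj; rewrite /= gprojD [in LHS]gprojZl. Qed.
HB.instance Definition _ :=
  GRing.isLinear.Build S (sbtype (lead P)) (sbtype lead_bimod) _ lead_top lead_top_linear.

(** Taking degree n components maps P^{<= n} onto [lead_bimod] and sends R_P into it; projectivity
    of R_P as a bimodule lifts the second map along the first. *)
Lemma lead_lift : exists2 k : {linear sbtype (lead P) -> sbtype upto_bimod},
  rlinear k & forall x, gproj n (val (k x) : T) = gproj n (val x : T).
Proof.
have [||y|k kR kE] := @proj_lead _ _ top lead_top.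
- by move=> x a; apply: val_inj; rewrite /= [LHS]gprojZr.
- by move=> x a; apply: val_inj; rewrite /= [LHS]gprojZr.
- have /sbpredP[x ux xE] := valP y.
  by exists (exist _ x (introT (sbpredP upto_bimod x) ux)); apply: val_inj.
by exists k => // x; exact: (congr1 (fun z : sbtype lead_bimod => val z) (kE x)).
Qed.

End Degree.

Definition lift_at n : {linear sbtype (lead P) -> sbtype (upto_bimod n)} :=
  projT1 (cid2 (lead_lift n)).
Lemma lift_at_rlinear n : rlinear (lift_at n).
Proof. by rewrite /lift_at; case: cid2. Qed.
Lemma lift_atE n x : gproj n (val (lift_at n x) : T) = gproj n (val x : T).
Proof. by rewrite /lift_at; case: cid2. Qed.

Lemma rel_lead_mem (r : sbtype R) : val r \in sbpred (lead P).
Proof. by apply/sbpredP/R_lead/(elimT (sbpredP _ _) (valP r)). Qed.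
Definition rel_lead (r : sbtype R) : sbtype (lead P) :=
  exist _ (val r) (rel_lead_mem r).

Definition lift_term n (r : sbtype R) : sbim T :=
  val (lift_at n (rel_lead (rel_proj relR n r))).

Lemma lift_term_linear n : linear (lift_term n).
Proof.
move=> s x y; rewrite /lift_term.
have -> : rel_lead (rel_proj relR n (s *: x + y)) =
    s *: rel_lead (rel_proj relR n x) + rel_lead (rel_proj relR n y).
  by apply: val_inj; rewrite /= gprojD [in LHS]gprojZl.
by rewrite (linearP (lift_at n)) sb_val_linear.
Qed.
Lemma lift_term_rlinear n : forall r s, lift_term n (rscale r s) = rscale (lift_term n r) s.
Proof.
move=> x s; rewrite /lift_term.
have -> : rel_lead (rel_proj relR n (rscale x s)) = rscale (rel_lead (rel_proj relR n x)) s.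
  by apply: val_inj; rewrite /= [in LHS]gprojZr.
by rewrite lift_at_rlinear sb_val_rscale.
Qed.
Lemma lift_term0 n (r : sbtype R) : gproj n (val r : T) = 0 -> lift_term n r = 0.
Proof.
move=> r0; rewrite /lift_term; have -> : rel_lead (rel_proj relR n r) = 0 by apply: val_inj.
by rewrite raddf0.
Qed.
Lemma lift_term_mem n r : upto_part n (lift_term n r).
Proof. exact: (elimT (sbpredP (upto_bimod n) _) (valP _)). Qed.

(** Each component of r is lifted in its own degree, which makes the map filtered; the terms beyond
    the degree of r vanish, so the chosen bound does not matter. *)
Definition lift_sum (r : sbtype R) : sbim T :=
  \sum_(n < (projT1 (cid (upto_fin (val r : T)))).+1) lift_term n r.

Lemma lift_sumE N (r : sbtype R) : upto T N (val r) ->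
  lift_sum r = \sum_(n < N.+1) lift_term n r.
Proof.
move=> rN; rewrite /lift_sum; case: cid => K /= rK.
have aux L L' : (L <= L')%N -> upto T L (val r) ->
    \sum_(n < L'.+1) lift_term n r = \sum_(n < L.+1) lift_term n r.
  move=> LL' rL; rewrite (big_ord_widen _ (fun n => lift_term n r) (LL' : L < L'.+1)%N).
  rewrite [LHS](bigID (fun n : 'I_L'.+1 => (n < L.+1)%N)) /= [X in _ + X]big1 ?addr0 //.
  by move=> n; rewrite ltnS -ltnNge => Ln; apply/lift_term0/rL.
by case: (leqP K N) => [KN|/ltnW NK]; [rewrite (aux K N) | rewrite (aux N K)].
Qed.

Fact lift_sum_linear : linear lift_sum.
Proof.
move=> s x y; have [N xN] := upto_fin (val x : T); have [K yK] := upto_fin (val y : T).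
have xM := uptoS (leq_maxl N K) xN; have yM := uptoS (leq_maxr N K) yK.
rewrite (lift_sumE xM) (lift_sumE yM) (@lift_sumE (maxn N K)); last first.
  move=> m Mm; rewrite sb_val_linear.
  transitivity (sunit s * gproj m (val x : T) + gproj m (val y : T)).
    by rewrite -gprojZl -gprojD.
  by rewrite xM // yM // mulr0 addr0.
rewrite scaler_sumr -big_split; apply: eq_bigr => n _; exact: lift_term_linear.
Qed.
HB.instance Definition _ :=
  GRing.isLinear.Build S (sbtype R) (sbim T) _ lift_sum lift_sum_linear.

Lemma lift_sum_filtered : filtered_morphism lift_sum.
Proof.
split=> [x s|n r rn].
  change (lift_sum (rscale x s) = rscale (lift_sum x) s); have [N xN] := upto_fin (val x : T).
  rewrite (lift_sumE xN) (@lift_sumE N); last first.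
    by move=> m Nm; rewrite [LHS]gprojZr xN // mul0r.
  rewrite (big_morph (fun z : sbim T => rscale z s) (fun x y => rscaleDl x y s)
    (rscale0 (sbim T) s)).
  by apply: eq_bigr => n _; apply: lift_term_rlinear.
suff : upto T n (lift_sum r) /\ gproj n (lift_sum r : T) = val r by [].
have -> : lift_sum r = lift_term n r.
  rewrite (lift_sumE (homog_upto rn)) big_ord_recr /= big1 ?add0r // => i _.
  by apply: lift_term0; apply: homog_neq rn _; rewrite ltn_eqF.
have [_ un] := lift_term_mem n r; split; first exact: un.
by rewrite [LHS]lift_atE [LHS]gproj_homog.
Qed.

Lemma lift_sum_mem r : sbset P (lift_sum r).
Proof.
apply: (subgroup_sum _ (sb_subgroup P)) => n _.
by have [] := lift_term_mem n r.
Qed.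

End FilteredLift.

(** * From PBW to the filtration Q_n and back *)

Section Criterion.
Variables (S : pzRingType) (A : connSRingType S) (R P : subbimod (sbim (TA A))).
Hypothesis relR : bimodule_of_relations R.
Local Notation T := (TA A).

Lemma gen_ideal_rel_gproj n (x : T) :
  gen_ideal (sbset R : set T) x -> gen_ideal (sbset R : set T) (gproj n x).
Proof. by rewrite (gen_ideal_rel relR); apply: rel_ideal_gproj. Qed.

Lemma gen_ideal_sub (X Y : set T) : X `<=` gen_ideal Y -> gen_ideal X `<=` gen_ideal Y.
Proof. by move=> XY x; apply; split=> //; apply: gen_ideal_closed. Qed.

Section Alpha.
Variable alpha : {linear sbtype R -> sbim (TA A)}.
Hypothesis alphaF : filtered_morphism alpha.
Hypothesis alphaP : range alpha `<=` sbset P.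
Local Notation Q := (range alpha : set T).

Lemma range_gen_ideal : gen_ideal Q `<=` gen_ideal (sbset P : set T).
Proof. by apply: gen_ideal_sub => x /alphaP Px I [_]; apply. Qed.

Lemma leading_of_rel n (x : T) : homog T n x -> gen_ideal (sbset R : set T) x ->
  exists y, [/\ gen_ideal (sbset P : set T) y, filt_gen Q n y, upto T n y & gproj n y = x].
Proof.
rewrite (gen_ideal_rel relR) => xn xI.
have [y Gy] := Gr_rel_span alpha (rel_span_gproj relR (n := n) xI).
rewrite xn in Gy; have [yn yx] := Gr_upto alphaF Gy; have Fy := Gr_fg alphaF Gy.
by exists y; split=> //; apply: range_gen_ideal; apply: fg_gen_ideal Fy.
Qed.

(** By PBW the leading form of x lies in <R>, so it is also the leading form of some y in Q_n and
    <P>; x - y has lower degree, and induction applies. *)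
Lemma PBW_filt_gen : PBW_deformation (sbset R) (sbset P) ->
  forall n (x : T), gen_ideal (sbset P : set T) x -> upto T n x -> filt_gen Q n x.
Proof.
move=> PBW n x xP xn; have [sP _] := gen_ideal_closed (sbset P : set T).
have step m (z : T) : gen_ideal (sbset P : set T) z -> upto T m z ->
    exists y, [/\ gen_ideal (sbset P : set T) y, filt_gen Q m y, upto T m y &
                  gproj m y = gproj m z].
  move=> zP zm; apply: leading_of_rel (gproj_homog m z) _.
  by apply/(PBW_leading PBW (gproj_homog m z)); exists z.
elim: n x xP xn => [|n IH] x xP xn; have [y [yP Fy yn yx]] := step _ x xP xn.
  have := gproj_recover xn; rewrite big_ord1 -yx => ->.
  by have := gproj_recover yn; rewrite big_ord1 => <-.
rewrite -(subrK y x); apply: (subgroupD (fg_subgroup alpha n.+1)) => //.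
apply: (fg_le (leqnSn n)); apply: IH; first exact: (subgroupB sP).
move=> m; rewrite leq_eqVlt => /orP[/eqP <-|nm]; first by rewrite gprojB yx subrr.
by rewrite gprojB xn // yn // subrr.
Qed.

(** An element of <P> lies in <Q>, hence in the Q_n of its degree bound, and leading forms of Q_n
    are in I_A = <R>. Conversely, alpha turns a form of I_A into an element of <P> with that leading
    form. *)
Lemma PBW_of_jac : sbset P `<=` gen_ideal Q -> (forall n, jac alpha n) ->
  PBW_deformation (sbset R) (sbset P).
Proof.
move=> PQ C; apply: PBW_of_leading => [n x|n x xn]; first exact: gen_ideal_rel_gproj.
split=> [xR|[y [yP yn <-]]].
  by have [y [yP _ yn yx]] := leading_of_rel xn xR; exists y.
rewrite (gen_ideal_rel relR); apply: (fg_lead relR alphaF).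
exact: (jac_gen_ideal relR alphaF C (gen_ideal_sub PQ yP)).
Qed.

End Alpha.

Lemma PBW_lead_sub : PBW_deformation (sbset R) (sbset P) ->
  sbset (lead P) `<=` gen_ideal (sbset R : set T).
Proof.
move=> PBW x xL; have [sI _] := gen_ideal_closed (sbset R : set T).
apply: (gproj_ind sI) => n; apply/(PBW_leading PBW (gproj_homog n x)).
have [y [Py yn] yx] := xL n; exists y; split=> //.
by move=> I [_]; apply.
Qed.

End Criterion.

Theorem theorem5p5 (S : pzRingType) (A : connSRingType S)
    (R P : subbimod (sbim (TA A)))
    (strongA : strongly_graded A)
    (relR : bimodule_of_relations R)
    (R_lead : sbset R `<=` sbset (lead P))
    (projR : left_projective (sbtype R))
    (projA1 : left_projective (A1 A))
    (proj_lead : bimod_projective (sbtype (lead P))) :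
  PBW_deformation (sbset R) (sbset P) <->
  gen_ideal (sbset R : set (TA A)) = gen_ideal (sbset (lead P) : set (TA A)) /\
  exists alpha : {linear sbtype R -> sbim (TA A)},
    [/\ filtered_morphism alpha,
        range alpha `<=` sbset P,
        sbset P `<=` gen_ideal (range alpha : set (TA A)) &
        complexity A = (-1)%:E \/
        forall n : nat, (1 <= n)%N -> (n%:Z%:E <= complexity A)%E ->
          jacobi (range alpha : set (TA A)) n].
Proof.
split=> [PBW|[_ [alpha [alphaF alphaP PQ Jac]]]].
  split.
    rewrite eqEsubset; split; apply: gen_ideal_sub => x.
      by move=> xR I [_]; apply; apply: R_lead.
    exact: PBW_lead_sub.
  exists (lift_sum relR R_lead proj_lead : {linear _ -> _}).
  have aF := lift_sum_filtered relR R_lead proj_lead.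
  have aP : range (lift_sum relR R_lead proj_lead) `<=` sbset P.
    by move=> _ [r _ <-]; apply: lift_sum_mem.
  have PQ := PBW_filt_gen relR aF aP PBW.
  split=> //.
    move=> x Px; have [n xn] := upto_fin (x : TA A).
    by apply: fg_gen_ideal (PQ n x _ xn) => I [_]; apply.
  (* Q_{n+1} lies in <P>, so the inclusion [PQ] yields (J_n) for every n at once. *)
  right=> n _ _ x [xn1 xn]; apply: PQ => //.
  by apply: (range_gen_ideal aP); apply: fg_gen_ideal xn1.
apply: (PBW_of_jac relR alphaF alphaP PQ).
have [kV kVE] : exists k : {linear A1 A -> freemod S (A1 A)}, forall v, fsum id (k v) = v.
  by apply: left_projective_section => // v; exists (fbasis v); apply: fsum_basis.
have [kR kRE] := left_projective_section projR (rho_surj relR).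
elim=> [|n IH]; first exact: (jac0 relR).
(* Up to c(A) the Jacobi condition is assumed; beyond c(A) the vanishing of Tor propagates it. *)
have [le|nle] := pselect (n.+1%:Z%:E <= complexity A)%E; last first.
  exact: (jac_step kVE kRE alphaF strongA (Tor_zero_above nle) IH).
(* If c(A) = -1, no n + 1 is at most c(A), and this case does not occur. *)
case: Jac => [c1|Jac]; last exact: (jac_of_jacobi alphaF (Jac _ _ le)).
by rewrite c1 lee_fin in le.
Qed.
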